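(* MAJ-MAJ-$2$SAT is in $\mathsf{P}$. Moreover, given a 2-CNF $F$ over variables $x_1,\dots,x_n$ and $y_1,\dots,y_{n'}$ and parameters $\rho,\sigma \in (0,1)$, one can determine whether \[\Pr_{a \in \{0,1\}^n}\left[\Pr_{b \in \{0,1\}^{n'}}[F(a,b)=1] \geq \sigma \right] \geq \rho\] in $\mathrm{poly}(1/\rho) \cdot n^{O(\log(1/\sigma))}$ time (with $n$ taken as a bound on the total number of variables). Furthermore, when the answer is YES, the algorithm returns the exact number of $a\in\{0,1\}^n$ such that $\Pr_b[F(a,b)=1]\geq \sigma$.
   Context: A 2-CNF is a conjunction of clauses each with at most two literals. MAJ-MAJ-$2$SAT: given $n,n'$ and a 2-CNF $F$ over $n+n'$ variables, decide whether at least half of the assignments $a$ to the first $n$ variables are such that at least half of the assignments $b$ to the remaining $n'$ variables satisfy $F(a,b)$. Probabilities are over uniformly random assignments.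
   Formalization: The parameters ρ, σ are rational numbers given in the input, and the running time is bounded by poly(1/ρ)·n^{O(log(1/σ))} plus a polynomial in the input size, since the stated bound alone tends to a constant as σ tends to 1. *)

(* Defs.v *)
From mathcomp Require Import all_boot all_order all_algebra.
From mathcomp Require Import reals exp.

Set Implicit Arguments.
Unset Strict Implicit.
Unset Printing Implicit Defensive.

Import Order.TTheory GRing.Theory Num.Theory.
Local Open Scope ring_scope.

(* ------------------------------------------------------------------------ *)
(* Model of computation: the WHILE language over binary trees of N. Jones,  *)
(* Computability and Complexity from a Programming Perspective (MIT Press,  *)
(* 1997), where every elementary tree operation costs one unit of time.     *)
(* Since trees can be stored with sharing, each elementary operation        *)
(* allocates at most one cell; hence WHILE programs and Turing machines     *)
(* simulate each other with polynomial overhead, and polynomial time for    *)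
(* WHILE is the usual class P.                                              *)
(* ------------------------------------------------------------------------ *)

Inductive tree : Type := Nil | Cons of tree & tree.

Fixpoint tree_size (t : tree) : nat :=
  if t is Cons t1 t2 then (tree_size t1 + tree_size t2).+1 else 1%N.

Definition non_nil (t : tree) : bool := if t is Cons _ _ then true else false.

Inductive expr : Type :=
  | EVar of nat
  | ENil
  | ECons of expr & expr
  | EHd of expr
  | ETl of expr.

Inductive cmd : Type :=
  | Skip
  | Assign of nat & expr
  | Seq of cmd & cmd
  | If of expr & cmd & cmd
  | While of expr & cmd.

Definition store := nat -> tree.

Definition upd (s : store) (x : nat) (v : tree) : store :=
  fun y => if y == x then v else s y.

(* The head and the tail of Nil are Nil. *)
Fixpoint eval (s : store) (e : expr) : tree :=
  match e with
  | EVar x => s x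
  | ENil => Nil
  | ECons e1 e2 => Cons (eval s e1) (eval s e2)
  | EHd e1 => if eval s e1 is Cons t _ then t else Nil
  | ETl e1 => if eval s e1 is Cons _ t then t else Nil
  end.

Fixpoint expr_cost (e : expr) : nat :=
  match e with
  | EVar _ | ENil => 1
  | ECons e1 e2 => (expr_cost e1 + expr_cost e2).+1
  | EHd e1 | ETl e1 => (expr_cost e1).+1
  end%N.

(* exec c s s' t: started in store s, command c halts in store s' after     *)
(* exactly t time units; a diverging run is related to nothing.             *)
Inductive exec : cmd -> store -> store -> nat -> Prop :=
  | exec_skip s : exec Skip s s 1
  | exec_assign x e s :
      exec (Assign x e) s (upd s x (eval s e)) (expr_cost e).+1
  | exec_seq c1 c2 s1 s2 s3 t1 t2 :
      exec c1 s1 s2 t1 -> exec c2 s2 s3 t2 ->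
      exec (Seq c1 c2) s1 s3 (t1 + t2)%N
  | exec_if_true e c1 c2 s s' t :
      non_nil (eval s e) -> exec c1 s s' t ->
      exec (If e c1 c2) s s' ((expr_cost e).+1 + t)%N
  | exec_if_false e c1 c2 s s' t :
      ~~ non_nil (eval s e) -> exec c2 s s' t ->
      exec (If e c1 c2) s s' ((expr_cost e).+1 + t)%N
  | exec_while_true e c s1 s2 s3 t1 t2 :
      non_nil (eval s1 e) -> exec c s1 s2 t1 -> exec (While e c) s2 s3 t2 ->
      exec (While e c) s1 s3 ((expr_cost e).+1 + t1 + t2)%N
  | exec_while_false e c s :
      ~~ non_nil (eval s e) -> exec (While e c) s s (expr_cost e).+1.

(* The input is placed in variable 0, all other variables being Nil, and    *)
(* the output is read from variable 0.                                      *)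
Definition runs (p : cmd) (input output : tree) (t : nat) : Prop :=
  exists2 s : store,
    exec p (upd (fun=> Nil) 0%N input) s t & s 0%N = output.

Definition enc_bool (b : bool) : tree := if b then Cons Nil Nil else Nil.

Definition enc_list (T : Type) (f : T -> tree) (s : seq T) : tree :=
  foldr (fun x => Cons (f x)) Nil s.

Definition enc_option (T : Type) (f : T -> tree) (o : option T) : tree :=
  if o is Some x then Cons Nil (f x) else Nil.

Definition enc_unary (n : nat) : tree := enc_list enc_bool (nseq n false).

(* Least significant bit first, without leading zeros: up_log 2 n.+1 is the *)
(* bit length of n.                                                         *)
Definition bits (n : nat) : seq bool :=
  mkseq (fun i => odd (n %/ 2 ^ i)) (up_log 2 n.+1).

Definition enc_binary (n : nat) : tree := enc_list enc_bool (bits n).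

(* Only used for nonnegative q; numerator and denominator are coprime. *)
Definition enc_rat (q : rat) : tree :=
  Cons (enc_binary `|numq q|%N) (enc_binary `|denq q|%N).

Definition in_P (L : tree -> Prop) : Prop :=
  exists (p : cmd) (c : nat), forall x : tree,
    exists (b : bool) (t : nat),
      [/\ runs p x (enc_bool b) t, (b <-> L x) & (t <= c * tree_size x ^ c)%N].

(* ------------------------------------------------------------------------ *)
(* Formulas over two blocks of variables, x_1..x_n and y_1..y_n'.           *)
(* ------------------------------------------------------------------------ *)

Definition assignment (n : nat) := {ffun 'I_n -> bool}.

(* (v, true) is the positive literal v, (v, false) the negated one. *)
Definition literal (n n' : nat) := (('I_n + 'I_n') * bool)%type.
Definition clause (n n' : nat) := seq (literal n n').
Definition cnf (n n' : nat) := seq (clause n n').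

Definition is_2cnf (n n' : nat) (F : cnf n n') : bool :=
  all (fun C => size C <= 2)%N F.

Definition sat_literal (n n' : nat) (a : assignment n) (b : assignment n')
    (l : literal n n') : bool :=
  match l.1 with inl i => a i | inr j => b j end == l.2.

Definition sat (n n' : nat) (F : cnf n n')
    (a : assignment n) (b : assignment n') : bool :=
  all (has (sat_literal a b)) F.

(* Probability of P over a uniformly random element of T. *)
Definition Pr (T : finType) (P : pred T) : rat := #|P|%:R / #|T|%:R.

Definition heavy (n n' : nat) (F : cnf n n') (sigma : rat)
    (a : assignment n) : bool :=
  sigma <= Pr (fun b : assignment n' => sat F a b).

Definition threshold_yes (n n' : nat) (F : cnf n n') (rho sigma : rat) : bool :=
  rho <= Pr (heavy F sigma).

(* n and n' are encoded in unary, so that the size of an instance is at     *)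
(* least its number of variables.                                           *)
Definition enc_literal (n n' : nat) (l : literal n n') : tree :=
  Cons (enc_bool l.2)
       match l.1 with
       | inl i => Cons (enc_bool false) (enc_unary i)
       | inr j => Cons (enc_bool true) (enc_unary j)
       end.

Definition enc_cnf (n n' : nat) (F : cnf n n') : tree :=
  Cons (enc_unary n)
       (Cons (enc_unary n') (enc_list (enc_list (@enc_literal n n')) F)).

Definition enc_instance (n n' : nat) (F : cnf n n') (rho sigma : rat) : tree :=
  Cons (enc_cnf F) (Cons (enc_rat rho) (enc_rat sigma)).

Definition MAJ_MAJ_2SAT (x : tree) : Prop :=
  exists (n n' : nat) (F : cnf n n'),
    [/\ x = enc_cnf F, is_2cnf F & threshold_yes F (1 / 2) (1 / 2)].

(* None stands for the answer NO. *)
Definition threshold_count (n n' : nat) (F : cnf n n') (rho sigma : rat) :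
    option nat :=
  if threshold_yes F rho sigma then Some #|heavy F sigma| else None.

(* poly(1/rho) * n^(O(log(1/sigma))), with c bounding all hidden constants. *)
(* A running-time bound also needs a summand polynomial in the input size:  *)
(* the factor n^(c * ln(1/sigma)) tends to 1 as sigma tends to 1, and the   *)
(* clauses of F and the digits of rho and sigma have to be read.            *)
Definition threshold_time (R : realType) (c n : nat) (rho sigma : rat) : R :=
  c%:R * (ratr rho)^-1 ^+ c * (n%:R `^ (c%:R * ln (ratr sigma)^-1)).

(* Main.v *)
(* Branch on the clauses of F that only mention x: such a clause with two     *)

(* The objects of the proof are cubes: lists of literals on pairwise distinct variables. The x-part
   of such a cube contains exactly 2 ^ k assignments, k being the number of unassigned x-variables
   ([card_cons_x]), and likewise over y ([card_cons_y]). Three passes refine a list of cubes: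
   [xstage] over the clauses in x, [mstage] over the mixed clauses, [ystage] over the clauses in y.

   Three-way branching obeys a dichotomy, [split_total]: either no branch is cut and the leaves
   partition the solutions, or there are more variable-disjoint clauses than the budget. In the
   second case [card_disjoint_clauses] bounds the fraction of solutions by a power of 3/4, which
   lies strictly below the threshold ([few_solutions]); the computed count is smaller still
   ([split_total_le]), so the comparison with the threshold comes out right all the same. Over y
   this yields [heavy_leafE], over x the NO case of [answerE]. On mixed clauses, each a follows one
   path only, the one whose cube contains it, and that path is cut only if so many literals over y
   are forced that a cannot be heavy ([force_sumE], [force_sum_heavy]). Hence every a is counted
   exactly as often as it is heavy and covered by a leaf over x ([leaf_sums1]).

   For the time, a three-way branching with budget d has at most 3 ^ d leaves. At a mixed clause
   each option settles one of at most (2 (n + n')) ^ 2 distinct pairs of literals and one option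
   costs budget, whence [size_mstage_le_pow]. The budgets are differences of bit lengths, within a
   constant of log2 (1 / q); this gives poly(1 / rho) and n ^ O(log (1 / sigma)), and [main_time]
   turns the product of branch counts and polynomial overhead into the required sum.

   The algorithm is written in a small total language whose compilation to WHILE is correct with
   exact running time ([comp_correct]). For MAJ-MAJ-2SAT both thresholds are 1/2, so the budgets are
   constant and the time is polynomial; a syntactic check comes first, because membership in P
   concerns all trees. *)
(* unassigned variables has three satisfying assignments, and d nested        *)
(* branchings exhibit d variable-disjoint clauses, which are jointly          *)
(* satisfied with probability (3/4)^d; so depth O(log(1/rho)) suffices.  On   *)
(* a leaf, a mixed clause (z or l), z over x and l over y, either has z true  *)
(* or forces l; k forced literals leave Pr_b at most 2^-k, so at most         *)
(* O(log(1/sigma)) of the branchings of a path take the second option.  On    *)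
(* the resulting cube the formula in y no longer depends on the assignment    *)
(* of x, and it is counted by the same three-way branching with budget        *)
(* O(log(1/sigma)).  The cubes are disjoint, so the heavy assignments are     *)
(* counted by adding powers of 2.  A branch that runs out of its budget may   *)
(* simply be dropped: the count can only decrease, and it was too small.      *)
(* Leaves are disjoint non-empty cubes, so there are also at most 2^n of      *)
(* them, which matters when n + n' <= 1 and the time bound has no factor      *)
(* depending on sigma.                                                        *)
Require Import Defs.
From mathcomp Require Import all_boot all_order all_algebra.
From mathcomp Require Import reals exp.
From mathcomp Require Import zify ring lra.

Set Implicit Arguments.
Unset Strict Implicit.
Unset Printing Implicit Defensive.

(* [Nil] and [Cons] are also notations of seq. *)
Import Defs.
Import Order.TTheory GRing.Theory Num.Theory.
Local Open Scope nat_scope.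

(** * A total functional language compiled to WHILE *)

(* Variables are de Bruijn levels, so that weakening is free. The body of a   *)
(* [Fold] sees three more variables: the remaining list, the accumulator and  *)
(* the current element.                                                       *)
Inductive prog : Type :=
  | Ret of expr
  | Let of prog & prog
  | Ite of expr & prog & prog
  | Fold of expr & expr & prog
  | Call of prog & seq expr.

Definition hd (t : tree) : tree := if t is Cons x _ then x else Nil.
Definition tl (t : tree) : tree := if t is Cons _ x then x else Nil.

Fixpoint iter_tree (g : tree -> tree -> tree) (l acc : tree) : tree :=
  if l is Cons _ r then iter_tree g r (g l acc) else acc.

(** The 10 is the overhead of one round of the compiled loop: its test (2) and the three assignments
    around the body (3 + 2 + 3). *)
Fixpoint iter_cost (g : tree -> tree -> tree) (c : tree -> tree -> nat)
    (l acc : tree) : nat :=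
  if l is Cons _ r then c l acc + 10 + iter_cost g c r (g l acc) else 0.

Definition evl (env : seq tree) (e : expr) : tree := eval (nth Nil env) e.

Fixpoint den (p : prog) (env : seq tree) : tree :=
  match p with
  | Ret e => evl env e
  | Let p q => den q (env ++ [:: den p env])
  | Ite e p q => if evl env e is Cons _ _ then den p env else den q env
  | Fold l i p =>
      iter_tree (fun r acc => den p (env ++ [:: r; acc; hd r]))
        (evl env l) (evl env i)
  | Call p es => den p (map (evl env) es)
  end.

Fixpoint cost (p : prog) (env : seq tree) : nat :=
  match p with
  | Ret e => (expr_cost e).+1
  | Let p q => cost p env + cost q (env ++ [:: den p env]) + 2
  | Ite e p q =>
      (expr_cost e).+1 + if evl env e is Cons _ _ then cost p env else cost q env
  | Fold l i p =>
      (expr_cost l + expr_cost i + 6) +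
      iter_cost (fun r acc => den p (env ++ [:: r; acc; hd r]))
        (fun r acc => cost p (env ++ [:: r; acc; hd r]))
        (evl env l) (evl env i)
  | Call p es =>
      sumn [seq (expr_cost e).+1 | e <- es] + cost p (map (evl env) es) + 3
  end.

Fixpoint scoped (k : nat) (e : expr) : bool :=
  match e with
  | EVar x => x < k
  | ENil => true
  | ECons a b => scoped k a && scoped k b
  | EHd a | ETl a => scoped k a
  end.

Fixpoint closed (k : nat) (p : prog) : bool :=
  match p with
  | Ret e => scoped k e
  | Let p q => closed k p && closed k.+1 q
  | Ite e p q => [&& scoped k e, closed k p & closed k q]
  | Fold l i p => [&& scoped k l, scoped k i & closed k.+3 p]
  | Call p es => all (scoped k) es && closed (size es) p
  end.

Fixpoint shift (b : nat) (e : expr) : expr :=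
  match e with
  | EVar x => EVar (b + x)
  | ENil => ENil
  | ECons e1 e2 => ECons (shift b e1) (shift b e2)
  | EHd e => EHd (shift b e)
  | ETl e => ETl (shift b e)
  end.

Fixpoint load (b r : nat) (es : seq expr) : cmd :=
  if es is e :: es' then Seq (Assign r (shift b e)) (load b r.+1 es') else Skip.

(* The environment occupies the variables b, .., b + k - 1; the result goes   *)
(* to b + k, and everything above is scratch space.                           *)
Fixpoint comp (b k : nat) (p : prog) : cmd :=
  match p with
  | Ret e => Assign (b + k) (shift b e)
  | Let p q =>
      Seq (comp b k p) (Seq (comp b k.+1 q) (Assign (b + k) (EVar (b + k.+1))))
  | Ite e p q => If (shift b e) (comp b k p) (comp b k q)
  | Fold l i p =>
      Seq (Assign (b + k) (shift b l))
     (Seq (Assign (b + k.+1) (shift b i))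
     (Seq (While (EVar (b + k))
             (Seq (Assign (b + k.+2) (EHd (EVar (b + k))))
             (Seq (comp b k.+3 p)
             (Seq (Assign (b + k.+1) (EVar (b + k.+3)))
                  (Assign (b + k) (ETl (EVar (b + k))))))))
          (Assign (b + k) (EVar (b + k.+1)))))
  | Call p es =>
      Seq (load b (b + k) es)
     (Seq (comp (b + k) (size es) p)
          (Assign (b + k) (EVar (b + k + size es))))
  end.

Definition holds (b : nat) (env : seq tree) (s : store) : Prop :=
  forall i, i < size env -> s (b + i) = nth Nil env i.

Lemma eval_shift b env s e :
  holds b env s -> scoped (size env) e -> eval s (shift b e) = evl env e.
Proof.
rewrite /evl => H; elim: e => [x||e1 IH1 e2 IH2|e IH|e IH] //=.
- by move=> lx; exact: H.
- by case/andP=> s1 s2; rewrite IH1 ?IH2.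
- by move=> se; rewrite IH.
- by move=> se; rewrite IH.
Qed.

Lemma expr_cost_shift b e : expr_cost (shift b e) = expr_cost e.
Proof. by elim: e => //= [e1 -> e2 ->|e ->|e ->]. Qed.

Lemma updE s x v : upd s x v x = v.
Proof. by rewrite /upd eqxx. Qed.

Lemma upd_neq s x v y : y != x -> upd s x v y = s y.
Proof. by rewrite /upd => /negbTE->. Qed.

Lemma holds_upd b env s x v :
  b + size env <= x -> holds b env s -> holds b env (upd s x v).
Proof. by move=> le H i lti; rewrite upd_neq ?H //; lia. Qed.

Lemma holds_agree b env s s' :
  (forall j, j < b + size env -> s' j = s j) -> holds b env s -> holds b env s'.
Proof. by move=> agr H i lti; rewrite agr ?H //; lia. Qed.

Lemma holds_rcons b env s v :
  holds b env s -> s (b + size env) = v -> holds b (env ++ [:: v]) s.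
Proof.
move=> H sv i; rewrite size_cat /= addn1 ltnS leq_eqVlt nth_cat.
by case/orP=> [/eqP->|lti]; [rewrite ltnn subnn | rewrite lti H].
Qed.

Lemma exec_load b env es : all (scoped (size env)) es ->
  forall r s, b + size env <= r -> holds b env s ->
  exists s', [/\ exec (load b r es) s s' (sumn [seq (expr_cost e).+1 | e <- es]).+1,
    holds r (map (evl env) es) s' & forall j, j < r -> s' j = s j].
Proof.
elim: es => [_ r s le H|e es IH /= /andP[sce sces] r s le H].
  by exists s; split => //; exact: exec_skip.
have [|s' [ex H' agr]] := IH sces r.+1 (upd s r (evl env e)) _ (holds_upd _ le H).
  by lia.
exists s'; split=> [||j ltj]; last by rewrite agr ?upd_neq //; lia.
  rewrite -addnS; apply: exec_seq ex.
  rewrite -(eval_shift H sce) -(expr_cost_shift b); exact: exec_assign.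
case=> [|i] lti; first by rewrite addn0 agr //= updE.
by rewrite -addSnnS H'.
Qed.

(** The last conjunct is the frame condition: the environment survives, so that code run afterwards
    still finds it. *)
Definition computes (b : nat) (env : seq tree) (c : cmd) (p : prog) : Prop :=
  forall s, holds b env s -> exists s',
    [/\ exec c s s' (cost p env), s' (b + size env) = den p env
      & forall j, j < b + size env -> s' j = s j].

Lemma exec_fold b env p :
  (forall env', size env' = (size env).+3 ->
     computes b env' (comp b (size env).+3 p) p) ->
  forall acc ls s, holds b env s ->
    s (b + size env) = ls -> s (b + (size env).+1) = acc ->
  exists s', [/\ exec
    (While (EVar (b + size env))
             (Seq (Assign (b + (size env).+2) (EHd (EVar (b + size env))))
             (Seq (comp b (size env).+3 p)
             (Seq (Assign (b + (size env).+1) (EVar (b + (size env).+3)))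
                  (Assign (b + size env) (ETl (EVar (b + size env))))))))
    s s' (2 + iter_cost (fun r acc => den p (env ++ [:: r; acc; hd r]))
            (fun r acc => cost p (env ++ [:: r; acc; hd r])) ls acc),
    s' (b + (size env).+1) =
      iter_tree (fun r acc => den p (env ++ [:: r; acc; hd r])) ls acc
    & forall j, j < b + size env -> s' j = s j].
Proof.
move=> cp acc ls; elim: ls acc => [|x _ r IH] acc s H sl sa.
  exists s; split=> //=; have := @exec_while_false (EVar (b + size env)) _ s.
  by rewrite /= sl; apply.
set k := size env in H sl sa cp *.
pose s1 := upd s (b + k.+2) x.
have H1 : holds b (env ++ [:: Cons x r; acc; x]) s1.
  rewrite -[[:: _; _; _]]/([:: Cons x r] ++ [:: acc] ++ [:: x]) !catA.
  have e1 : size (env ++ [:: Cons x r]) = k.+1 by rewrite size_cat addn1.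
  have e2 : size ((env ++ [:: Cons x r]) ++ [:: acc]) = k.+2.
    by rewrite size_cat e1 addn1.
  apply: holds_rcons; last by rewrite e2 /s1 updE.
  apply: holds_rcons; last by rewrite e1 /s1 upd_neq ?sa //; lia.
  apply: holds_rcons; last by rewrite -/k /s1 upd_neq ?sl //; lia.
  by apply: holds_upd => //; rewrite -/k; lia.
have sz : size (env ++ [:: Cons x r; acc; x]) = k.+3 by rewrite size_cat addn3.
have [s2 [ex2 res2 agr2]] := cp _ sz s1 H1.
rewrite sz in res2 agr2.
pose s3 := upd s2 (b + k.+1) (s2 (b + k.+3)).
pose s4 := upd s3 (b + k) r.
have agr4 j : j < b + k -> s4 j = s j.
  move=> ltj; rewrite /s4 upd_neq /s3 ?upd_neq; [|lia|lia].
  by rewrite agr2; [rewrite /s1 upd_neq //; lia | lia].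
have [||s' [ex' res' agr']] := IH (s2 (b + k.+3)) s4 (holds_agree agr4 H).
- by rewrite /s4 updE.
- by rewrite /s4 upd_neq /s3 ?updE //; lia.
exists s'; split; last by move=> j ltj; rewrite agr' ?agr4.
  rewrite res2 in ex'.
  have -> : forall m1 m2, 2 + iter_cost m1 m2 (Cons x r) acc =
      (expr_cost (EVar (b + k))).+1 + (3 + (m2 (Cons x r) acc + (2 + 3))) +
      (2 + iter_cost m1 m2 r (m1 (Cons x r) acc)).
    by move=> m1 m2 /=; lia.
  apply: exec_while_true ex'; first by rewrite /= sl.
  apply: exec_seq (s1) _ _ _ _ _.
    have := exec_assign (b + k.+2) (EHd (EVar (b + k))) s.
    by rewrite /= sl.
  apply: exec_seq ex2 _; apply: exec_seq (s3) _ _ _ _ _.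
    exact: exec_assign.
  have := exec_assign (b + k) (ETl (EVar (b + k))) s3.
  have -> : eval s3 (ETl (EVar (b + k))) = r.
    rewrite /= /s3 upd_neq; last lia.
    by rewrite agr2 ?/s1 ?upd_neq ?sl //; lia.
  by [].
by rewrite res' res2.
Qed.

Theorem comp_correct p b env :
  closed (size env) p -> computes b env (comp b (size env) p) p.
Proof.
elim: p b env => [e|p IHp q IHq|e p IHp q IHq|l i p IHp|p IHp es] b env /=.
- move=> sce s H; exists (upd s (b + size env) (evl env e)).
  split; [|by rewrite updE|by move=> j ltj; rewrite upd_neq //; lia].
  rewrite /= -(eval_shift H sce) -(expr_cost_shift b); exact: exec_assign.
- move=> /andP[clp clq] s H.
  have [s1 [ex1 res1 agr1]] := IHp b env clp s H.
  have sz : size (env ++ [:: den p env]) = (size env).+1.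
    by rewrite size_cat addn1.
  have H1 := holds_rcons (holds_agree agr1 H) res1.
  have := IHq b (env ++ [:: den p env]); rewrite sz => /(_ clq).
  move=> /(_ s1 H1); rewrite sz => -[s2 [ex2 res2 agr2]].
  exists (upd s2 (b + size env) (s2 (b + (size env).+1))); split.
  + rewrite /= -addnA; apply: exec_seq ex1 _; apply: exec_seq ex2 _.
    exact: exec_assign.
  + by rewrite updE.
  + by move=> j ltj; rewrite upd_neq ?agr2 ?agr1 //; lia.
- move=> /and3P[sce clp clq] s H.
  have ev := eval_shift H sce.
  case E: (evl env e) ev => [|x y] ev; rewrite /computes /= E -(expr_cost_shift b).
    have [s1 [ex1 res1 agr1]] := IHq b env clq s H.
    by exists s1; split=> //; apply: exec_if_false ex1; rewrite ev.
  have [s1 [ex1 res1 agr1]] := IHp b env clp s H.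
  by exists s1; split=> //; apply: exec_if_true ex1; rewrite ev.
- move=> /and3P[scl sci clp] s H.
  set k := size env in scl sci clp *.
  pose s1 := upd s (b + k) (evl env l).
  pose s2 := upd s1 (b + k.+1) (evl env i).
  have H1 : holds b env s1 by apply: holds_upd.
  have H2 : holds b env s2 by apply: holds_upd => //; rewrite -/k; lia.
  have cp env' : size env' = k.+3 -> computes b env' (comp b k.+3 p) p.
    by move=> sz; rewrite -sz; apply: IHp; rewrite sz.
  have [||s3 [ex3 res3 agr3]] := exec_fold (acc := evl env i) (ls := evl env l) cp H2.
  + by rewrite /s2 upd_neq /s1 ?updE //; lia.
  + by rewrite /s2 updE.
  exists (upd s3 (b + k) (s3 (b + k.+1))); split.
  + rewrite /=; set c := iter_cost _ _ _ _ in ex3 *.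
    have -> : expr_cost l + expr_cost i + 6 + c =
        (expr_cost (shift b l)).+1 + ((expr_cost (shift b i)).+1 + (2 + c + 2)).
      by rewrite !expr_cost_shift; lia.
    apply: exec_seq (s1) _ _ _ _ _.
      by rewrite /s1 -(eval_shift H scl); apply: exec_assign.
    apply: exec_seq (s2) _ _ _ _ _.
      by rewrite /s2 -(eval_shift H1 sci); apply: exec_assign.
    apply: exec_seq ex3 _; exact: exec_assign.
  + by rewrite updE.
  + move=> j ltj; rewrite upd_neq; last lia.
    by rewrite agr3 // /s2 upd_neq /s1 ?upd_neq //; lia.
- move=> /andP[sces clp] s H.
  have [s1 [ex1 H1 agr1]] := exec_load sces (leqnn _) H.
  have := IHp (b + size env) (map (evl env) es); rewrite size_map.
  move=> /(_ clp s1 H1); rewrite size_map => -[s2 [ex2 res2 agr2]].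
  exists (upd s2 (b + size env) (s2 (b + size env + size es))); split.
  + rewrite /=; set c1 := sumn _ in ex1 *; set c2 := cost _ _ in ex2 *.
    have -> : c1 + c2 + 3 = c1.+1 + (c2 + 2) by lia.
    apply: exec_seq ex1 _; apply: exec_seq ex2 _; exact: exec_assign.
  + by rewrite updE.
  + by move=> j ltj; rewrite upd_neq ?agr2 ?agr1 //; lia.
Qed.

Definition program (p : prog) : cmd := Seq (comp 0 1 p) (Assign 0 (EVar 1)).

Lemma program_runs p x :
  closed 1 p -> runs (program p) x (den p [:: x]) (cost p [:: x] + 2).
Proof.
move=> clp.
have H : holds 0 [:: x] (upd (fun=> Nil) 0 x) by case.
have [s [ex res _]] := @comp_correct p 0 [:: x] clp _ H.
exists (upd s 0 (s 1)); last by rewrite updE.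
by apply: exec_seq ex _; apply: exec_assign.
Qed.

(* Higher-order syntax: a block is a program fragment that is still waiting   *)
(* for the size of its environment, i.e. for the first unused level.          *)
Definition block := nat -> prog.

Definition ret (e : expr) : block := fun=> Ret e.
Definition letb (p : block) (q : expr -> block) : block :=
  fun k => Let (p k) (q (EVar k) k.+1).
Definition ite (e : expr) (p q : block) : block := fun k => Ite e (p k) (q k).
Definition fold (l i : expr) (p : expr -> expr -> block) : block :=
  fun k => Fold l i (p (EVar k.+1) (EVar k.+2) k.+3).
Definition call (p : prog) (es : seq expr) : block := fun=> Call p es.

Definition fun1 (f : expr -> block) : prog := f (EVar 0) 1.
Definition fun2 (f : expr -> expr -> block) : prog := f (EVar 0) (EVar 1) 2.
Definition fun3 (f : expr -> expr -> expr -> block) : prog :=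
  f (EVar 0) (EVar 1) (EVar 2) 3.
Definition fun4 (f : expr -> expr -> expr -> expr -> block) : prog :=
  f (EVar 0) (EVar 1) (EVar 2) (EVar 3) 4.
Definition fun5 (f : expr -> expr -> expr -> expr -> expr -> block) : prog :=
  f (EVar 0) (EVar 1) (EVar 2) (EVar 3) (EVar 4) 5.

Definition ETrue : expr := ECons ENil ENil.

Notation "'LET' x ':=' p 'IN' q" := (letb p (fun x => q))
  (at level 200, x name, p at level 100, q at level 200, right associativity).

Notation enc_bits := (enc_list enc_bool).

Fixpoint len (t : tree) : nat := if t is Cons _ r then (len r).+1 else 0.

Lemma len_enc_list (T : Type) (f : T -> tree) s : len (enc_list f s) = size s.
Proof. by elim: s => //= x s ->. Qed.

Lemma len_enc_unary m : len (enc_unary m) = m.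
Proof. by rewrite len_enc_list size_nseq. Qed.

(** The bridge from loops to lists: a body that simulates [h] under the encodings [f] and [e] makes
    the loop compute [foldl h]. It gives the meaning of most folds below. *)
Lemma iter_treeE (T A : Type) (f : T -> tree) (e : A -> tree)
    (h : A -> T -> A) g :
  (forall x r a, g (Cons (f x) r) (e a) = e (h a x)) ->
  forall s a, iter_tree g (enc_list f s) (e a) = e (foldl h a s).
Proof. by move=> gE; elim=> //= x s IH a; rewrite gE IH. Qed.

Lemma iter_cost_le B g c l acc :
  (forall r a, c r a <= B) -> iter_cost g c l acc <= len l * (B + 10).
Proof.
move=> cB; elim: l acc => //= x _ r IH acc.
by rewrite mulSn leq_add // leq_add2r.
Qed.

Ltac split_tests := repeat match goal with
  | |- context [match ?x with Nil => _ | Cons _ _ => _ end] => destruct x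
  end.

(** * Lists, equality and binary arithmetic *)

Definition rev_prog : prog :=
  fun2 (fun l acc => fold l acc (fun acc x => ret (ECons x acc))).

Lemma den_rev (T : Type) (f : T -> tree) s s' :
  den rev_prog [:: enc_list f s; enc_list f s'] = enc_list f (catrev s s').
Proof.
rewrite /= /evl /= (@iter_treeE _ _ f (enc_list f) (fun a x => x :: a)) //.
by congr enc_list; elim: s s' => //= x s IH s'; rewrite IH.
Qed.

Lemma cost_rev l acc : cost rev_prog [:: l; acc] <= 15 * (len l).+1.
Proof.
rewrite /= /evl /=.
set g := fun r acc => _; set c := fun _ _ : tree => _.
have := @iter_cost_le 4 g c l acc (fun _ _ => leqnn _); lia.
Qed.

Definition eqbits_prog : prog :=
  fun2 (fun a b =>
    LET r := fold a (ECons ETrue b) (fun acc x =>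
      ite (EHd acc)
        (ite (ETl acc)
          (ite x
            (ite (EHd (ETl acc)) (ret (ECons ETrue (ETl (ETl acc)))) (ret ENil))
            (ite (EHd (ETl acc)) (ret ENil) (ret (ECons ETrue (ETl (ETl acc))))))
          (ret ENil))
        (ret ENil))
    IN ite (EHd r) (ite (ETl r) (ret ENil) (ret ETrue)) (ret ENil)).

Lemma den_eqbits s1 s2 :
  den eqbits_prog [:: enc_bits s1; enc_bits s2] = enc_bool (s1 == s2).
Proof.
rewrite /= /evl /=.
pose e (o : option (seq bool)) :=
  if o is Some s then Cons (enc_bool true) (enc_bits s) else Nil.
pose h (o : option (seq bool)) (x : bool) :=
  if o is Some (y :: s) then if x == y then Some s else None else None.
rewrite -[Cons (Cons Nil Nil) (enc_bits s2)]/(e (Some s2)).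
rewrite (@iter_treeE _ _ enc_bool e h); last by move=> [] r [[|[] s]|].
have -> : (s1 == s2) = (foldl h (Some s2) s1 == Some [::]).
  have hN : forall s, foldl h None s = None by elim.
  elim: s1 s2 => [|x s1 IH] [|y s2] //=; first by rewrite hN.
  by rewrite eqseq_cons; case: eqP => _; rewrite ?hN -?IH.
by case: foldl => [[|[] s]|].
Qed.

Lemma cost_eqbits a b : cost eqbits_prog [:: a; b] <= 50 * (len a).+1.
Proof.
rewrite /= /evl /=.
set g := fun r acc => _; set c := fun _ _ : tree => _.
have cB r x : c r x <= 30 by rewrite /c; split_tests; lia.
have := @iter_cost_le 30 g c a (Cons (Cons Nil Nil) b) cB.
move: (iter_cost _ _ _ _) (iter_tree _ _ _) => C r; split_tests; lia.
Qed.

#[global] Opaque rev_prog eqbits_prog.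

Fixpoint num (s : seq bool) : nat := if s is b :: s' then b + (num s').*2 else 0.

(** The default [true] makes the empty list, which represents 0, canonical. *)
Definition canonical (s : seq bool) : bool := last true s.

Lemma num_lt s : num s < 2 ^ size s.
Proof. by elim: s => //= b s IH; rewrite expnS; case: b => /=; lia. Qed.

Lemma canonical_num s : canonical s -> s != [::] -> 2 ^ (size s).-1 <= num s.
Proof.
rewrite /canonical; elim: s => //= b [|c s] IH //=; first by case: b.
move=> can _; have {IH} := IH can isT; rewrite /= expnS; lia.
Qed.

Lemma num_bits k v : v < 2 ^ k ->
  num (mkseq (fun i => odd (v %/ 2 ^ i)) k) = v.
Proof.
elim: k v => [|k IH] v ltv; first by rewrite expn0 in ltv; rewrite /=; lia.
rewrite /mkseq /= -[1]/(1 + 0) iotaDl -map_comp /= expn0 divn1.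
rewrite (eq_map (_ : _ =1 fun i => odd (v./2 %/ 2 ^ i))); last first.
  by move=> i /=; rewrite add1n expnS divnMA divn2.
rewrite IH; first by lia.
by move: ltv; rewrite expnS; lia.
Qed.

Lemma num_inj s1 s2 : canonical s1 -> canonical s2 -> num s1 = num s2 -> s1 = s2.
Proof.
rewrite /canonical; elim: s1 s2 => [|b s1 IH] [|c s2] //.
- by move=> _ can; have := canonical_num can isT; rewrite /=; lia.
- by move=> can _; have := canonical_num can isT; rewrite /=; lia.
move=> can1 can2 /= E.
have [-> E2] : b = c /\ num s1 = num s2 by case: b E {can1}; case: c {can2} => /= E; split=> //; lia.
congr cons; apply: IH E2.
- by move: can1; case: (s1).
- by move: can2; case: (s2).
Qed.

Lemma num_bitsE v : num (bits v) = v.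
Proof. by apply: num_bits; have := @up_logP 2 v.+1 isT; lia. Qed.

Lemma canonical_bits v : canonical (bits v).
Proof.
rewrite /canonical /bits; case: v => [|v]; first by rewrite up_log1.
have := @up_log_bounds 2 v.+2 isT isT.
case: up_log => [|k] // /andP[lo hi].
rewrite -nth_last size_mkseq nth_mkseq //=.
have -> : v.+1 %/ 2 ^ k = 1; last by [].
have p : 0 < 2 ^ k by rewrite expn_gt0.
apply/eqP; rewrite eqn_leq -ltnS ltn_divLR // leq_divRL // mul1n.
by move: lo hi; rewrite /= expnS => lo hi; apply/andP; split; lia.
Qed.

Lemma bits_num s : canonical s -> bits (num s) = s.
Proof.
by move=> can; apply: num_inj => //; rewrite ?canonical_bits ?num_bitsE.
Qed.

Lemma size_bits_le v k : v < 2 ^ k -> size (bits v) <= k.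
Proof.
move=> ltv; have := @canonical_num _ (canonical_bits v); rewrite num_bitsE.
case: (bits v) => [|b s] //= /(_ isT) le.
by have := leq_ltn_trans le ltv; rewrite ltn_exp2l.
Qed.

Lemma size_bits_mono v w : v <= w -> size (bits v) <= size (bits w).
Proof.
move=> le; apply: size_bits_le; apply: leq_ltn_trans le _.
by have := num_lt (bits w); rewrite num_bitsE.
Qed.

(** Pass one moves the [e] low bits to a stack, where the head of [Nil] supplies missing zeros; pass
    two increments the rest with a carry flag; the stack is reversed at the end. *)
Definition addpow_prog : prog :=
  fun2 (fun e b =>
    LET r := fold e (ECons ENil b) (fun acc _ =>
      ret (ECons (ECons (EHd (ETl acc)) (EHd acc)) (ETl (ETl acc))))
    IN LET r2 := fold (ETl r) (ECons ETrue (EHd r)) (fun acc x =>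
      ite (EHd acc)
        (ite x (ret (ECons ETrue (ECons ENil (ETl acc))))
               (ret (ECons ENil (ECons ETrue (ETl acc)))))
        (ret (ECons ENil (ECons x (ETl acc)))))
    IN ite (EHd r2)
         (call rev_prog [:: ECons ETrue (ETl r2); ENil])
         (call rev_prog [:: ETl r2; ENil])).

Fixpoint incr (s : seq bool) : seq bool :=
  match s with
  | [::] => [:: true]
  | true :: s' => false :: incr s'
  | false :: s' => true :: s'
  end.

Fixpoint addpow (e : nat) (s : seq bool) : seq bool :=
  if e is e'.+1 then head false s :: addpow e' (behead s) else incr s.

Lemma num_addpow e s : num (addpow e s) = 2 ^ e + num s.
Proof.
elim: e s => [|e IH] s /=.
  by rewrite expn0; elim: s => [|[] s IH] //=; rewrite ?IH; lia.
by rewrite IH expnS; case: s => [|b s] /=; lia.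
Qed.

Lemma canonical_addpow e s : canonical s -> canonical (addpow e s).
Proof.
have ne e' s' : addpow e' s' != [::] by case: e' s' => [|e'] [|[] s'].
have last_ne (x y : bool) t : t != [::] -> last x t = last y t by case: t.
rewrite /canonical; elim: e s => [|e IH] s can.
  elim: s can => [|[] s IH] //= can.
  by rewrite (last_ne _ true) ?IH //; case: (s) => [|[]].
    by case: (s) can.
rewrite /= (last_ne _ true) //; apply: IH.
by case: s can => [|b [|c s]].
Qed.

Lemma den_addpow e v :
  den addpow_prog [:: enc_unary e; enc_binary v] = enc_binary (2 ^ e + v).
Proof.
rewrite /enc_binary -{2}(num_bitsE v) -num_addpow bits_num; last first.
  exact/canonical_addpow/canonical_bits.
move: (bits v) => s; rewrite /= /evl /=.
pose e1 (a : seq bool * seq bool) := Cons (enc_bits a.1) (enc_bits a.2).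
pose h1 (a : seq bool * seq bool) (x : bool) :=
  (head false a.2 :: a.1, behead a.2).
rewrite -[Cons Nil (enc_bits s)]/(e1 ([::], s)) /enc_unary.
rewrite (@iter_treeE _ _ enc_bool e1 h1); last by move=> x r [u [|b t]].
set r := foldl _ _ _.
pose e2 (a : bool * seq bool) := Cons (enc_bool a.1) (enc_bits a.2).
pose h2 (a : bool * seq bool) (x : bool) :=
  if a.1 then (x, ~~ x :: a.2) else (false, x :: a.2).
rewrite -[Cons (Cons Nil Nil) _]/(e2 (true, r.1)) [RHS]/=.
rewrite [e1 r]/= (@iter_treeE _ _ enc_bool e2 h2); last by move=> [] ? [[] t].
set r2 := foldl _ _ _.
have -> : enc_bits (addpow e s) =
    enc_bits (catrev (if r2.1 then true :: r2.2 else r2.2) [::]).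
  congr enc_list; rewrite -/(rev _) {}/r2.
  (* Generalized over the stack [u] of bits already emitted; once the carry is gone the remaining
     bits are just copied. *)
  have h2E t u : let a := foldl h2 (true, u) t in
      rev (if a.1 then true :: a.2 else a.2) = catrev u (incr t).
    elim: t u => [|[] t IH] u //=; first by rewrite /h2 /= IH.
    have -> w : foldl h2 (false, w) t = (false, catrev t w).
      by elim: t w {IH} => //= b t IH w; rewrite IH.
    by rewrite /= /rev /= -[LHS]/(rev _) catrevE rev_cat revK catrevE rev_cons -cats1 -catA.
  rewrite h2E {}/r.
  have h1E u t : let a := foldl h1 (u, t) (nseq e false) in
      catrev a.1 (incr a.2) = catrev u (addpow e t).
    by elim: e u t => //= e IH u t; rewrite IH.
  by rewrite h1E.
rewrite -den_rev; move: r2 => [[] t] //=.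
Qed.

(** Bounds the length of intermediate lists, on which the cost of later passes depends. *)
Lemma iter_tree_mu (mu : tree -> nat) k g l acc :
  (forall r a, mu (g r a) <= mu a + k) ->
  mu (iter_tree g l acc) <= mu acc + len l * k.
Proof.
move=> gB; elim: l acc => [|x _ r IH] acc /=; first by rewrite addn0.
by apply: leq_trans (IH _) _; rewrite mulSn addnA leq_add2r.
Qed.

(** For bodies that are cheap only on the accumulators that occur: [P] is an invariant of the
    remaining list and the accumulator. *)
Lemma iter_cost_inv (T A : Type) (f : T -> tree) (e : A -> tree)
    (h : A -> T -> A) (P : seq T -> A -> Prop) B g c :
  (forall x r a, g (Cons (f x) r) (e a) = e (h a x)) ->
  (forall x s a, P (x :: s) a -> P s (h a x)) ->
  (forall x s r a, P (x :: s) a -> c (Cons (f x) r) (e a) <= B) ->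
  forall s a, P s a -> iter_cost g c (enc_list f s) (e a) <= size s * (B + 10).
Proof.
move=> gE hP cB; elim=> //= x s IH a Pa.
by rewrite gE mulSn leq_add ?IH ?leq_add2r //; [apply: cB Pa | apply: hP].
Qed.

Lemma cost_addpow e b : cost addpow_prog [:: e; b] <= 150 * (len e + len b).+1.
Proof.
rewrite /= /evl /=.
set g1 := fun r acc => _; set c1 := fun _ _ : tree => _.
have C1 := @iter_cost_le 20 g1 c1 e (Cons Nil b) (fun _ _ => isT).
(* Moving a bit from one list to the other preserves the total length, except that a zero is created
   when the source is exhausted. *)
pose mu t := len (hd t) + len (tl t).
have mu1 r a : mu (g1 r a) <= mu a + 1.
  by rewrite /mu /g1; case: a => [|x [|y z]] //=; lia.
have := @iter_tree_mu mu 1 g1 e (Cons Nil b) mu1.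
move: (iter_tree g1 _ _) (iter_cost g1 _ _ _) C1 => r C C1 M1 {mu1 c1 g1}.
set g2 := fun r acc => _; set c2 := fun _ _ : tree => _.
pose mu2 t := len (tl t).
have mu2E r' a : mu2 (g2 r' a) <= mu2 a + 1.
  rewrite /mu2 /g2; case: a => //= [x y]; last by split_tests => /=; lia.
have cB r' x : c2 r' x <= 30 by rewrite /c2; split_tests; lia.
set l2 := (X in iter_tree g2 X); set i2 := (X in iter_tree g2 _ X).
have C2 := @iter_cost_le 30 g2 c2 l2 i2 cB.
have M2 := @iter_tree_mu mu2 1 g2 l2 i2 mu2E.
move: (iter_tree g2 _ _) (iter_cost g2 _ _ _) C2 M2 => r2 D C2 M2 {mu2E c2 g2 cB}.
have L : len l2 + mu2 i2 <= len e + len b.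
  by move: M1; rewrite /mu /l2 /mu2 /i2 /=; case: (r) => //= *; lia.
have {L M2} [L M2] : len l2 <= len e + len b /\ len (tl r2) <= len e + len b.
  by rewrite -/(mu2 r2); lia.
case: r2 M2 => [|[|x y] z] /= M2; rewrite /evl /=.
- have := cost_rev Nil Nil; rewrite [len _]/=; lia.
- have := cost_rev z Nil; lia.
- have := cost_rev (Cons (Cons Nil Nil) z) Nil; rewrite [len _]/=; lia.
Qed.

#[global] Opaque addpow_prog.

(** Shift-and-add. Every product in the algorithm has a power of 2 as a factor, so no general
    multiplication is called for. *)
Definition addmul_prog : prog :=
  fun3 (fun e q v =>
    LET r := fold q (ECons e v) (fun acc x =>
      ite x
        (LET v' := call addpow_prog [:: EHd acc; ETl acc]
         IN ret (ECons (ECons ENil (EHd acc)) v'))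
        (ret (ECons (ECons ENil (EHd acc)) (ETl acc))))
    IN ret (ETl r)).

Definition addmul_step (a : nat * nat) (b : bool) :=
  (a.1.+1, if b then 2 ^ a.1 + a.2 else a.2).
Definition enc_nat2 (a : nat * nat) := Cons (enc_unary a.1) (enc_binary a.2).

Lemma den_addmul e q v :
  den addmul_prog [:: enc_unary e; enc_bits q; enc_binary v] =
  enc_binary (v + 2 ^ e * num q).
Proof.
rewrite /= /evl /= -[Cons (enc_unary e) _]/(enc_nat2 (e, v)).
rewrite (@iter_treeE _ _ enc_bool enc_nat2 addmul_step); last first.
  by move=> [] r [e' v'] //=; rewrite /evl /= den_addpow.
congr enc_binary; elim: q e v => [|b q IH] e v /=; first by rewrite muln0 addn0.
by rewrite IH expnS; move: (2 ^ _) (num _) => X Y; case: b => /=; nia.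
Qed.

Definition addmul_bd (m : nat) : nat := m * (150 * (2 * m).+1 + 40) + 40.

(** The accumulated value only grows, so the bit length of the final value bounds that of every
    intermediate one. *)
Lemma cost_addmul e q v m :
  e + size q <= m -> size (bits (v + 2 ^ e * num q)) <= m ->
  cost addmul_prog [:: enc_unary e; enc_bits q; enc_binary v] <= addmul_bd m.
Proof.
rewrite /= /evl /= -[Cons (enc_unary e) _]/(enc_nat2 (e, v)) => lee lev.
set g := fun r acc => _; set c := fun _ _ : tree => _.
pose P (s : seq bool) a :=
  a.1 + size s <= m /\ size (bits (a.2 + 2 ^ a.1 * num s)) <= m.
have := @iter_cost_inv _ _ enc_bool enc_nat2 addmul_step P
  (150 * (2 * m).+1 + 30) g c _ _ _ q (e, v) (conj lee lev).
rewrite /addmul_bd => /(_ _ _ _) le.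
suff : iter_cost g c (enc_bits q) (enc_nat2 (e, v)) <= size q * (150 * (2 * m).+1 + 30 + 10).
  by move: (iter_cost _ _ _ _) => C; nia.
apply: le.
- by move=> [] r [e' v'] //=; rewrite /g /= /evl /= den_addpow.
- move=> b s [e' v'] [/= le1 le2]; split=> /=; first by lia.
  by apply: leq_trans le2; apply: size_bits_mono; rewrite expnS;
  by move: (2 ^ _) (num _) => X Y; case: b => /=; nia.
move=> b s r [e' v'] [/= le1 le2]; rewrite /c /=; case: b le2 => le2; rewrite /= /evl /=; last by lia.
have := cost_addpow (enc_unary e') (enc_binary v').
rewrite len_enc_unary len_enc_list.
have : size (bits v') <= m by apply: leq_trans le2; apply: size_bits_mono; lia.
lia.
Qed.

(** Bits come least significant first: the flag compares the parts read so far, and a later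
    differing bit overrides it. Bits left over in [b] decide at once, since a canonical list ends in
    a 1. *)
Definition leq_prog : prog :=
  fun2 (fun a b =>
    LET r := fold a (ECons ETrue b) (fun acc x =>
      ite x
        (ite (EHd (ETl acc)) (ret (ECons (EHd acc) (ETl (ETl acc))))
                             (ret (ECons ENil (ETl (ETl acc)))))
        (ite (EHd (ETl acc)) (ret (ECons ETrue (ETl (ETl acc))))
                             (ret (ECons (EHd acc) (ETl (ETl acc))))))
    IN ite (ETl r) (ret ETrue) (ret (EHd r))).

Lemma den_leq u v :
  den leq_prog [:: enc_binary u; enc_binary v] = enc_bool (u <= v).
Proof.
have -> : (u <= v) = (num (bits u) <= num (bits v)) by rewrite !num_bitsE.
rewrite /= /evl /= /enc_binary.
have := canonical_bits v; move: (bits u) (bits v) => s t can.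
pose e (a : bool * seq bool) := Cons (enc_bool a.1) (enc_bits a.2).
pose h (a : bool * seq bool) (x : bool) :=
  (if x then (if head false a.2 then a.1 else false)
   else (if head false a.2 then true else a.1), behead a.2).
rewrite -[Cons (Cons Nil Nil) _]/(e (true, t)).
rewrite (@iter_treeE _ _ enc_bool e h); last by move=> [] r [f [|[] w]].
(* A flag that is false turns the comparison of the remaining parts into a strict one. *)
have gen f : (if f then num s <= num t else num s < num t) =
    (if (foldl h (f, t) s).2 is [::] then (foldl h (f, t) s).1 else true).
  elim: s f t can => [|x s IH] f t can /=.
    case: t can => [|y t] can; first by case: f.
    by have := canonical_num can isT; rewrite /=; case: f; lia.
  rewrite -IH; last by case: t can => [|y [|z t]].
  by case: t {can} => [|y t] /=; case: x; case: f => //=; try case: y; lia.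
rewrite (gen true) /=.
by case: foldl => f' [|y t'].
Qed.

Lemma cost_leq a b : cost leq_prog [:: a; b] <= 50 * (len a).+1.
Proof.
rewrite /= /evl /=.
set g := fun r acc => _; set c := fun _ _ : tree => _.
have cB r x : c r x <= 30 by rewrite /c; split_tests; lia.
have := @iter_cost_le 30 g c a (Cons (Cons Nil Nil) b) cB.
move: (iter_cost _ _ _ _) (iter_tree _ _ _) => C r; split_tests; lia.
Qed.

#[global] Opaque addmul_prog leq_prog.

(** * The programs on formulas *)

Lemma enc_binary0 : enc_binary 0 = Nil.
Proof. by rewrite /enc_binary /bits up_log1. Qed.

Definition unary_prog : prog :=
  fun1 (fun l => fold l ENil (fun acc _ => ret (ECons ENil acc))).

Definition triple_prog : prog :=
  fun1 (fun l => fold l ENil (fun acc _ =>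
    ret (ECons ENil (ECons ENil (ECons ENil acc))))).

(** Only the length of the result matters: the tail of [Nil] being [Nil], dropping elements is
    truncated subtraction of lengths. *)
Definition budget_prog : prog :=
  fun1 (fun q => fold (EHd q) (ECons ENil (ETl q)) (fun acc _ => ret (ETl acc))).

Definition test (s : bool) (e : expr) (p q : block) : block :=
  if s then ite e p q else ite e q p.

Definition room_prog (s : bool) : prog :=
  fun2 (fun m p => fold p m (fun acc l =>
    test s (EHd (ETl l)) (ret (ETl acc)) (ret acc))).

Definition neg_prog : prog :=
  fun1 (fun l => ite (EHd l) (ret (ECons ENil (ETl l))) (ret (ECons ETrue (ETl l)))).

Definition mem_prog : prog :=
  fun2 (fun l p => fold p ENil (fun acc x =>
    ite acc (ret acc) (call eqbits_prog [:: l; x]))).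

Definition split_prog : prog :=
  fun4 (fun z w st acc =>
    let push p := ECons (ECons (EHd st) p) acc in
    let pushS p acc := ECons (ECons (ETl (EHd st)) p) acc in
    let p := ETl st in
    LET tz := call mem_prog [:: z; p] IN
    ite tz (ret (ECons st acc))
   (LET tw := call mem_prog [:: w; p] IN
    ite tw (ret (ECons st acc))
   (LET nz := call neg_prog [:: z] IN
    LET taut := call eqbits_prog [:: nz; w] IN
    ite taut (ret (ECons st acc))
   (LET nw := call neg_prog [:: w] IN
    LET fz := call mem_prog [:: nz; p] IN
    LET fw := call mem_prog [:: nw; p] IN
    ite fz (ite fw (ret acc) (ret (push (ECons w p))))
   (ite fw (ret (push (ECons z p)))
   (LET eq := call eqbits_prog [:: z; w] IN
    ite eq (ret (push (ECons z p)))
   (ite (EHd st)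
     (ret (pushS (ECons z (ECons w p))
          (pushS (ECons z (ECons nw p))
          (pushS (ECons nz (ECons w p)) acc))))
     (ret acc)))))))).

Definition force_prog : prog :=
  fun4 (fun z l st acc =>
    let push p acc := ECons (ECons (EHd st) p) acc in
    let pushS p acc := ECons (ECons (ETl (EHd st)) p) acc in
    let p := ETl st in
    LET tz := call mem_prog [:: z; p] IN
    ite tz (ret (ECons st acc))
   (LET tl := call mem_prog [:: l; p] IN
    ite tl (ret (ECons st acc))
   (LET nz := call neg_prog [:: z] IN
    LET nl := call neg_prog [:: l] IN
    LET fz := call mem_prog [:: nz; p] IN
    LET fl := call mem_prog [:: nl; p] IN
    ite fl (ite fz (ret acc) (ret (push (ECons z p) acc)))
   (ite (EHd st)
     (ite fz (ret (pushS (ECons l p) acc))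
             (ret (push (ECons z p) (pushS (ECons nz (ECons l p)) acc))))
     (ite fz (ret acc) (ret (push (ECons z p) acc))))))).

(** A unit clause is treated as a clause with its literal repeated. *)
Definition second (c : expr) : block :=
  ite (ETl c) (ret (EHd (ETl c))) (ret (EHd c)).

Definition same_prog (s : bool) : prog :=
  fun1 (fun c => LET w := second c IN
    test s (EHd (ETl (EHd c)))
      (test s (EHd (ETl w)) (ret (ECons (EHd c) w)) (ret ENil)) (ret ENil)).

Definition mixed_prog : prog :=
  fun1 (fun c => LET w := second c IN
    ite (EHd (ETl (EHd c)))
      (ite (EHd (ETl w)) (ret ENil) (ret (ECons w (EHd c))))
      (ite (EHd (ETl w)) (ret (ECons (EHd c) w)) (ret ENil))).

Definition stage_prog (orient step : prog) : prog :=
  fun2 (fun F sts => fold F sts (fun sts C =>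
    ite C
      (LET p := call orient [:: C] IN
       ite p (fold sts ENil (fun acc st => call step [:: EHd p; ETl p; st; acc]))
             (ret sts))
      (ret ENil))).

Definition xstage_prog : prog := stage_prog (same_prog false) split_prog.
Definition ystage_prog : prog := stage_prog (same_prog true) split_prog.
Definition mstage_prog : prog := stage_prog mixed_prog force_prog.

Definition heavy_prog : prog :=
  fun5 (fun m F q d p =>
    LET ys := call ystage_prog [:: F; ECons (ECons d p) ENil] IN
    LET v := fold ys ENil (fun acc st =>
      LET e := call (room_prog true) [:: m; ETl st]
      IN call addmul_prog [:: e; ETl q; acc]) IN
    LET r := call addmul_prog [:: m; EHd q; ENil] IN
    call leq_prog [:: r; v]).

(** The second sum is the count multiplied in advance by the denominator of rho, ready for the final
    comparison. *)
Definition leaf_prog : prog :=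
  fun5 (fun n q h p acc =>
    ite h
      (LET e := call (room_prog false) [:: n; p] IN
       LET c := call addmul_prog [:: e; ECons ETrue ENil; EHd acc] IN
       LET t := call addmul_prog [:: e; ETl q; ETl acc] IN
       ret (ECons c t))
      (ret acc)).

Definition main_prog : prog :=
  fun1 (fun x =>
    let n := EHd (EHd x) in
    let m := EHd (ETl (EHd x)) in
    let F := ETl (ETl (EHd x)) in
    let rho := EHd (ETl x) in
    let sigma := ETl (ETl x) in
    LET b := call budget_prog [:: rho] IN
    LET dr := call triple_prog [:: b] IN
    LET c := call budget_prog [:: sigma] IN
    LET k := call unary_prog [:: c] IN
    LET ds := call triple_prog [:: c] IN
    LET xs := call xstage_prog [:: F; ECons (ECons dr ENil) ENil] IN
    LET r := fold xs (ECons ENil ENil) (fun acc st =>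
      LET ms := call mstage_prog [:: F; ECons (ECons k (ETl st)) ENil] IN
      fold ms acc (fun acc st' =>
        LET h := call heavy_prog [:: m; F; sigma; ds; ETl st'] IN
        call leaf_prog [:: n; rho; h; ETl st'; acc])) IN
    LET t := call addmul_prog [:: n; EHd rho; ENil] IN
    LET yes := call leq_prog [:: t; ETl r] IN
    ite yes (ret (ECons ENil (EHd r))) (ret ENil)).

Lemma den_unary l : den unary_prog [:: l] = enc_unary (len l).
Proof.
have E k : iter_tree (fun _ acc => Cons Nil acc) l (enc_unary k) =
    enc_unary (len l + k).
  by elim: l k => //= _ _ l IH k; rewrite (IH k.+1) addnS.
by have := E 0; rewrite addn0.
Qed.

Lemma den_triple l : den triple_prog [:: l] = enc_unary (3 * len l).
Proof.
have E k : iter_tree (fun _ acc => Cons Nil (Cons Nil (Cons Nil acc))) l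
    (enc_unary k) = enc_unary (3 * len l + k).
  elim: l k => //= _ _ l IH k; rewrite (IH k.+3); congr enc_unary; lia.
by have := E 0; rewrite addn0.
Qed.

Lemma len_budget a b : len (den budget_prog [:: Cons a b]) = (len b).+1 - len a.
Proof.
rewrite /= /evl /= -[(len b).+1]/(len (Cons Nil b)).
elim: a (Cons Nil b) => [|y _ a IH] c; rewrite ?subn0 //= IH.
by case: c => [|x c] /=; rewrite ?sub0n // subSS.
Qed.

Lemma cost_unary l : cost unary_prog [:: l] <= 30 * (len l).+1.
Proof.
rewrite /= /evl /=; set g := fun r acc => _; set c := fun _ _ : tree => _.
have := @iter_cost_le 10 g c l Nil (fun _ _ => isT); lia.
Qed.

Lemma cost_triple l : cost triple_prog [:: l] <= 30 * (len l).+1.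
Proof.
rewrite /= /evl /=; set g := fun r acc => _; set c := fun _ _ : tree => _.
have := @iter_cost_le 10 g c l Nil (fun _ _ => isT); lia.
Qed.

Lemma cost_budget a b : cost budget_prog [:: Cons a b] <= 30 * (len a).+1.
Proof.
rewrite /= /evl /=; set g := fun r acc => _; set c := fun _ _ : tree => _.
have := @iter_cost_le 10 g c a (Cons Nil b) (fun _ _ => isT); lia.
Qed.

Lemma cost_room s m p : cost (room_prog s) [:: m; p] <= 40 * (len p).+1.
Proof.
rewrite /room_prog; case: s; rewrite /= /evl /=;
set g := fun r acc => _; set c := fun _ _ : tree => _;
(have cB r x : c r x <= 20 by rewrite /c; split_tests; lia);
have := @iter_cost_le 20 g c p m cB; lia.
Qed.

Lemma cost_neg l : cost neg_prog [:: l] <= 20.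
Proof. by rewrite /= /evl /=; split_tests. Qed.

Definition mem_bd (m : nat) : nat := m * (50 * m.+1 + 40) + 20.

Lemma cost_mem l p m :
  len l <= m -> len p <= m -> cost mem_prog [:: l; p] <= mem_bd m.
Proof.
rewrite /= /evl /= => lel lep.
set g := fun r acc => _; set c := fun _ _ : tree => _.
have cB r x : c r x <= 50 * m.+1 + 30.
  by rewrite /c; split_tests; rewrite /= /evl /=; last lia;
    have := cost_eqbits l (hd r); lia.
have := @iter_cost_le _ g c p Nil cB; rewrite /mem_bd.
move: (iter_cost _ _ _ _) => C; nia.
Qed.

(** * Cubes, states and the branching steps as functions on formulas *)

Section Formulas.

Variables n n' : nat.
Notation lit := (literal n n').
Notation enc_cube := (enc_list (@enc_literal n n')).
Implicit Types (l z w : lit) (p : seq lit).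

Definition side l : bool := if l.1 is inr _ then true else false.
Definition neg l : lit := (l.1, ~~ l.2).

(** An encoded literal is also an encoded bit string, so [eqbits_prog] compares literals. *)
Definition lit_bits l : seq bool :=
  [:: l.2, side l & nseq (match l.1 with inl i => i : nat | inr j => j : nat end) false].

Lemma enc_literalE l : enc_literal l = enc_bits (lit_bits l).
Proof. by case: l => [[i|j] b]. Qed.

Lemma lit_bits_inj : injective lit_bits.
Proof.
move=> [[i|j] b] [[i'|j'] b'] //= [-> /(congr1 size)]; rewrite !size_nseq.
- by move=> /val_inj->.
- by move=> /val_inj->.
Qed.

Lemma den_eqlit l z :
  den eqbits_prog [:: enc_literal l; enc_literal z] = enc_bool (l == z).
Proof. by rewrite !enc_literalE den_eqbits (inj_eq lit_bits_inj). Qed.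

Lemma den_neg l : den neg_prog [:: enc_literal l] = enc_literal (neg l).
Proof. by case: l => [x []]. Qed.

Lemma den_mem l p :
  den mem_prog [:: enc_literal l; enc_cube p] = enc_bool (l \in p).
Proof.
rewrite /= /evl /=; pose h b z := b || (l == z).
rewrite -[Nil]/(enc_bool false) (@iter_treeE _ _ (@enc_literal n n') enc_bool h).
  congr enc_bool; rewrite -[RHS]orFb; elim: p false => [|z p IH] b /=.
    by rewrite orbF.
  by rewrite IH in_cons orbA.
by move=> z r [] //=; rewrite den_eqlit.
Qed.

(** The number of variables left free out of [k], i.e. the logarithm of the size of the cube on side
    [s]. The truncation never bites on an independent cube, by [pow2_le]. *)
Definition room (s : bool) (k : nat) p : nat := k - count (fun l => side l == s) p.

Lemma den_room s k p :
  den (room_prog s) [:: enc_unary k; enc_cube p] = enc_unary (room s k p).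
Proof.
case: s; rewrite /= /evl /=.
- rewrite (@iter_treeE _ _ (@enc_literal n n') enc_unary
    (fun k l => if side l == true then k.-1 else k)); last first.
    by move=> [[i|j] b] r [|a].
  congr enc_unary; elim: p k => [|l p IH] k /=; first by rewrite /room subn0.
  by rewrite IH /room /=; case: eqP; lia.
- rewrite (@iter_treeE _ _ (@enc_literal n n') enc_unary
    (fun k l => if side l == false then k.-1 else k)); last first.
    by move=> [[i|j] b] r [|a].
  congr enc_unary; elim: p k => [|l p IH] k /=; first by rewrite /room subn0.
  by rewrite IH /room /=; case: eqP; lia.
Qed.

#[local] Opaque unary_prog triple_prog budget_prog neg_prog mem_prog room_prog.

Definition state := (nat * seq lit)%type.

Definition enc_state (st : state) : tree := Cons (enc_unary st.1) (enc_cube st.2).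

Notation enc_states := (enc_list enc_state).

(** Only a clause with two distinct unassigned variables branches and uses budget; its three cubes
    are the satisfying assignments of the clause, hence disjoint. Unit propagation is free, and a
    branching due at budget 0 is dropped. *)
Definition split_step z w (st : state) : seq state :=
  let: (t, p) := st in
  if [|| z \in p, w \in p | neg z == w] then [:: st]
  else if neg z \in p then if neg w \in p then [::] else [:: (t, w :: p)]
  else if neg w \in p then [:: (t, z :: p)]
  else if z == w then [:: (t, z :: p)]
  else if t is t'.+1 then
    [:: (t', [:: z, w & p]); (t', [:: z, neg w & p]); (t', [:: neg z, w & p])]
  else [::].

(** The budget pays for literals over y only, so making z true is free. The other option records
    [neg z], which keeps the two cubes disjoint. *)
Definition force_step z l (st : state) : seq state :=
  let: (t, p) := st in
  if (z \in p) || (l \in p) then [:: st]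
  else if neg l \in p then if neg z \in p then [::] else [:: (t, z :: p)]
  else if t is t'.+1 then
    if neg z \in p then [:: (t', l :: p)]
    else [:: (t, z :: p); (t', [:: neg z, l & p])]
  else if neg z \in p then [::] else [:: (t, z :: p)].

Lemma den_split z w st acc :
  den split_prog [:: enc_literal z; enc_literal w; enc_state st; enc_states acc]
  = enc_states (split_step z w st ++ acc).
Proof.
case: st => t p; rewrite /= /evl /= !den_neg !den_mem !den_eqlit.
case: (z \in p) => //=; case: (w \in p) => //=; case: (neg z == w) => //=.
case: (neg z \in p) => /=; first by case: (neg w \in p).
by case: (neg w \in p) => //=; case: (z == w) => //=; case: t.
Qed.

Lemma den_force z l st acc :
  den force_prog [:: enc_literal z; enc_literal l; enc_state st; enc_states acc]
  = enc_states (force_step z l st ++ acc).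
Proof.
case: st => t p; rewrite /= /evl /= !den_neg !den_mem.
case: (z \in p) => //=; case: (l \in p) => //=.
case: (neg l \in p) => /=; first by case: (neg z \in p).
by case: t => [|t] /=; case: (neg z \in p).
Qed.

Definition orient := clause n n' -> option (lit * lit).

Definition same (s : bool) : orient := fun C =>
  if C is z :: C' then
    if (side z == s) && (side (head z C') == s) then Some (z, head z C') else None
  else None.

Definition mixed : orient := fun C =>
  if C is z :: C' then
    let w := head z C' in
    if side z == side w then None else Some (if side z then (w, z) else (z, w))
  else None.

Definition enc_pair (o : option (lit * lit)) : tree :=
  if o is Some (z, w) then Cons (enc_literal z) (enc_literal w) else Nil.

Lemma den_same s C : C != [::] ->
  den (same_prog s) [:: enc_list (@enc_literal n n') C] = enc_pair (same s C).
Proof.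
by case: s; case: C => [|[[i|j] b] [|[[i'|j'] b'] C]].
Qed.

Lemma den_mixed C : C != [::] ->
  den mixed_prog [:: enc_list (@enc_literal n n') C] = enc_pair (mixed C).
Proof.
by case: C => [|[[i|j] b] [|[[i'|j'] b'] C]].
Qed.

Definition stage (o : orient) (step : lit -> lit -> state -> seq state)
    (F : cnf n n') (sts : seq state) : seq state :=
  foldl (fun sts C =>
    if C is [::] then [::]
    else if o C is Some (z, w) then
      foldl (fun acc st => step z w st ++ acc) [::] sts
    else sts) sts F.

Notation enc_clauses := (enc_list (enc_list (@enc_literal n n'))).

Lemma den_stage op sp o step F sts :
  (forall C, C != [::] ->
     den op [:: enc_list (@enc_literal n n') C] = enc_pair (o C)) ->
  (forall z w st acc,
     den sp [:: enc_literal z; enc_literal w; enc_state st; enc_states acc] =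
     enc_states (step z w st ++ acc)) ->
  den (stage_prog op sp) [:: enc_clauses F; enc_states sts] =
  enc_states (stage o step F sts).
Proof.
move=> opE spE; rewrite /= /evl /= /stage.
apply: iter_treeE => C r a; case: C => [|z C] //=.
rewrite /evl /= (opE (z :: C)) //; case: (o _) => [[x y]|] //=.
rewrite -[Nil]/(enc_states [::]).
by apply: iter_treeE => st r' a'; rewrite /evl /= spE.
Qed.

Definition xstage := stage (same false) split_step.
Definition ystage := stage (same true) split_step.
Definition mstage := stage mixed force_step.

Lemma den_xstage F sts :
  den xstage_prog [:: enc_clauses F; enc_states sts] = enc_states (xstage F sts).
Proof. exact/den_stage/den_split/den_same. Qed.

Lemma den_ystage F sts :
  den ystage_prog [:: enc_clauses F; enc_states sts] = enc_states (ystage F sts).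
Proof. exact/den_stage/den_split/den_same. Qed.

Lemma den_mstage F sts :
  den mstage_prog [:: enc_clauses F; enc_states sts] = enc_states (mstage F sts).
Proof. exact/den_stage/den_force/den_mixed. Qed.

End Formulas.

#[global] Opaque unary_prog triple_prog budget_prog neg_prog mem_prog room_prog.

(** * The value computed by the whole algorithm *)

Section Main.

Variables n n' : nat.
Notation lit := (literal n n').
Notation state := (state n n').
Notation enc_cube := (enc_list (@enc_literal n n')).
Notation enc_states := (enc_list (@enc_state n n')).
Notation enc_clauses := (enc_list (enc_list (@enc_literal n n'))).

Definition enc_frac (q : nat * nat) : tree :=
  Cons (enc_binary q.1) (enc_binary q.2).

(** A logarithm read off from bit lengths: for 0 < q < 1, 2 ^ budget exceeds 1 / q ([budget_lt]) and
    is at most 4 / q ([budget_le]). *)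
Definition budget (q : nat * nat) : nat :=
  (size (bits q.2)).+1 - size (bits q.1).

Definition add_volume (q : nat) (v : nat) (st : state) : nat :=
  v + 2 ^ room true n' st.2 * q.

Definition volume (F : cnf n n') (q d : nat) (p : seq lit) : nat :=
  foldl (add_volume q) 0 (ystage F [:: (d, p)]).

Definition heavy_leaf (F : cnf n n') (sigma : nat * nat) (d : nat) (p : seq lit) :=
  2 ^ n' * sigma.1 <= volume F sigma.2 d p.

(** The factor 3 on the budget is due to (3/4) ^ 3 < 1/2: three disjoint clauses at least halve the
    solutions. *)
Definition add_leaf F (rho sigma : nat * nat) (a : nat * nat) (st : state) :=
  if heavy_leaf F sigma (3 * budget sigma) st.2 then
    (a.1 + 2 ^ room false n st.2, a.2 + 2 ^ room false n st.2 * rho.2)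
  else a.

Definition add_leaves F rho sigma (a : nat * nat) (st : state) :=
  foldl (add_leaf F rho sigma) a (mstage F [:: (budget sigma, st.2)]).

Definition leaf_sums F rho sigma : nat * nat :=
  foldl (add_leaves F rho sigma) (0, 0)
    (xstage F [:: (3 * budget rho, [::])]).

Definition answer F rho sigma : option nat :=
  if 2 ^ n * rho.1 <= (leaf_sums F rho sigma).2 then Some (leaf_sums F rho sigma).1
  else None.

#[local] Opaque xstage_prog ystage_prog mstage_prog.

Lemma den_heavy F q d p :
  den heavy_prog [:: enc_unary n'; enc_clauses F; enc_frac q; enc_unary d; enc_cube p]
  = enc_bool (heavy_leaf F q d p).
Proof.
rewrite /= /evl /= -[Cons (Cons (enc_unary d) _) Nil]/(enc_states [:: (d, p)]).
rewrite !den_ystage -enc_binary0 den_addmul num_bitsE add0n.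
rewrite (@iter_treeE _ _ (@enc_state n n') enc_binary (add_volume q.2)).
  by rewrite den_leq.
by move=> st r v; rewrite /= /evl /= den_room den_addmul num_bitsE.
Qed.

#[local] Opaque heavy_prog.

Lemma den_leaf k q (h : bool) p c t :
  den leaf_prog [:: enc_unary k; enc_frac q; enc_bool h; enc_cube p; enc_frac (c, t)]
  = enc_frac (if h then (c + 2 ^ room false k p, t + 2 ^ room false k p * q.2)
              else (c, t)).
Proof.
case: h => //=; rewrite /evl /= den_room -[Cons (Cons Nil Nil) Nil]/(enc_bits [:: true]).
by rewrite !den_addmul num_bitsE /= addn0 muln1.
Qed.

#[local] Opaque leaf_prog.

Lemma den_main F rho sigma :
  den main_prog [:: Cons (enc_cnf F) (Cons (enc_frac rho) (enc_frac sigma))] =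
  enc_option enc_binary (answer F rho sigma).
Proof.
rewrite /= /evl /= !den_triple !den_unary !len_budget !len_enc_list.
rewrite -[(size (bits rho.2)).+1 - _]/(budget rho).
rewrite -[(size (bits sigma.2)).+1 - _]/(budget sigma).
rewrite -[Cons (Cons (enc_unary _) Nil) Nil]
  /(enc_states [:: (3 * budget rho, [::])]) den_xstage.
rewrite -enc_binary0 den_addmul num_bitsE add0n.
rewrite -[Cons (enc_binary 0) (enc_binary 0)]/(enc_frac (0, 0)).
rewrite (@iter_treeE _ _ (@enc_state n n') enc_frac (add_leaves F rho sigma)).
  rewrite den_leq /answer -/(leaf_sums F rho sigma) enc_binary0.
  by case: (_ <= _).
move=> st r a; rewrite /= /evl /=.
rewrite -[Cons (Cons (enc_unary _) _) _]
  /(enc_states [:: (budget sigma, st.2)]) den_mstage.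
apply: iter_treeE => {a}st' r' [c t]; rewrite /= /evl /= den_heavy den_leaf.
by rewrite /add_leaf /=; case: heavy_leaf.
Qed.

End Main.

(** * Running time *)

Section Costs.

Variables n n' : nat.
Notation lit := (literal n n').
Notation state := (state n n').
Notation enc_cube := (enc_list (@enc_literal n n')).
Notation enc_states := (enc_list (@enc_state n n')).
Notation enc_clauses := (enc_list (enc_list (@enc_literal n n'))).
Implicit Types (z w l : lit) (st : state) (F : cnf n n').

Variable m : nat.
Hypothesis n_le : n + n' + 2 <= m.

Lemma len_literal l : len (enc_literal l) <= m.
Proof.
rewrite enc_literalE len_enc_list /= size_nseq.
by case: l => [[i|j] b] /=; [have := ltn_ord i | have := ltn_ord j]; lia.
Qed.

Definition step_bd : nat := 4 * mem_bd m + 100 * m.+1 + 200.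

Let mem_le l p : size p <= m -> cost mem_prog [:: enc_literal l; enc_cube p] <= mem_bd m.
Proof. by move=> le; apply: cost_mem; rewrite ?len_literal // len_enc_list. Qed.

Let eqlit_le l t : cost eqbits_prog [:: enc_literal l; t] <= 50 * m.+1.
Proof. by have := cost_eqbits (enc_literal l) t; have := len_literal l; lia. Qed.

Lemma cost_split z w st acc : size st.2 <= m ->
  cost split_prog [:: enc_literal z; enc_literal w; enc_state st; acc] <= step_bd.
Proof.
case: st => t p /= lep; rewrite /evl /= !den_neg !den_mem !den_eqlit.
have := (mem_le z lep, mem_le w lep, mem_le (neg z) lep, mem_le (neg w) lep,
  eqlit_le (neg z) (enc_literal w), eqlit_le z (enc_literal w),
  cost_neg (enc_literal z), cost_neg (enc_literal w)).
rewrite /step_bd; move: (mem_bd m) => M [[[[[[[]]]]]]].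
move: (cost mem_prog [:: enc_literal z; _]) (cost mem_prog [:: enc_literal w; _])
  (cost mem_prog [:: enc_literal (neg z); _]) (cost mem_prog [:: enc_literal (neg w); _])
  (cost eqbits_prog [:: enc_literal z; _])
  (cost eqbits_prog [:: enc_literal (neg z); _]) => C1 C2 C3 C4 C5 C6.
move: (cost neg_prog [:: enc_literal z]) (cost neg_prog [:: enc_literal w]) => C7 C8 *.
case: (z \in p) => /=; first by lia.
case: (w \in p) => /=; first by lia.
case: (neg z == w) => /=; first by lia.
case: (neg z \in p); case: (neg w \in p) => /=; try by lia.
case: (z == w) => /=; first by lia.
by case: t => /=; lia.
Qed.

Lemma cost_force z w st acc : size st.2 <= m ->
  cost force_prog [:: enc_literal z; enc_literal w; enc_state st; acc] <= step_bd.
Proof.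
case: st => t p /= lep; rewrite /evl /= !den_neg !den_mem.
have := (mem_le z lep, mem_le w lep, mem_le (neg z) lep, mem_le (neg w) lep,
  cost_neg (enc_literal z), cost_neg (enc_literal w)).
rewrite /step_bd; move: (mem_bd m) => M [[[[[]]]]].
move: (cost mem_prog [:: enc_literal z; _]) (cost mem_prog [:: enc_literal w; _])
  (cost mem_prog [:: enc_literal (neg z); _]) (cost mem_prog [:: enc_literal (neg w); _])
  => C1 C2 C3 C4.
move: (cost neg_prog [:: enc_literal z]) (cost neg_prog [:: enc_literal w]) => C7 C8 *.
case: (z \in p) => /=; first by lia.
case: (w \in p) => /=; first by lia.
case: (neg z \in p); case: (neg w \in p); case: t => /=; lia.
Qed.

Lemma size_split z w st st' : st' \in split_step z w st -> size st'.2 <= (size st.2).+2.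
Proof.
case: st => [t p] /=; case: ifP => _; first by rewrite inE => /eqP-> /=; lia.
case: ifP => _; first by case: ifP => _ //; rewrite inE => /eqP->.
case: ifP => _; first by rewrite inE => /eqP->.
case: ifP => _; first by rewrite inE => /eqP->.
by case: t => [|t] //; rewrite !inE => /or3P[] /eqP->.
Qed.

Lemma size_force z w st st' : st' \in force_step z w st -> size st'.2 <= (size st.2).+2.
Proof.
case: st => [t p] /=; case: ifP => _; first by rewrite inE => /eqP-> /=; lia.
case: ifP => _; first by case: ifP => _ //; rewrite inE => /eqP->.
case: t => [|t]; case: ifP => _ //; rewrite ?inE.
- by move/eqP->.
- by move/eqP->.
- by case/orP=> /eqP->.
Qed.

Lemma mem_foldl_cat (T S : eqType) (f : T -> seq S) (s : seq T) acc x :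
  x \in foldl (fun a y => f y ++ a) acc s ->
  x \in acc \/ exists2 y, y \in s & x \in f y.
Proof.
elim: s acc => [|y s IH] acc /=; first by left.
case/IH=> [|[z zs xz]]; last by right; exists z; rewrite // inE zs orbT.
rewrite mem_cat => /orP[xy|]; last by left.
by right; exists y; rewrite // mem_head.
Qed.

Lemma stage_cons o (step : lit -> lit -> state -> seq state) C F sts :
  stage o step (C :: F) sts = stage o step F (stage o step [:: C] sts).
Proof. by []. Qed.

Lemma size_stage o (step : lit -> lit -> state -> seq state) F sts k :
  (forall z w st st', st' \in step z w st -> size st'.2 <= (size st.2).+2) ->
  (forall st, st \in sts -> size st.2 <= k) ->
  forall st, st \in stage o step F sts -> size st.2 <= k + 2 * size F.
Proof.
move=> stepS; elim: F sts k => [|C F IH] sts k szs st.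
  by move=> /szs; rewrite muln0 addn0.
rewrite stage_cons => /IH-/(_ k.+2 _); rewrite /= => H.
have -> : k + 2 * (size F).+1 = k.+2 + 2 * size F by lia.
apply: H => {}st; case: C => [|z C] //=; rewrite /stage /=.
case: (o _) => [[z' w]|]; last by move=> /szs; lia.
by case/mem_foldl_cat=> [//|[st' /szs st's /stepS]]; lia.
Qed.

(** [L] has to bound the list of states after every prefix of the formula, since an intermediate
    list may be longer than the final one. The slack [2 * size F] pays for the at most two literals
    that each clause adds to a cube. *)
Lemma cost_stage op sp (o : orient n n') step :
  (forall C, C != [::] ->
     den op [:: enc_list (@enc_literal n n') C] = enc_pair (o C)) ->
  (forall C, cost op [:: C] <= 60) ->
  (forall z w st acc,
     den sp [:: enc_literal z; enc_literal w; enc_state st; enc_states acc] =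
     enc_states (step z w st ++ acc)) ->
  (forall z w st acc, size st.2 <= m ->
     cost sp [:: enc_literal z; enc_literal w; enc_state st; acc] <= step_bd) ->
  (forall z w st st', st' \in step z w st -> size st'.2 <= (size st.2).+2) ->
  forall F sts L,
  (forall j, size (stage o step (take j F) sts) <= L) ->
  (forall st, st \in sts -> size st.2 + 2 * size F <= m) ->
  cost (stage_prog op sp) [:: enc_clauses F; enc_states sts] <=
    size F * (L * (step_bd + 30) + 150) + 30.
Proof.
move=> opE opC spE spC stepS F sts L sizeL lem.
rewrite /= /evl /=; set g := fun r acc => _; set c := fun _ _ : tree => _.
suff : iter_cost g c (enc_clauses F) (enc_states sts) <=
    size F * (L * (step_bd + 30) + 140 + 10) by move: (iter_cost _ _ _ _) => *; lia.
pose P (F : cnf n n') (sts : seq state) :=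
  (forall j, size (stage o step (take j F) sts) <= L) /\
  (forall st, st \in sts -> size st.2 + 2 * size F <= m).
apply: (@iter_cost_inv _ _ (enc_list (@enc_literal n n')) enc_states
  (fun sts C => stage o step [:: C] sts) P); last by split.
- move=> C r a; rewrite -(den_stage [:: C] a opE spE).
  by rewrite /= /evl /=.
- move=> C F' a [sizeL' lem']; split; first by move=> j; apply: (sizeL' j.+1).
  move=> st st_in.
  have := @size_stage o step [:: C] a (m - 2 * size (C :: F')) stepS _ st st_in.
  move=> /(_ _)/=; have : 2 * (size F').+1 <= m.
    case: a lem' st_in {sizeL'} => [|st0 a] lem'.
      by rewrite /stage /=; case: C {lem'} => [|? ?] //=; case: (o _) => [[]|].
    move=> _; exact: leq_trans (leq_addl _ _) (lem' st0 (mem_head _ _)).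
  move=> h H; have {}H : size st.2 <= m - 2 * (size F').+1 + 2 * 1.
    have ar x k : x + k <= m -> x <= m - k by clear; lia.
    by apply: H => st' /lem'; exact: ar.
  have ar x k : 2 * k.+1 <= m -> x <= m - 2 * k.+1 + 2 * 1 -> x + 2 * k <= m.
    by clear; lia.
  exact: ar h H.
move=> C F' r a [sizeL' lem']; rewrite /c; case: C lem' sizeL' => [|z C] lem' sizeL'.
  by rewrite /=; lia.
rewrite /= /evl /=.
have := opC (enc_list (@enc_literal n n') (z :: C)).
rewrite (opE (z :: C)) //=; move: (cost op _) => C0 C0le.
case: (o (z :: C)) => [[z' w]|] /=; last by lia.
set g' := fun r acc => _; set c' := fun _ _ : tree => _.
have szL : size a <= L by have := sizeL' 0.
have : iter_cost g' c' (enc_states a) (enc_states [::]) <= size a * (step_bd + 20 + 10).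
  apply: (@iter_cost_inv _ _ (@enc_state n n') enc_states
    (fun acc st => step z' w st ++ acc) (fun s _ => forall st, st \in s -> size st.2 <= m)).
  + by move=> st r' a'; rewrite /g' /= /evl /= spE.
  + by move=> st s _ H st' st's; apply: H; rewrite inE st's orbT.
  + move=> st s r' a' H; rewrite /c' /= /evl /=.
    have := @spC z' w st (enc_states a') (H _ (mem_head _ _)).
    move: (cost sp _) => C1; lia.
  + by move=> st /lem'; lia.
rewrite [enc_states [::]]/=; move: (iter_cost g' c' _ _) => C1 C1le.
have := leq_mul szL (leqnn (step_bd + 30)); rewrite -addnA in C1le; lia.
Qed.


Definition stage_bd (L : nat) : nat := m * (L * (step_bd + 30) + 150) + 30.

Lemma cost_same s C : cost (same_prog s) [:: C] <= 60.
Proof. by rewrite /same_prog; case: s; rewrite /= /evl /=; split_tests. Qed.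

Lemma cost_mixed C : cost mixed_prog [:: C] <= 60.
Proof. by rewrite /= /evl /=; split_tests. Qed.

Lemma cost_xstage F st L : size F <= m -> size st.2 + 2 * size F <= m ->
  (forall j, size (xstage (take j F) [:: st]) <= L) ->
  cost xstage_prog [:: enc_clauses F; enc_states [:: st]] <= stage_bd L.
Proof.
move=> leF lest leL; apply: leq_trans (_ : _ <= size F * _ + _) _.
  apply: cost_stage leL _; [exact: den_same | exact: cost_same | exact: den_split
    | exact: cost_split | exact: size_split |].
  by move=> st'; rewrite inE => /eqP->.
by rewrite leq_add2r leq_mul.
Qed.

Lemma cost_ystage F st L : size F <= m -> size st.2 + 2 * size F <= m ->
  (forall j, size (ystage (take j F) [:: st]) <= L) ->
  cost ystage_prog [:: enc_clauses F; enc_states [:: st]] <= stage_bd L.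
Proof.
move=> leF lest leL; apply: leq_trans (_ : _ <= size F * _ + _) _.
  apply: cost_stage leL _; [exact: den_same | exact: cost_same | exact: den_split
    | exact: cost_split | exact: size_split |].
  by move=> st'; rewrite inE => /eqP->.
by rewrite leq_add2r leq_mul.
Qed.

Lemma cost_mstage F st L : size F <= m -> size st.2 + 2 * size F <= m ->
  (forall j, size (mstage (take j F) [:: st]) <= L) ->
  cost mstage_prog [:: enc_clauses F; enc_states [:: st]] <= stage_bd L.
Proof.
move=> leF lest leL; apply: leq_trans (_ : _ <= size F * _ + _) _.
  apply: cost_stage leL _; [exact: den_mixed | exact: cost_mixed | exact: den_force
    | exact: cost_force | exact: size_force |].
  by move=> st'; rewrite inE => /eqP->.
by rewrite leq_add2r leq_mul.
Qed.

#[local] Opaque xstage_prog ystage_prog mstage_prog.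

Definition heavy_bd (L : nat) : nat :=
  stage_bd L + L * (40 * m.+1 + addmul_bd m + 60) + addmul_bd m + 50 * m.+1 + 150.

Lemma size_bits_mul k v : k + size (bits v) <= m -> size (bits (2 ^ k * v)) <= m.
Proof.
move=> le; apply: leq_trans le; apply: size_bits_le.
by rewrite expnD ltn_pmul2l ?expn_gt0 // -{1}(num_bitsE v) num_lt.
Qed.

Lemma foldl_ge (T : Type) (f : nat -> T -> nat) :
  (forall v x, v <= f v x) -> forall s v, v <= foldl f v s.
Proof.
by move=> le; elim=> //= x s IH v; apply: leq_trans (IH _).
Qed.

Lemma cost_heavy F q d p L :
  size F <= m -> size p + 2 * size F <= m ->
  n' + size (bits q.1) <= m -> n' + size (bits q.2) <= m ->
  (forall j, size (ystage (take j F) [:: (d, p)]) <= L) ->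
  size (bits (volume F q.2 d p)) <= m ->
  cost heavy_prog
    [:: enc_unary n'; enc_clauses F; enc_frac q; enc_unary d; enc_cube p] <= heavy_bd L.
Proof.
move=> leF lep leq1 leq2 leL leV.
rewrite /= /evl /= -[Cons (Cons (enc_unary d) _) Nil]/(enc_states [:: (d, p)]).
rewrite den_ystage -enc_binary0 den_addmul num_bitsE add0n.
have := @cost_ystage F (d, p) L leF lep leL.
have sz : size (ystage F [:: (d, p)]) <= L by have := leL (size F); rewrite take_size.
have := @cost_addmul n' (bits q.1) 0 m leq1.
rewrite add0n num_bitsE => /(_ (size_bits_mul leq1)).
have := cost_leq (enc_binary (2 ^ n' * q.1)) (enc_binary (volume F q.2 d p)).
rewrite len_enc_list; have := size_bits_mul leq1.
set g := fun r acc => _; set c := fun _ _ : tree => _.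
have gE st r v : g (Cons (enc_state st) r) (enc_binary v) = enc_binary (add_volume q.2 v st).
  by rewrite /g /= /evl /= den_room den_addmul num_bitsE.
rewrite (@iter_treeE _ _ _ _ _ g gE) -/(volume F q.2 d p).
pose P (s : seq state) v := size (bits (foldl (add_volume q.2) v s)) <= m /\
  forall st, st \in s -> size st.2 <= m.
have := @iter_cost_inv _ _ (@enc_state n n') enc_binary (add_volume q.2) P
  (40 * m.+1 + addmul_bd m + 40) g c gE.
have szys st : st \in ystage F [:: (d, p)] -> size st.2 <= m.
  move/(@size_stage (same true) (@split_step n n') F _ (size p) (@size_split)).
  by move=> H; apply: leq_trans lep; apply: H => st'; rewrite inE => /eqP->.
move=> /(_ _ _ (ystage F [:: (d, p)]) 0 (conj leV szys)) le.
have {le} : iter_cost g c (enc_states (ystage F [:: (d, p)])) (enc_binary 0) <=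
    size (ystage F [:: (d, p)]) * (40 * m.+1 + addmul_bd m + 40 + 10).
  apply: le => [st s v [leV' lep']|st s r v [leV' lep']].
    by split=> // st' st's; apply: lep'; rewrite inE st's orbT.
  rewrite /c /= /evl /= den_room.
  have := cost_room true (enc_unary n') (enc_cube st.2).
  have := lep' _ (mem_head _ _); rewrite len_enc_list.
  have := @cost_addmul (room true n' st.2) (bits q.2) v m; rewrite num_bitsE.
  move=> /(_ _ _) H; have {H} := H.
  move: (cost addmul_prog _) (cost (room_prog true) _) => C1 C2 H1 H2 H3.
  have : C1 <= addmul_bd m; last by lia.
  apply: H1; first by rewrite /room; lia.
  apply: leq_trans leV'; apply: size_bits_mono => /=; apply: foldl_ge => v' st'.
  exact: leq_addr.
move: (cost ystage_prog _) (cost leq_prog _) (cost addmul_prog _) (iter_cost _ _ _ _).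
have := leq_mul sz (leqnn (40 * m.+1 + addmul_bd m + 60)).
by rewrite /heavy_bd; move=> *; lia.
Qed.

Definition leaf_bd : nat := 40 * m.+1 + 2 * addmul_bd m + 100.

Lemma cost_leaf q (h : bool) p c t :
  size p <= m -> n + 1 <= m -> n + size (bits q.2) <= m ->
  (h -> size (bits (c + 2 ^ room false n p)) <= m) ->
  (h -> size (bits (t + 2 ^ room false n p * q.2)) <= m) ->
  cost leaf_prog [:: enc_unary n; enc_frac q; enc_bool h; enc_cube p; enc_frac (c, t)]
    <= leaf_bd.
Proof.
rewrite /leaf_bd => lep len1 lenq; case: h; last by move=> _ _ /=; lia.
move=> /(_ isT) lec /(_ isT) let_ /=; rewrite /evl /= den_room.
rewrite -[Cons (Cons Nil Nil) Nil]/(enc_bits [:: true]).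
have := cost_room false (enc_unary n) (enc_cube p); rewrite len_enc_list.
have ler : room false n p <= n by exact: leq_subr.
have := @cost_addmul (room false n p) [:: true] c m.
have := @cost_addmul (room false n p) (bits q.2) t m.
rewrite num_bitsE [num _]/= addn0 muln1 => H1 H2.
move: (cost (room_prog false) _) (cost addmul_prog [:: _; enc_bits [:: true]; _]) H2
  (cost addmul_prog [:: _; enc_bits (bits q.2); _]) H1 => C0 C1 H1 C2 H2.
have : C1 <= addmul_bd m by apply: H1 => //=; lia.
have : C2 <= addmul_bd m by apply: H2 => //=; lia.
lia.
Qed.

#[local] Opaque heavy_prog leaf_prog.

Definition main_bd (Lx Lm Ly : nat) : nat :=
  stage_bd Lx + Lx * (stage_bd Lm + Lm * (heavy_bd Ly + leaf_bd + 100) + 200)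
  + addmul_bd m + 500 * m.+1.

Definition leq_sums (a b : nat * nat) : Prop := a.1 <= b.1 /\ a.2 <= b.2.

Lemma foldl_leq_sums (T : Type) (f : nat * nat -> T -> nat * nat) :
  (forall a x, leq_sums a (f a x)) -> forall s a, leq_sums a (foldl f a s).
Proof.
move=> le; elim=> [|x s IH] a //=.
have [h1 h2] := le a x; have [k1 k2] := IH (f a x).
by split; [apply: leq_trans k1 | apply: leq_trans k2].
Qed.

Definition leq_bits (a : nat * nat) : Prop :=
  size (bits a.1) <= m /\ size (bits a.2) <= m.

(** Both sums only grow along the leaves, so the bit lengths of the final sums control all
    intermediate ones. *)
Lemma leq_bits_sums a b : leq_sums a b -> leq_bits b -> leq_bits a.
Proof.
by case=> le1 le2 [lb1 lb2]; split;
  [apply: leq_trans lb1 | apply: leq_trans lb2]; apply: size_bits_mono.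
Qed.

Lemma add_leaf_ge F rho sigma a st : leq_sums a (add_leaf F rho sigma a st).
Proof. by rewrite /add_leaf; case: ifP => _; split; rewrite //= leq_addr. Qed.

Lemma add_leaves_ge F rho sigma a st : leq_sums a (add_leaves F rho sigma a st).
Proof. by apply: foldl_leq_sums => b st'; apply: add_leaf_ge. Qed.

(** Peels off one [Let], replacing its value by a named [v] and moving its cost into the accumulator
    [k], so that the values are not unfolded inside each other. *)
Lemma cost_Let_le p q env v a k c :
  den p env = v -> cost p env <= a ->
  cost q (env ++ [:: v]) + (k + a + 2) <= c -> cost (Let p q) env + k <= c.
Proof. by move=> /= -> ? ?; lia. Qed.

(** A cube gains at most two literals per clause in each of three successive stages, whence
    [6 * size F]. The list lengths [Lx], [Lm] and [Ly] remain parameters, to be filled in by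
    counting branches. *)
Lemma cost_main F rho sigma Lx Lm Ly :
  6 * size F <= m ->
  n + n' + size (bits rho.1) <= m -> n + n' + size (bits rho.2) <= m ->
  n + n' + size (bits sigma.1) <= m -> n + n' + size (bits sigma.2) <= m ->
  let xs := xstage F [:: (3 * budget rho, [::])] in
  let ms st := mstage F [:: (budget sigma, st.2)] in
  (forall j, size (xstage (take j F) [:: (3 * budget rho, [::])]) <= Lx) ->
  (forall st, st \in xs ->
     forall j, size (mstage (take j F) [:: (budget sigma, st.2)]) <= Lm) ->
  (forall st st', st \in xs -> st' \in ms st ->
     forall j, size (ystage (take j F) [:: (3 * budget sigma, st'.2)]) <= Ly) ->
  (forall st st', st \in xs -> st' \in ms st ->
     size (bits (volume F sigma.2 (3 * budget sigma) st'.2)) <= m) ->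
  size (bits (leaf_sums F rho sigma).1) <= m ->
  size (bits (leaf_sums F rho sigma).2) <= m ->
  cost main_prog [:: Cons (enc_cnf F) (Cons (enc_frac rho) (enc_frac sigma))] <=
  main_bd Lx Lm Ly.
Proof.
move=> leF ler1 ler2 les1 les2 xs ms leLx leLm leLy leV leT1 leT2.
set x := Cons _ _; rewrite -[X in X <= _]addn0 /main_prog /fun1 /letb /fold.
pose b := den budget_prog [:: enc_frac rho].
pose b' := den budget_prog [:: enc_frac sigma].
have lenb : len b = budget rho by rewrite /b len_budget !len_enc_list.
have lenb' : len b' = budget sigma by rewrite /b' len_budget !len_enc_list.
have leb : budget rho <= m.+1 by rewrite /budget; lia.
have leb' : budget sigma <= m.+1 by rewrite /budget; lia.
apply: (@cost_Let_le _ _ _ b (30 * m.+1 + 20)) => //.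
  have := cost_budget (enc_binary rho.1) (enc_binary rho.2).
  by rewrite len_enc_list /= /evl /= /enc_frac; lia.
apply: (@cost_Let_le _ _ _ (enc_unary (3 * budget rho)) (30 * m.+2 + 20)).
- by rewrite /= /evl /= den_triple lenb.
- by have := cost_triple b; rewrite /= /evl /= lenb; lia.
apply: (@cost_Let_le _ _ _ b' (30 * m.+1 + 20)) => //.
  have := cost_budget (enc_binary sigma.1) (enc_binary sigma.2).
  by rewrite len_enc_list /= /evl /= /enc_frac; lia.
apply: (@cost_Let_le _ _ _ (enc_unary (budget sigma)) (30 * m.+2 + 20)).
- by rewrite /= /evl /= den_unary lenb'.
- by have := cost_unary b'; rewrite /= /evl /= lenb'; lia.
apply: (@cost_Let_le _ _ _ (enc_unary (3 * budget sigma)) (30 * m.+2 + 20)).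
- by rewrite /= /evl /= den_triple lenb'.
- by have := cost_triple b'; rewrite /= /evl /= lenb'; lia.
have leFm : size F <= m by lia.
have Exs : Cons (Cons (enc_unary (3 * budget rho)) Nil) Nil =
  enc_states [:: (3 * budget rho, [::])] by [].
apply: (@cost_Let_le _ _ _ (enc_states xs) (stage_bd Lx + 20)).
- by rewrite /= /evl /= Exs den_xstage.
- have lest : size (3 * budget rho, [::] : seq lit).2 + 2 * size F <= m.
    by rewrite [size _]/=; lia.
  have := @cost_xstage F _ Lx leFm lest leLx.
  by rewrite /= /evl /= Exs; lia.
have szxs : size xs <= Lx by have := leLx (size F); rewrite take_size.
apply: (@cost_Let_le _ _ _ (enc_frac (leaf_sums F rho sigma))
  (Lx * (stage_bd Lm + Lm * (heavy_bd Ly + leaf_bd + 60) + 100) + 20)).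
- rewrite /= /evl /= -{1 2}enc_binary0.
  rewrite -[Cons (enc_binary 0) (enc_binary 0)]/(enc_frac (0, 0)).
  apply: (iter_treeE (h := add_leaves F rho sigma)) => st r a; rewrite /= /evl /=.
  rewrite -[Cons (Cons (enc_unary _) _) _]
    /(enc_states [:: (budget sigma, st.2)]) den_mstage.
  apply: iter_treeE => {a}st' r' [c' t]; rewrite /= /evl /= den_heavy den_leaf.
  by rewrite /add_leaf /=; case: heavy_leaf.
- rewrite /= /evl /= -{1 2}enc_binary0.
  rewrite -[Cons (enc_binary 0) (enc_binary 0)]/(enc_frac (0, 0)).
  set g := fun r acc => _; set c := fun _ _ : tree => _.
  pose P (s : seq state) a := {subset s <= xs} /\
    leq_bits (foldl (add_leaves F rho sigma) a s).
  suff : iter_cost g c (enc_states xs) (enc_frac (0, 0)) <= size xs *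
      (stage_bd Lm + Lm * (heavy_bd Ly + leaf_bd + 60) + 60 + 10).
    have := leq_mul szxs
      (leqnn (stage_bd Lm + Lm * (heavy_bd Ly + leaf_bd + 60) + 60 + 10)).
    by move: (Lm * _) (stage_bd _) (iter_cost _ _ _ _) => A B C; nia.
  apply: (@iter_cost_inv _ _ (@enc_state n n') enc_frac (add_leaves F rho sigma) P).
  + move=> st r a; rewrite /g /= /evl /=.
    rewrite -[Cons (Cons (enc_unary _) _) _]
      /(enc_states [:: (budget sigma, st.2)]) den_mstage.
    apply: iter_treeE => {a}st' r' [c' t]; rewrite /= /evl /= den_heavy den_leaf.
    by rewrite /add_leaf /=; case: heavy_leaf.
  + by move=> st s a [sub le]; split=> // st' st's; apply: sub; rewrite inE st's orbT.
  + move=> st s r a [sub le]; rewrite /c /= /evl /=.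
    have st_in : st \in xs by apply: sub; apply: mem_head.
    have szst : size st.2 <= 2 * size F.
      apply: (@size_stage (same false) (@split_step n n') F _ 0 (@size_split) _ _ st_in).
      by move=> st'; rewrite inE => /eqP->.
    rewrite -[Cons (Cons (enc_unary _) _) _]
      /(enc_states [:: (budget sigma, st.2)]) den_mstage -/(ms st).
    have lest : size (budget sigma, st.2).2 + 2 * size F <= m by rewrite [size _]/=; lia.
    have := @cost_mstage F (budget sigma, st.2) Lm leFm lest (leLm _ st_in).
    have szms : size (ms st) <= Lm by have := leLm _ st_in (size F); rewrite take_size.
    set g' := fun r acc => _; set c' := fun _ _ : tree => _.
    suff : iter_cost g' c' (enc_states (ms st)) (enc_frac a) <= size (ms st) *
        (heavy_bd Ly + leaf_bd + 50 + 10).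
      have := leq_mul szms (leqnn (heavy_bd Ly + leaf_bd + 50 + 10)).
      by move: (heavy_bd _) (iter_cost _ _ _ _) (cost mstage_prog _) => A B C; nia.
    apply: (@iter_cost_inv _ _ (@enc_state n n') enc_frac (add_leaf F rho sigma)
      (fun s a => {subset s <= ms st} /\ leq_bits (foldl (add_leaf F rho sigma) a s))).
    * move=> st' r' [c0 t]; rewrite /g' /= /evl /= den_heavy den_leaf.
      by rewrite /add_leaf /=; case: heavy_leaf.
    * move=> st' s' a' [sub' le']; split=> // st'' st's.
      by apply: sub'; rewrite inE st's orbT.
    * move=> st' s' r' [c0 t] [sub' le']; rewrite /c' /= /evl /= den_heavy.
      have st'_in : st' \in ms st by apply: sub'; apply: mem_head.
      have szst' : size st'.2 <= 4 * size F.
        have H := @size_stage (@mixed n n') (@force_step n n') F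
          [:: (budget sigma, st.2)] (2 * size F) (@size_force).
        apply: leq_trans (H _ _ st'_in) _; last by lia.
        by move=> st''; rewrite inE => /eqP->.
      have lest' : size st'.2 + 2 * size F <= m by lia.
      have Q1 : n' + size (bits sigma.1) <= m by lia.
      have Q2 : n' + size (bits sigma.2) <= m by lia.
      have := cost_heavy leFm lest' Q1 Q2 (leLy _ _ st_in st'_in) (leV _ _ st_in st'_in).
      have Q3 : n + 1 <= m by lia.
      have Q4 : n + size (bits rho.2) <= m by lia.
      have Q5 : size st'.2 <= m by lia.
      have := @cost_leaf rho (heavy_leaf F sigma (3 * budget sigma) st'.2) st'.2
        c0 t Q5 Q3 Q4 _ _.
      have le2 : leq_sums (add_leaf F rho sigma (c0, t) st')
          (foldl (add_leaf F rho sigma) (c0, t) (st' :: s')).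
        by apply: foldl_leq_sums => *; apply: add_leaf_ge.
      have := leq_bits_sums le2 le'; rewrite /add_leaf /=.
      move: (cost heavy_prog _) (cost leaf_prog _) => C1 C2; case: heavy_leaf.
        by case=> /= l1 l2 /(_ (fun=> l1) (fun=> l2)); lia.
      by move=> _ H H1; have : C2 <= leaf_bd by [apply: H]; lia.
    * split=> //; apply: leq_bits_sums le.
      by apply: foldl_leq_sums => *; apply: add_leaves_ge.
  + by split=> //; split.
apply: (@cost_Let_le _ _ _ (enc_binary (2 ^ n * rho.1)) (addmul_bd m + 20)).
- by rewrite /= /evl /= -enc_binary0 den_addmul num_bitsE add0n.
- have lenr : n + size (bits rho.1) <= m by lia.
  have := @cost_addmul n (bits rho.1) 0 m lenr.
  rewrite add0n num_bitsE enc_binary0 => /(_ (size_bits_mul lenr)).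
  by rewrite /= /evl /= -/(enc_binary rho.1); lia.
apply: (@cost_Let_le _ _ _ (enc_bool (2 ^ n * rho.1 <= (leaf_sums F rho sigma).2))
  (50 * m.+1 + 20)).
- by rewrite /= /evl /= den_leq.
- have lenr : n + size (bits rho.1) <= m by lia.
  have := cost_leq (enc_binary (2 ^ n * rho.1)) (enc_binary (leaf_sums F rho sigma).2).
  by rewrite len_enc_list; have := size_bits_mul lenr; rewrite /= /evl /=; lia.
rewrite /main_bd; case: (2 ^ n * _ <= _); rewrite /= /evl /=; lia.
Qed.

End Costs.

(** * Counting assignments *)

Section Flip.

Variables (A : finType) (V : eqType) (ev : A -> V -> bool).
Variables (free : pred V) (flip : V -> A -> A).
Hypothesis flipK : forall x, involutive (flip x).
Hypothesis ev_flip : forall x a y, free x -> ev (flip x a) y = (y == x) (+) ev a y.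

Definition holds_lit (a : A) (l : V * bool) : bool := ev a l.1 == l.2.

Lemma holds_lit_flip x a l : free x -> l.1 != x -> holds_lit (flip x a) l = holds_lit a l.
Proof. by move=> fx ne; rewrite /holds_lit ev_flip // (negbTE ne). Qed.

(** Flipping x preserves Q and toggles the value of x, so it exchanges the two halves of Q. *)
Lemma card_half (Q : pred A) x c : free x ->
  (forall a, Q (flip x a) = Q a) ->
  2 * #|[pred a | Q a && holds_lit a (x, c)]| = #|Q|.
Proof.
move=> fx Qx; rewrite -(cardID [pred a | holds_lit a (x, c)] Q).
have -> : #|[predI Q & [pred a | holds_lit a (x, c)]]| =
    #|[pred a | Q a && holds_lit a (x, c)]|.
  by apply: eq_card => a; rewrite !inE andbC.
rewrite mul2n -addnn; congr (_ + _).
rewrite -!sum1_card (reindex_inj (inv_inj (flipK x))) /=.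
apply: eq_bigl => a; rewrite !inE Qx /holds_lit ev_flip // eqxx andbC.
by case: (ev a x); case: c.
Qed.

Lemma card_cube (p : seq (V * bool)) :
  all (fun l => free l.1) p -> uniq (map fst p) ->
  2 ^ size p * #|[pred a | all (holds_lit a) p]| = #|A|.
Proof.
elim: p => [|[x c] p IH] /=; first by rewrite expn0 mul1n.
move=> /andP[fx fp] /andP[xp up]; rewrite -(IH fp up) expnS -mulnA mulnCA.
congr (_ * _); rewrite -(@card_half [pred a | all (holds_lit a) p] x c fx) /=.
  by congr (_ * _); apply: eq_card => a; rewrite !inE andbC.
move=> a; apply: eq_in_all => l lp; apply: holds_lit_flip => //.
by apply: contraNneq xp => <-; apply: map_f.
Qed.

Definition clause_vars (M : seq ((V * bool) * (V * bool))) : seq V :=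
  flatten [seq [:: c.1.1; c.2.1] | c <- M].

Definition holds_clause (a : A) (c : (V * bool) * (V * bool)) : bool :=
  holds_lit a c.1 || holds_lit a c.2.

(** Induction on M: the two variables of a new clause are independent of the remaining clauses, so
    the clause fails on exactly a quarter of their solutions. *)
Lemma card_disjoint_clauses M : all free (clause_vars M) -> uniq (clause_vars M) ->
  4 ^ size M * #|[pred a | all (holds_clause a) M]| = 3 ^ size M * #|A|.
Proof.
elim: M => [|[[x c] [y d]] M IH] /=; first by rewrite !expn0 !mul1n.
move=> /and3P[fx fy fM] /and3P[]; rewrite inE negb_or => /andP[xy xM] yM uM.
pose Q := [pred a | all (holds_clause a) M].
have Qflip u : free u -> u \notin clause_vars M -> forall a, Q (flip u a) = Q a.
  move=> fu uM' a; apply: eq_in_all => e eM; rewrite /holds_clause.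
  have ve v : v \in [:: e.1.1; e.2.1] -> v != u.
    move=> vin; apply: contraNneq uM' => <-; apply/flattenP.
    by exists [:: e.1.1; e.2.1] => //; apply: (map_f (fun e => [:: e.1.1; e.2.1])).
  by rewrite !holds_lit_flip ?ve ?inE ?eqxx ?orbT.
have q1 := card_half (~~ d) fy (Qflip y fy yM).
have Q2 a : Q (flip x a) && holds_lit (flip x a) (y, ~~ d) =
    Q a && holds_lit a (y, ~~ d).
  by rewrite Qflip // holds_lit_flip //= eq_sym.
have q2 := @card_half [pred a | Q a && holds_lit a (y, ~~ d)] x (~~ c) fx Q2.
(* Fixing both variables to their falsifying values halves the set twice. *)
have q3 : 4 * #|[pred a | Q a && ~~ (holds_lit a (x, c) || holds_lit a (y, d))]| = #|Q|.
  rewrite -q1 -q2.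
  rewrite mulnA; congr (_ * _); apply: eq_card => a; rewrite !inE -andbA; congr (_ && _).
  by rewrite /holds_lit /=; case: (ev a x); case: (ev a y); case: (c); case: (d).
have := IH fM uM; rewrite -/Q => EQ.
have := cardID [pred a | holds_lit a (x, c) || holds_lit a (y, d)] Q.
have -> : #|[predD Q & [pred a | holds_lit a (x, c) || holds_lit a (y, d)]]| =
    #|[pred a | Q a && ~~ (holds_lit a (x, c) || holds_lit a (y, d))]|.
  by apply: eq_card => a; rewrite !inE andbC.
have -> : #|[predI Q & [pred a | holds_lit a (x, c) || holds_lit a (y, d)]]| =
    #|[pred a | holds_clause a (x, c, (y, d)) && all (holds_clause a) M]|.
  by apply: eq_card => a; rewrite !inE andbC.
move: q3 EQ; move: #|Q| #|[pred a | Q a && _]| #|[pred a | holds_clause _ _ && _]| #|A|.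
move=> q r s t q3 EQ E; rewrite !expnS.
have E4 : 4 * s = 3 * q by lia.
by rewrite -mulnA mulnCA E4 mulnCA EQ mulnA.
Qed.

End Flip.

(** * Correctness of the branching *)

Section Branching.

Variables n n' : nat.
Notation lit := (literal n n').
Notation state := (state n n').
Implicit Types (z w l : lit) (p : seq lit) (st : state) (F : cnf n n').
Implicit Types (a : assignment n) (b : assignment n').
Implicit Types (step : lit -> lit -> state -> seq state) (o : orient n n').

Definition value a b (x : 'I_n + 'I_n') : bool :=
  match x with inl i => a i | inr j => b j end.

Definition sat_x a l : bool := if l.1 is inl i then a i == l.2 else true.
Definition sat_y b l : bool := if l.1 is inr j then b j == l.2 else true.

Definition cons_x a p : bool := all (sat_x a) p.
Definition cons_y b p : bool := all (sat_y b) p.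
Definition consistent a b p : bool := all (sat_literal a b) p.

Lemma consistentE a b p : consistent a b p = cons_x a p && cons_y b p.
Proof.
elim: p => //= l p ->; rewrite /sat_literal /cons_x /cons_y /= andbACA.
by congr (_ && _); case: l => [[i|j] c]; rewrite /sat_x /sat_y /= ?andbT.
Qed.

Lemma sat_neg a b l : sat_literal a b (neg l) = ~~ sat_literal a b l.
Proof. by case: l => [[i|j] c]; rewrite /sat_literal /=; [case: (a i)|case: (b j)]; case: c. Qed.

Lemma consistent_mem a b p l : consistent a b p -> l \in p -> sat_literal a b l.
Proof. by move=> /allP; apply. Qed.

Definition independent p : bool := uniq (map fst p).

Lemma fresh_lit p l : l \notin p -> neg l \notin p -> l.1 \notin map fst p.
Proof.
move=> lp nlp; apply/mapP => -[[x c] xp /= E].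
have [Ec|Ec] := eqVneq c l.2.
  by move: lp; rewrite (surjective_pairing l) E -Ec xp.
by move: nlp; rewrite /neg E; have -> : ~~ l.2 = c; [case: (l.2) c Ec {xp E} => [] [] | rewrite xp].
Qed.

Lemma card_side (s : bool) p : count (fun l => side l == s) p = size [seq l <- p | side l == s].
Proof. by rewrite size_filter. Qed.

(** With [pow2_sub], turns the product formulas for cubes into explicit powers of 2 and shows that
    the subtraction in the exponent is not truncated. *)
Lemma pow2_le k c N : 2 ^ k * c = 2 ^ N -> k <= N.
Proof.
move=> E; rewrite -(@leq_exp2l 2) // -E leq_pmulr //.
by case: c E => // /eqP; rewrite muln0 eq_sym expn_eq0.
Qed.

Lemma pow2_sub k c N : 2 ^ k * c = 2 ^ N -> c = 2 ^ (N - k).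
Proof.
move=> E; apply/eqP; rewrite -(@eqn_pmul2l (2 ^ k)) ?expn_gt0 // E -expnD.
by rewrite subnKC // (pow2_le E).
Qed.

Definition flip_x (x : 'I_n + 'I_n') a : assignment n :=
  if x is inl i then [ffun j => (j == i) (+) a j] else a.
Definition flip_y (x : 'I_n + 'I_n') b : assignment n' :=
  if x is inr i then [ffun j => (j == i) (+) b j] else b.

Lemma flip_xK x : involutive (flip_x x).
Proof. by case: x => [i|j] a //=; apply/ffunP => k; rewrite !ffunE addbA addbb. Qed.

Lemma flip_yK x : involutive (flip_y x).
Proof. by case: x => [i|j] a //=; apply/ffunP => k; rewrite !ffunE addbA addbb. Qed.

Definition in_x (x : 'I_n + 'I_n') : bool := if x is inl _ then true else false.

Lemma value_flip_x b x a y : in_x x -> value (flip_x x a) b y = (y == x) (+) value a b y.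
Proof. by case: x => [i|//] _; case: y => [j|j] /=; rewrite ?ffunE. Qed.

Lemma value_flip_y a x b y : ~~ in_x x -> value a (flip_y x b) y = (y == x) (+) value a b y.
Proof. by case: x => [//|i] _; case: y => [j|j] /=; rewrite ?ffunE. Qed.

Lemma card_assignment k : #|{: assignment k}| = 2 ^ k.
Proof. by rewrite card_ffun card_bool card_ord. Qed.

Lemma cube_x p : independent p ->
  2 ^ count (fun l => side l == false) p * #|[pred a | cons_x a p]| = 2 ^ n.
Proof.
move=> ind; rewrite card_side.
pose b0 : assignment n' := [ffun=> false].
have := @card_cube _ _ (fun a => value a b0) in_x flip_x flip_xK (value_flip_x b0)
  [seq l <- p | side l == false].
rewrite card_assignment => <-.
- congr (_ * _); apply: eq_card => a; rewrite !inE /cons_x all_filter.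
  by apply: eq_all => -[[i|j] c].
- by rewrite all_filter; apply/allP => -[[i|j] c].
- by apply: subseq_uniq ind; rewrite map_subseq // filter_subseq.
Qed.

Lemma card_cons_x p : independent p -> #|[pred a | cons_x a p]| = 2 ^ room false n p.
Proof. by move/cube_x/pow2_sub. Qed.

Lemma cube_y p : independent p ->
  2 ^ count (fun l => side l == true) p * #|[pred b | cons_y b p]| = 2 ^ n'.
Proof.
move=> ind; rewrite card_side.
pose a0 : assignment n := [ffun=> false].
have := @card_cube _ _ (value a0) (fun x => ~~ in_x x) flip_y flip_yK (value_flip_y a0)
  [seq l <- p | side l == true].
rewrite card_assignment => <-.
- congr (_ * _); apply: eq_card => a; rewrite !inE /cons_y all_filter.
  by apply: eq_all => -[[i|j] c].
- by rewrite all_filter; apply/allP => -[[i|j] c].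
- by apply: subseq_uniq ind; rewrite map_subseq // filter_subseq.
Qed.

Lemma card_cons_y p : independent p -> #|[pred b | cons_y b p]| = 2 ^ room true n' p.
Proof. by move/cube_y/pow2_sub. Qed.

(** The branching tree behind [stage]: f is summed over the leaves below a single state, which
    allows induction on the clauses where [stage] keeps a flat list. *)
Fixpoint branch_sum o step F (f : state -> nat) st : nat :=
  match F with
  | [::] => f st
  | [::] :: _ => 0
  | C :: F' =>
      if o C is Some (z, w) then \sum_(st' <- step z w st) branch_sum o step F' f st'
      else branch_sum o step F' f st
  end.

Lemma sum_stage o step F (f : state -> nat) sts :
  \sum_(st <- stage o step F sts) f st = \sum_(st <- sts) branch_sum o step F f st.
Proof.
elim: F sts => [|C F IH] sts //; rewrite stage_cons IH.
case: C => [|l C] /=; first by rewrite /stage /= big_nil big1_eq.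
rewrite /stage /=; case: (o _) => [[z w]|] //.
have gen acc g : \sum_(st <- foldl (fun acc st => step z w st ++ acc) acc sts) g st =
    \sum_(st <- acc) g st + \sum_(st <- sts) \sum_(st' <- step z w st) g st' :> nat.
  elim: sts acc => [|st sts IHs] acc /=; first by rewrite big_nil addn0.
  by rewrite IHs big_cat big_cons /= addnA [X in X + _ = _]addnC.
by rewrite gen big_nil.
Qed.

Lemma stage_ind o step F sts (P : state -> Prop) :
  (forall C z w st, o C = Some (z, w) -> P st ->
     forall st', st' \in step z w st -> P st') ->
  (forall st, st \in sts -> P st) -> forall st, st \in stage o step F sts -> P st.
Proof.
move=> stepP; elim: F sts => // C F IH sts Ps; rewrite stage_cons; apply: IH => st.
case: C => [|l C] //=; rewrite /stage /=; case E: (o _) => [[z w]|]; last exact: Ps.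
by case/mem_foldl_cat=> [//|[st0 /Ps Pst0]]; apply: stepP E Pst0 _.
Qed.

Definition sat_stage o F a b : bool :=
  all (fun C => if C is [::] then false
    else if o C is Some (z, w) then sat_literal a b z || sat_literal a b w
    else true) F.

(** A clause with one or two literals is selected by exactly one of the three orientations, a unit
    clause through its repeated literal; an empty clause falsifies every [sat_stage]. *)
Lemma sat_stages F a b : is_2cnf F ->
  sat F a b = [&& sat_stage (same false) F a b, sat_stage (@mixed n n') F a b
                & sat_stage (same true) F a b].
Proof.
rewrite /sat /sat_stage -!all_predI => /allP two; apply: eq_in_all => C /two.
case: C => [|z [|w [|? ?]]] //= _; rewrite ?orbF.
  by case: (side z); rewrite /= ?andbT ?orbb.
by case: (side z); case: (side w); rewrite /= ?andbT // orbC.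
Qed.

Lemma split_suffix z w st st' : st' \in split_step z w st ->
  exists2 q, st'.2 = q ++ st.2 & {subset q <= [:: z; w; neg z; neg w]}.
Proof.
case: st => [t p] /=; case: ifP => _.
  by rewrite inE => /eqP->; exists [::].
case: ifP => _.
  by case: ifP => _ //; rewrite inE => /eqP->; exists [:: w] => // l; rewrite !inE => ->; rewrite orbT.
case: ifP => _; first by rewrite inE => /eqP->; exists [:: z] => // l; rewrite !inE => ->.
case: ifP => _; first by rewrite inE => /eqP->; exists [:: z] => // l; rewrite !inE => ->.
case: t => [//|t]; rewrite !inE => /or3P[] /eqP->; [exists [:: z; w]|exists [:: z; neg w]|exists [:: neg z; w]];
  by move=> // l; rewrite !inE => /orP[] ->; rewrite ?orbT.
Qed.

Lemma split_independent z w st st' :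
  independent st.2 -> st' \in split_step z w st -> independent st'.2.
Proof.
case: st => [t p] /= ind; case: ifP => [_|]; first by rewrite inE => /eqP->.
move=> /negbT; rewrite !negb_or => /and3P[zp wp zw].
case: ifP => [_|/negbT nzp].
  by case: ifP => [//|/negbT nwp]; rewrite inE => /eqP->; rewrite /independent /= fresh_lit.
case: ifP => [_|/negbT nwp].
  by rewrite inE => /eqP->; rewrite /independent /= fresh_lit.
case: ifP => [_|/negbT zw'].
  by rewrite inE => /eqP->; rewrite /independent /= fresh_lit.
case: t => [//|t].
have ne : z.1 != w.1.
  by apply: contraNneq zw' => E; move: zw E; case: z w {zp wp nzp nwp} => [x c] [y d] /= zw E;
     move: zw; rewrite /neg /= E !xpair_eqE eqxx /=; case: c d => [] [].
by rewrite !inE => /or3P[] /eqP->; rewrite /independent /= inE negb_or ne !fresh_lit.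
Qed.

Lemma force_suffix z w st st' : st' \in force_step z w st ->
  exists2 q, st'.2 = q ++ st.2 & {subset q <= [:: z; w; neg z]}.
Proof.
case: st => [t p] /=; case: ifP => _.
  by rewrite inE => /eqP->; exists [::].
case: ifP => _.
  by case: ifP => _ //; rewrite inE => /eqP->; exists [:: z] => // l; rewrite !inE => ->.
case: t => [|t]; case: ifP => _ //; rewrite !inE.
- by move/eqP->; exists [:: z] => // l; rewrite !inE => ->.
- by move/eqP->; exists [:: w] => // l; rewrite !inE => ->; rewrite orbT.
case/orP=> /eqP->; first by exists [:: z] => // l; rewrite !inE => ->.
by exists [:: neg z; w] => // l; rewrite !inE => /orP[] ->; rewrite ?orbT.
Qed.

Lemma force_independent z w st st' : z.1 != w.1 ->
  independent st.2 -> st' \in force_step z w st -> independent st'.2.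
Proof.
move=> ne; case: st => [t p] /= ind; case: ifP => [_|]; first by rewrite inE => /eqP->.
move=> /negbT; rewrite !negb_or => /andP[zp wp].
case: ifP => [_|/negbT nwp].
  by case: ifP => [//|/negbT nzp]; rewrite inE => /eqP->; rewrite /independent /= fresh_lit.
case: t => [|t]; case: ifP => [_|/negbT nzp] //; rewrite !inE.
- by move/eqP->; rewrite /independent /= fresh_lit.
- by move/eqP->; rewrite /independent /= fresh_lit.
case/orP=> /eqP->; first by rewrite /independent /= fresh_lit.
by rewrite /independent /= inE negb_or ne !fresh_lit.
Qed.

End Branching.

(** * Three-way branching: exact, or else many disjoint clauses *)

Section Correctness.

Variables n n' : nat.
Notation lit := (literal n n').
Notation state := (state n n').
Implicit Types (z w l : lit) (p : seq lit) (st : state) (F : cnf n n').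
Implicit Types (a : assignment n) (b : assignment n').

(** The successor cubes are disjoint and lie inside the solutions of the clause; dropping a branch
    only lowers the left side. *)
Lemma split_sum_le z w st a b :
  \sum_(st' <- split_step z w st) consistent a b st'.2 <=
    (consistent a b st.2 && (sat_literal a b z || sat_literal a b w) : nat).
Proof.
case: st => t p /=; have cm := @consistent_mem n n' a b p.
case: ifP => [taut|_].
  rewrite big_seq1; case C: (consistent a b p) => //=.
  have -> // : sat_literal a b z || sat_literal a b w.
  case/or3P: taut => [/(cm _ C)->|/(cm _ C)->|/eqP<-] //; first by rewrite orbT.
  by rewrite sat_neg orbN.
case: ifP => [nzp|_].
  case: ifP => [nwp|_]; first by rewrite big_nil.
  by rewrite big_seq1 /= andbC; case: (consistent _ _ _); case: (sat_literal a b w); rewrite ?orbT.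
case: ifP => [nwp|_].
  by rewrite big_seq1 /= andbC; case: (consistent _ _ _); case: (sat_literal a b z); rewrite ?orbT.
case: ifP => [/eqP->|_].
  by rewrite big_seq1 /= andbC; case: (consistent _ _ _); case: (sat_literal a b w); rewrite ?orbT.
case: t => [|t]; first by rewrite big_nil.
rewrite !big_cons big_nil /= !sat_neg.
by case: (consistent _ _ _); case: (sat_literal a b z); case: (sat_literal a b w).
Qed.

(** The hypothesis fails only when a clause with two distinct unassigned variables meets budget 0,
    the one case in which solutions are lost. *)
Lemma split_sum_eq z w st a b :
  [|| z \in st.2, w \in st.2, neg z == w, neg z \in st.2, neg w \in st.2, z == w | 0 < st.1] ->
  \sum_(st' <- split_step z w st) consistent a b st'.2 =
    (consistent a b st.2 && (sat_literal a b z || sat_literal a b w) : nat).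
Proof.
case: st => t p /=; have cm := @consistent_mem n n' a b p.
case: ifP => [taut _|/negbT].
  rewrite big_seq1; case C: (consistent a b p) => //=.
  have -> // : sat_literal a b z || sat_literal a b w.
  case/or3P: taut => [/(cm _ C)->|/(cm _ C)->|/eqP<-] //; first by rewrite orbT.
  by rewrite sat_neg orbN.
rewrite !negb_or => /and3P[/negbTE-> /negbTE-> /negbTE->] /=.
case: ifP => [nzp _|_].
  case: ifP => [nwp|_].
    rewrite big_nil; case C: (consistent a b p) => //=.
    by have := (cm _ C nzp, cm _ C nwp); rewrite !sat_neg => -[/negbTE-> /negbTE->].
  rewrite big_seq1 /= andbC; case C: (consistent a b p) => //=.
  by have := cm _ C nzp; rewrite sat_neg => /negbTE->.
case: ifP => [nwp _|_].
  rewrite big_seq1 /= andbC; case C: (consistent a b p) => //=.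
  by have := cm _ C nwp; rewrite sat_neg => /negbTE->; rewrite orbF.
case: ifP => [/eqP-> _|_].
  by rewrite big_seq1 /= orbb andbC.
case: t => [//|t] _; rewrite !big_cons big_nil /= !sat_neg.
by case: (consistent _ _ _); case: (sat_literal a b z); case: (sat_literal a b w).
Qed.

Notation tot s F := (branch_sum (same s) (@split_step n n') F).

Lemma split_total_le s F st a b :
  tot s F (fun st => consistent a b st.2) st <=
    (consistent a b st.2 && sat_stage (same s) F a b : nat).
Proof.
elim: F st => [|C F IH] st /=; first by rewrite andbT.
case: C => [|l C] //=; case: ifP => [_|//].
set w := head l C; rewrite andbA.
case S: (sat_stage (same s) F a b); last first.
  rewrite andbF leqn0; apply/eqP; apply: big1 => st' _; apply/eqP; rewrite -leqn0.
  by apply: leq_trans (IH _) _; rewrite S andbF.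
rewrite andbT; apply: leq_trans (split_sum_le l w st a b).
by apply: leq_sum => st' _; apply: leq_trans (IH _) _; rewrite S andbT.
Qed.

(* U records the clauses that were branched on above the current state.       *)
Definition branched s F0 (st : state) (U : seq (lit * lit)) : Prop :=
  [/\ uniq (clause_vars U), {subset clause_vars U <= map fst st.2}
    & {subset U <= pmap (same s) F0}].

Lemma branched_sub s F0 st st' U :
  {subset map fst st.2 <= map fst st'.2} -> branched s F0 st U -> branched s F0 st' U.
Proof. by move=> sub [u1 u2 u3]; split=> // x /u2/sub. Qed.

(** Q need not be decidable; finiteness of the list is what allows the choice. *)
Lemma all_or (T : eqType) (s : seq T) (P : T -> Prop) (Q : Prop) :
  (forall x, x \in s -> P x \/ Q) -> (forall x, x \in s -> P x) \/ Q.
Proof.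
elim: s => [|x s IH] H; first by left.
case: (H x (mem_head _ _)) => [Px|]; last by right.
case: IH => [y ys|Ps|]; [by apply: H; rewrite inE ys orbT|left|by right].
by move=> y; rewrite inE => /orP[/eqP->|/Ps].
Qed.

(** If some branch is cut, take the clauses branched on above it together with the clause that could
    not be afforded. A branching happens on unassigned variables and assigns both of them, so these
    clauses share no variable, and there is one more of them than the budget allows. *)
Lemma split_total s F0 F st U :
  {subset pmap (same s) F <= pmap (same s) F0} -> branched s F0 st U ->
  (forall a b, tot s F (fun st => consistent a b st.2) st =
    (consistent a b st.2 && sat_stage (same s) F a b : nat)) \/
  exists M, [/\ size M = (st.1 + size U).+1, uniq (clause_vars M)
    & {subset M <= pmap (same s) F0}].
Proof.
elim: F st U => [|C F IH] st U sub br; first by left=> a b /=; rewrite andbT.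
case: C sub => [|l C] sub; first by left=> a b /=; rewrite andbF.
rewrite /= in sub *; case: ifP sub => [side_lw|_] sub; last exact: IH br.
set w := head l C in sub side_lw *.
have lw : (l, w) \in pmap (same s) F0 by apply: sub; rewrite mem_head.
have {}sub : {subset pmap (same s) F <= pmap (same s) F0}.
  by move=> c cF; apply: sub; rewrite /= inE cF orbT.
have [ok|] := boolP [|| l \in st.2, w \in st.2, neg l == w, neg l \in st.2,
  neg w \in st.2, l == w | 0 < st.1].
  have {IH} : (forall st', st' \in split_step l w st ->
     (forall a b, tot s F (fun st => consistent a b st.2) st' =
       (consistent a b st'.2 && sat_stage (same s) F a b : nat))) \/
    exists M, [/\ size M = (st.1 + size U).+1, uniq (clause_vars M)
      & {subset M <= pmap (same s) F0}].
    apply: all_or => st' st'_in.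
    (* Invariant: remaining budget plus number of recorded clauses is constant along a path. *)
    have [U' [br' szU]] : exists U', branched s F0 st' U' /\ st'.1 + size U' = st.1 + size U.
      have [q Eq _] := split_suffix st'_in.
      have keep : branched s F0 st' U.
        by apply: branched_sub br; rewrite Eq map_cat => x xs; rewrite mem_cat xs orbT.
      move: br keep st'_in {Eq q ok}; case: st => [t p] br keep /=.
      case: ifP => [_|/negbT]; first by rewrite inE => /eqP E; exists U; rewrite E.
      rewrite !negb_or => /and3P[lp wp nlw].
      case: ifP => [_|/negbT nlp].
        by case: ifP => // _; rewrite inE => /eqP E; exists U; rewrite {2}E.
      case: ifP => [_|/negbT nwp]; first by rewrite inE => /eqP E; exists U; rewrite {2}E.
      case: ifP => [_|/negbT lw']; first by rewrite inE => /eqP E; exists U; rewrite {2}E.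
      case: t br => [//|t] [u1 u2 u3] st'_in; exists ((l, w) :: U).
      have ne : l.1 != w.1.
        apply: contraNneq lw' => E; move: nlw E; rewrite /neg; case: (l) (w) => [x c] [y d] /= nlw E.
        by move: nlw; rewrite E !xpair_eqE eqxx /=; case: (c); case: (d).
      have notU x : x \notin map fst p -> x \notin clause_vars U.
        by apply: contra => /u2.
      have [v1 v2] : [/\ l.1 \in map fst st'.2 & w.1 \in map fst st'.2].
        by move: st'_in; rewrite !inE => /or3P[] /eqP->; rewrite /= !inE !eqxx ?orbT.
      have t' : st'.1 = t by move: st'_in; rewrite !inE => /or3P[] /eqP->.
      split; last by rewrite t' /= addnS.
      split.
      + by rewrite /= inE negb_or ne !notU ?fresh_lit.
      + move=> x; rewrite !inE => /or3P[/eqP->//|/eqP->//|xU].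
        by case: keep => _ /(_ _ xU).
      + by move=> c; rewrite inE => /orP[/eqP->|/u3].
    by have := IH st' U' sub br'; rewrite szU.
  case=> [eq|]; [left=> a b|by right].
  rewrite andbA; case S: (sat_stage (same s) F a b); last first.
    by rewrite andbF; apply: big1_seq => st' /andP[_ st'_in]; rewrite eq // S andbF.
  rewrite andbT -split_sum_eq //; apply: eq_big_seq => st' st'_in.
  by rewrite eq // S andbT.
rewrite !negb_or -leqNgt leqn0 => /and5P[lp wp nlw nlp] /and3P[nwp lw' /eqP t0].
right; exists ((l, w) :: U); case: br => u1 u2 u3; split.
+ by rewrite t0.
+ have ne : l.1 != w.1.
    apply: contraNneq lw' => E; move: nlw E; rewrite /neg; case: (l) (w) => [x c] [y d] /= nlw' E.
    by move: nlw'; rewrite E !xpair_eqE eqxx /=; case: (c); case: (d).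
  have notU x : x \notin map fst st.2 -> x \notin clause_vars U by apply: contra => /u2.
  by rewrite /= inE negb_or ne !notU ?fresh_lit.
+ by move=> c; rewrite inE => /orP[/eqP->|/u3].
Qed.

End Correctness.

(** * Thresholds, counting over y, and forced literals *)

Section Leaves.

Variables n n' : nat.
Notation lit := (literal n n').
Notation state := (state n n').
Implicit Types (z w l : lit) (p : seq lit) (st : state) (F : cnf n n').
Implicit Types (a : assignment n) (b : assignment n').

Lemma card_pred_sum (T : finType) (P : pred T) : #|P| = \sum_x (P x : nat).
Proof. by rewrite -sum1_card big_mkcond. Qed.

Lemma same_side s C z w : same s C = Some (z, w) ->
  side (z : lit) = s /\ side (w : lit) = s.
Proof. by case: C => //= l C; case: ifP => // /andP[/eqP<- /eqP E] [<- <-]. Qed.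

Lemma mixed_side C z w : mixed C = Some (z, w) ->
  side (z : lit) = false /\ side (w : lit) = true.
Proof.
case: C => //= l C; case: ifP => // /negbT; set u := head l C => ne.
by case E: (side l) ne => ne [<- <-]; split=> //; case: (side u) ne.
Qed.

Lemma sat_stage_pmap s F M a b : {subset M <= pmap (same s) F} ->
  sat_stage (same s) F a b ->
  all (fun c => sat_literal a b c.1 || sat_literal a b c.2) M.
Proof.
move=> sub /allP satF; apply/allP => -[z w] /sub; rewrite mem_pmap => /mapP[C CF E].
by have := satF C CF; case: C CF E => // l C CF E; rewrite -E.
Qed.

Lemma clause_vars_side s F M x : {subset M <= pmap (@same n n' s) F} ->
  x \in clause_vars M -> in_x x = ~~ s.
Proof.
move=> sub /flattenP[_ /mapP[[z w] /sub zwF ->]].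
move: zwF; rewrite mem_pmap => /mapP[C _ /esym/same_side[sz sw]].
rewrite !inE => /orP[] /eqP-> /=; [rewrite -sz | rewrite -sw].
  by case: (z) => [[]].
by case: (w) => [[]].
Qed.

(** The clauses of M mention x only, so b is a dummy; [card_disjoint_clauses] applies with
    [flip_x]. *)
Lemma card_sat_x_le F M (P : pred (assignment n)) b :
  {subset M <= pmap (same false) F} -> uniq (clause_vars M) ->
  (forall a, P a -> sat_stage (same false) F a b) ->
  4 ^ size M * #|P| <= 3 ^ size M * 2 ^ n.
Proof.
move=> sub uM Psat; rewrite -(card_assignment n).
rewrite -(@card_disjoint_clauses _ _ (fun a => value a b) _ _ (@flip_xK n n') (value_flip_x b) M).
- rewrite leq_mul2l; apply/orP; right; apply: subset_leq_card.
  by apply/subsetP => a /Psat; apply: sat_stage_pmap sub.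
- by apply/allP => x /(clause_vars_side sub).
- by [].
Qed.

Lemma card_sat_y_le F M (P : pred (assignment n')) a :
  {subset M <= pmap (same true) F} -> uniq (clause_vars M) ->
  (forall b, P b -> sat_stage (same true) F a b) ->
  4 ^ size M * #|P| <= 3 ^ size M * 2 ^ n'.
Proof.
move=> sub uM Psat; rewrite -(card_assignment n').
rewrite -(@card_disjoint_clauses _ _ (value a) _ _ (@flip_yK n n') (value_flip_y a) M).
- rewrite leq_mul2l; apply/orP; right; apply: subset_leq_card.
  by apply/subsetP => b /Psat; apply: sat_stage_pmap sub.
- by apply/allP => x /(clause_vars_side sub)->.
- by [].
Qed.

(** The leading bits give 2 ^ (|p| - 1) <= p and r < 2 ^ |r|, where the budget is |r| + 1 - |p|; the
    opposite estimates give [budget_le]. *)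
Lemma budget_lt q : 0 < q.1 < q.2 -> q.2 < q.1 * 2 ^ budget q.
Proof.
case: q => p r /= /andP[p0 pr]; rewrite /budget /=.
have lp : 2 ^ (size (bits p)).-1 <= p.
  rewrite -{2}(num_bitsE p); apply: canonical_num (canonical_bits p) _.
  by apply: contraL p0 => /eqP E; rewrite -(num_bitsE p) E.
have lr : r < 2 ^ size (bits r) by rewrite -{1}(num_bitsE r) num_lt.
apply: leq_trans lr _; apply: leq_trans (leq_mul lp (leqnn _)); rewrite -expnD leq_exp2l //.
by have := size_bits_mono (ltnW pr); lia.
Qed.

Lemma budget_le q : 0 < q.1 < q.2 -> q.1 * 2 ^ budget q <= 4 * q.2.
Proof.
case: q => p r /= /andP[p0 pr]; rewrite /budget /=.
have lp : p < 2 ^ size (bits p) by rewrite -{1}(num_bitsE p) num_lt.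
have r0 : bits r != [::].
  apply: contraL pr => /eqP E; rewrite -(num_bitsE r) E /=; lia.
have lr : 2 ^ (size (bits r)).-1 <= r.
  by rewrite -{2}(num_bitsE r); apply: canonical_num (canonical_bits r) r0.
have le := size_bits_mono (ltnW pr).
apply: leq_trans (leq_mul (ltnW lp) (leqnn _)) _; rewrite -expnD.
apply: leq_trans (leq_mul (leqnn 4) lr); rewrite -[4]/(2 ^ 2) -expnD leq_exp2l //.
by case: (bits r) r0 le => //= *; lia.
Qed.

(** Since 27/64 <= 1/2, the hypothesis bounds c / 2 ^ N by 3/4 of 2 ^ - budget, and 2 ^ - budget is
    below q by [budget_lt]. *)
Lemma few_solutions q c N : 0 < q.1 < q.2 ->
  4 ^ (3 * budget q).+1 * c <= 3 ^ (3 * budget q).+1 * 2 ^ N -> c * q.2 < 2 ^ N * q.1.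
Proof.
move=> q01; have lt := budget_lt q01; rewrite !expnS !expnM.
rewrite -[4 ^ 3]/64 -[3 ^ 3]/27; case: q q01 lt => p r /=; set K := budget _.
move=> /andP[p0 _] lt le.
have pX : 0 < 2 ^ N by rewrite expn_gt0.
have pA : 0 < 64 ^ K by rewrite expn_gt0.
have pB : 0 < 27 ^ K by rewrite expn_gt0.
have leA : 27 ^ K * 2 ^ K <= 64 ^ K.
  by rewrite -expnMn; case: (K) => // k; rewrite leq_exp2r.
rewrite -(@ltn_pmul2l (64 ^ K)) //.
move: (27 ^ K) (64 ^ K) (2 ^ K) (2 ^ N) pX pA pB leA lt le => B A D X.
move=> pX pA pB leA lt le.
have h1 : 4 * A * c * r <= 3 * B * X * r by rewrite leq_mul2r le orbT.
have h2 : 3 * B * X * r <= 3 * X * p * (B * D) by nia.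
have h3 : 3 * X * p * (B * D) <= 3 * X * p * A by rewrite leq_mul2l leA orbT.
have h4 : 0 < A * (X * p) by rewrite !muln_gt0 pA pX.
have h5 : 4 * (A * (c * r)) <= 3 * (A * (X * p)) by nia.
lia.
Qed.

Lemma foldl_add_volume q v (s : seq state) :
  foldl (@add_volume n n' q) v s = v + (\sum_(st <- s) 2 ^ room true n' st.2) * q.
Proof.
elim: s v => [|st s IH] v /=; first by rewrite big_nil addn0.
by rewrite IH big_cons mulnDl addnA.
Qed.

(** Only the clauses over y are asked for: at a leaf of [mstage] the mixed clauses are already
    settled by the cube. *)
Definition extensions F a p : nat :=
  #|[pred b | consistent a b p && sat_stage (same true) F a b]|.

Lemma ystage_cube F a d p st : independent p -> cons_x a p ->
  st \in ystage F [:: (d, p)] -> independent st.2 && cons_x a st.2.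
Proof.
move=> ind ca.
apply: (@stage_ind n n' _ _ F [:: (d, p)] (fun st => independent st.2 && cons_x a st.2)).
  move=> C z w {}st /same_side[sz sw] /andP[ind' ca'] st' st'_in.
  rewrite (split_independent ind' st'_in) /=.
  have [q -> sub] := split_suffix st'_in; rewrite /cons_x all_cat; apply/andP; split=> //.
  apply/allP => l /sub; rewrite !inE => /or4P[] /eqP->; move: sz sw; rewrite /side /sat_x /=;
    by [case: (z.1)|case: (w.1)].
by move=> st'; rewrite inE => /eqP-> /=; rewrite ind.
Qed.

(** Double counting of the pairs of a leaf and an assignment b in its cube. *)
Lemma sum_ystage F a d p : independent p -> cons_x a p ->
  \sum_(st <- ystage F [:: (d, p)]) 2 ^ room true n' st.2 =
  \sum_b branch_sum (same true) (@split_step n n') F (fun st => consistent a b st.2) (d, p).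
Proof.
move=> ind ca; have E b : branch_sum (same true) (@split_step n n') F
    (fun st => consistent a b st.2) (d, p) =
    \sum_(st <- ystage F [:: (d, p)]) consistent a b st.2.
  by rewrite sum_stage big_seq1.
rewrite (eq_bigr _ (fun b _ => E b)).
rewrite exchange_big /=; apply: eq_big_seq => st /(ystage_cube ind ca) /andP[ind' ca'].
by rewrite -card_cons_y // card_pred_sum; apply: eq_bigr => b _; rewrite consistentE ca'.
Qed.

Lemma sum_ystage_le F a d p : independent p -> cons_x a p ->
  \sum_(st <- ystage F [:: (d, p)]) 2 ^ room true n' st.2 <= extensions F a p.
Proof.
move=> ind ca; rewrite (sum_ystage _ _ ind ca) /extensions card_pred_sum.
by apply: leq_sum => b _; apply: split_total_le.
Qed.

Lemma volume_le F q a d p : independent p -> cons_x a p ->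
  volume F q d p <= extensions F a p * q.
Proof.
move=> ind ca; rewrite /volume foldl_add_volume add0n.
by rewrite leq_mul2r sum_ystage_le ?orbT.
Qed.

(** If the leaves partition the extensions, the volume is exact. Otherwise the extensions are too
    few by [few_solutions], the volume is at most their number times the denominator, and both sides
    are false. *)
Lemma heavy_leafE F q a p : 0 < q.1 < q.2 -> independent p -> cons_x a p ->
  heavy_leaf F q (3 * budget q) p = (2 ^ n' * q.1 <= extensions F a p * q.2).
Proof.
move=> q01 ind ca; set d := 3 * budget q.
have [|eq|[M [szM uM subM]]] :=
  @split_total n n' true F F (d, p) [::] (fun _ => id).
- by split.
- rewrite /heavy_leaf /volume foldl_add_volume add0n (sum_ystage _ _ ind ca).
  congr (_ <= _ * _); rewrite /extensions card_pred_sum; apply: eq_bigr => b _.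
  by rewrite (eq a b).
have lt : extensions F a p * q.2 < 2 ^ n' * q.1.
  apply: few_solutions q01 _; rewrite /= addn0 -/d in szM; rewrite -szM.
  apply: (card_sat_y_le (a := a) subM uM) => b.
  by case/andP.
rewrite /heavy_leaf leqNgt (leq_ltn_trans (volume_le _ _ _ ind ca) lt) //.
by rewrite leqNgt lt.
Qed.

Notation force_sum F := (branch_sum (@mixed n n') (@force_step n n') F).

Lemma cons_x_suffix a p q : ~~ cons_x a p -> ~~ cons_x a (q ++ p).
Proof. by apply: contra; rewrite /cons_x all_cat => /andP[]. Qed.

Lemma force_sum0 F a h st : ~~ cons_x a st.2 ->
  force_sum F (fun st => cons_x a st.2 && h st) st = 0.
Proof.
elim: F st => [|C F IH] st /= nca; first by rewrite (negbTE nca).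
case: C => // l C; case: (mixed _) => [[z w]|]; last exact: IH.
apply: big1_seq => st' /andP[_ st'_in]; apply: IH.
by have [q -> _] := force_suffix st'_in; apply: cons_x_suffix.
Qed.

#[local] Arguments mixed {n n'} C : simpl never.

(** Only one path keeps a in its cube, since the value of z under a selects the option; all other
    subtrees contribute 0 ([force_sum0]). At the end of that path the cube describes exactly the b
    satisfying the mixed clauses, and there h equals T. The path stops earlier only at a
    contradiction or when the budget is spent, and then the last hypothesis gives T = false. The sum
    of budget and number of literals over y stays equal to k. *)
Lemma force_sumE F a (T : bool) h k st :
  independent st.2 -> cons_x a st.2 ->
  st.1 + count (fun l => side l == true) st.2 = k ->
  (forall st', independent st'.2 -> cons_x a st'.2 ->
    (forall b, consistent a b st'.2 =
       consistent a b st.2 && sat_stage (@mixed n n') F a b) -> h st' = T) ->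
  (#|[pred b | consistent a b st.2 && sat_stage (@mixed n n') F a b]| * 2 ^ k <= 2 ^ n'
     -> T = false) ->
  force_sum F (fun st => cons_x a st.2 && h st) st = T.
Proof.
elim: F st => [|C F IH] st ind ca szk hT Tf.
  by rewrite /= ca (hT st) // => b; rewrite andbT.
case: C hT Tf => [|l0 C] hT Tf.
  rewrite /= Tf // (@eq_card0 _ [pred b | _]) //.
  by move=> b; rewrite !inE /= andbF.
rewrite /= in hT Tf *; case E: (mixed (l0 :: C)) hT Tf => [[z l]|] hT Tf; last exact: IH.
have [sz sl] := mixed_side E.
have szb b : sat_literal a b z = sat_x a z.
  by move: sz; rewrite /sat_literal /sat_x /side; case: (z.1).
have cm b l' : consistent a b st.2 -> l' \in st.2 -> sat_literal a b l'.
  by move=> c; apply: consistent_mem c.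
have card0 : (forall b, consistent a b st.2 -> (sat_literal a b z || sat_literal a b l) = false)
    -> T = false.
  move=> H; apply: Tf; rewrite (@eq_card0 _ [pred b | _]) // => b; rewrite !inE /=.
  by case Cb: (consistent a b st.2) => //=; rewrite H.
have ne : z.1 != l.1.
  by move: sz sl; rewrite /side; case: (z.1) => x; case: (l.1).
(* The successor that contains a: its added literals q are equivalent to the clause, given the old
   cube. *)
have IHq st' q : st' = (st'.1, q ++ st.2) -> independent st'.2 ->
    st'.1 + count (fun l => side l == true) st'.2 = k -> cons_x a q ->
    (forall b, consistent a b st.2 -> consistent a b q =
      (sat_literal a b z || sat_literal a b l)) ->
    force_sum F (fun st => cons_x a st.2 && h st) st' = T.
  move=> Est ind' szk' cq cqb.
  have EC b : consistent a b st'.2 =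
      consistent a b st.2 && (sat_literal a b z || sat_literal a b l).
    rewrite Est /consistent /= all_cat -!/(consistent _ _ _) andbC.
    by case Cb: (consistent a b st.2) => //=; rewrite cqb.
  apply: IH => //.
  - by rewrite Est /cons_x /= all_cat -!/(cons_x _ _) cq.
  - move=> st'' ind'' ca'' H; apply: hT => // b.
    by rewrite H EC andbA.
  - move=> le; apply: Tf; rewrite (eq_card (_ : _ =i [pred b | consistent a b st'.2 && sat_stage (@mixed n n') F a b])) //.
    by move=> b; rewrite !inE EC andbA.
have dead t q : ~~ cons_x a q ->
    force_sum F (fun st => cons_x a st.2 && h st) (t, q ++ st.2) = 0.
  by move=> nq; apply: force_sum0; rewrite /cons_x all_cat negb_and nq.
have satN l' : sat_x a (neg l') = ~~ sat_x a l' \/ in_x l'.1 = false.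
  by case: l' => [[i|j] c]; [left|right]; rewrite /sat_x //=; case: (a i); case: c.
have sat_xN : sat_x a (neg z) = ~~ sat_x a z.
  by case: (satN z) => //; move: sz; rewrite /side; case: (z.1) => //=.
have sat_xl : sat_x a l = true by move: sl; rewrite /side /sat_x; case: (l.1).
case: st ind ca szk hT Tf cm card0 IHq dead => t p /= ind ca szk hT Tf cm card0 IHq dead.
case: ifP => [/orP zl|/negbT].
  rewrite big_seq1; apply: (IHq (t, p) [::]) => // b cb; apply/esym.
  by case: zl => /(cm _ _ cb)->; rewrite ?orbT.
rewrite negb_or => /andP[zp lp].
have big1z (t' : nat) : sat_x a z -> neg z \notin p -> t' = t ->
    force_sum F (fun st => cons_x a st.2 && h st) (t', z :: p) = T.
  move=> saz nzp ->; apply: (IHq (t, z :: p) [:: z]) => //=.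
  - by rewrite /independent /= fresh_lit.
  - by rewrite sz.
  - by rewrite saz.
  - by move=> b cb; rewrite szb saz.
have big1nz (t' : nat) : ~~ sat_x a z ->
    force_sum F (fun st => cons_x a st.2 && h st) (t', z :: p) = 0.
  by move=> saz; apply: (dead t' [:: z]); rewrite /cons_x /= (negbTE saz).
have nzp_sat : neg z \in p -> sat_x a z = false.
  by move=> nzp; have := allP ca _ nzp; rewrite sat_xN => /negbTE.
case: ifP => [nlp|/negbT nlp].
  have nl b : consistent a b p -> sat_literal a b l = false.
    by move=> cb; have := cm _ _ cb nlp; rewrite sat_neg => /negbTE.
  case: ifP => [nzp|/negbT nzp].
    by rewrite big_nil card0 // => b cb; rewrite szb nzp_sat ?nl.
  rewrite big_seq1; case: (boolP (sat_x a z)) => saz; first exact: big1z.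
  by rewrite big1nz // card0 // => b cb; rewrite szb (negbTE saz) nl.
have l_ok t' : t = t'.+1 -> ~~ sat_x a z -> neg z \in p ->
    force_sum F (fun st => cons_x a st.2 && h st) (t', l :: p) = T.
  move=> Et saz nzp; apply: (IHq (t', l :: p) [:: l]) => //=.
  - by rewrite /independent /= fresh_lit.
  - by rewrite sl -szk Et /= ?addnA ?addn1.
  - by rewrite sat_xl.
  - by move=> b cb; rewrite szb (negbTE saz) andbT.
case: t szk IHq big1z big1nz l_ok => [|t] szk IHq big1z big1nz l_ok.
  have Tf' : sat_x a z = false -> T = false.
    move=> saz; apply: Tf.
    (* At budget 0 the cube already has k literals over y. With z false under a, l becomes one more,
       so at most 2 ^ (n' - k - 1) assignments b remain. *)
    apply: (@leq_trans (#|[pred b | cons_y b (l :: p)]| * 2 ^ k)).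
      rewrite leq_mul2r; apply/orP; right; apply: subset_leq_card.
      apply/subsetP => b; rewrite !inE szb saz /= consistentE ca /= => /andP[cy /andP[sl' _]].
      apply/andP; split=> //; move: sl'; rewrite /sat_literal /sat_y.
      by case: (l.1).
    rewrite card_cons_y; last by rewrite /independent /= fresh_lit.
    rewrite /room /= sl eqxx -szk add0n -expnD leq_exp2l //.
    have ind' : independent (l :: p) by rewrite /independent /= fresh_lit.
    have := pow2_le (cube_y ind').
    rewrite /= sl eqxx => le; apply: leq_trans _ (eq_leq (subnK le));
      by rewrite leq_add2l add1n leqnSn.
  case: ifP => [nzp|/negbT nzp]; first by rewrite big_nil Tf' // nzp_sat.
  rewrite big_seq1; case: (boolP (sat_x a z)) => saz; first exact: big1z.
  by rewrite big1nz // Tf' // (negbTE saz).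
case: ifP => [nzp|/negbT nzp].
  by rewrite big_seq1; apply: l_ok; rewrite ?nzp_sat.
rewrite !big_cons big_nil addn0; case: (boolP (sat_x a z)) => saz.
  rewrite big1z //; have -> := dead t [:: neg z; l]; first by rewrite addn0.
  by rewrite /cons_x /= sat_xN saz.
rewrite big1nz // add0n; apply: (IHq (t, [:: neg z, l & p]) [:: neg z; l]) => //=.
- by rewrite /independent /= inE negb_or ne !fresh_lit.
- have szN : side (neg z) = false := sz.
  by rewrite szN sl -szk /= !addnA !addn0 ?addn1.
- by rewrite sat_xN saz sat_xl.
- by move=> b cb; rewrite sat_neg szb (negbTE saz) /= andbT.
Qed.

End Leaves.

(** * The sums over the leaves give the answer *)

Section Answer.

Variables n n' : nat.
Notation lit := (literal n n').
Notation state := (state n n').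
Implicit Types (z w l : lit) (p : seq lit) (st : state) (F : cnf n n').
Implicit Types (a : assignment n) (b : assignment n').

Notation force_sum F := (branch_sum (@mixed n n') (@force_step n n') F).

Lemma xstage_cube F d st : st \in xstage F [:: (d, [::])] ->
  independent st.2 && all (fun l => side l == false) st.2.
Proof.
apply: (@stage_ind n n' _ _ F _
  (fun st => independent st.2 && all (fun l => side l == false) st.2)).
  move=> C z w {}st /same_side[sz sw] /andP[ind' ca'] st' st'_in.
  rewrite (split_independent ind' st'_in) /=.
  have [q -> sub] := split_suffix st'_in; rewrite all_cat; apply/andP; split=> //.
  by apply/allP => l /sub; rewrite !inE => /or4P[] /eqP->; apply/eqP.
by move=> st'; rewrite inE => /eqP->.
Qed.

Lemma mstage_independent F st0 st : independent st0.2 ->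
  st \in mstage F [:: st0] -> independent st.2.
Proof.
move=> ind; apply: (@stage_ind n n' _ _ F _ (fun st => independent st.2)).
  move=> C z w {}st /mixed_side[sz sw] ind' st'; apply: force_independent ind'.
  by move: sz sw; rewrite /side; case: (z.1) => x; case: (w.1).
by move=> st'; rewrite inE => /eqP->.
Qed.

Lemma consistent_x a b p : all (fun l => side l == false) p -> consistent a b p = cons_x a p.
Proof.
move=> px; rewrite consistentE andbC; have -> // : cons_y b p.
apply/allP => l /(allP px); rewrite /side /sat_y.
by case: (l.1).
Qed.

Definition heavy_by F (q : nat * nat) a : bool :=
  2 ^ n' * q.1 <= #|[pred b | sat F a b]| * q.2.

(** Instance of [force_sumE] with k the budget of q: leaving at most a fraction 2 ^ - k of the b is
    below the threshold by [budget_lt]. The constant assignment is a dummy, since clauses over x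
    ignore b. *)
Lemma force_sum_heavy F q a st : is_2cnf F -> 0 < q.1 < q.2 ->
  sat_stage (same false) F a [ffun=> false] ->
  independent st.2 && all (fun l => side l == false) st.2 -> cons_x a st.2 ->
  force_sum F (fun st => cons_x a st.2 && heavy_leaf F q (3 * budget q) st.2)
    (budget q, st.2) = heavy_by F q a.
Proof.
move=> two q01 satx /andP[ind px] ca.
have satF b : sat F a b = sat_stage (@mixed n n') F a b && sat_stage (same true) F a b.
  rewrite sat_stages //; have -> // : sat_stage (same false) F a b.
  apply: sub_all (satx) => -[|l C] //; case E: same => [[z w]|] //.
  have [sz sw] := same_side E; move: sz sw; rewrite /sat_literal /side.
  by case: (z.1) => // i _; case: (w.1).
have cst b : consistent a b st.2 by rewrite consistent_x.
apply: (@force_sumE _ _ _ _ _ (fun st => heavy_leaf F q (3 * budget q) st.2) (budget q)) => //=.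
- rewrite (_ : count _ _ = 0) ?addn0 //; apply/eqP; rewrite -leqn0 leqNgt -has_count.
  by apply/hasPn => l /(allP px) /eqP->.
- move=> st' ind' ca' H; rewrite (heavy_leafE F q01 ind' ca') /heavy_by /extensions.
  by congr (_ <= _ * _); apply: eq_card => b; rewrite !inE H cst satF.
move=> le; apply: negbTE; rewrite -ltnNge; move: le; set c := #|_| => le.
have le' : #|[pred b | sat F a b]| <= c.
  by apply: subset_leq_card; apply/subsetP => b; rewrite !inE cst satF => /andP[].
have := budget_lt q01; case: q q01 {satx} le => r t /= /andP[r0 _]; set K := budget _ => le lt.
rewrite -(@ltn_pmul2r (2 ^ K)) ?expn_gt0 //.
apply: (@leq_ltn_trans (2 ^ n' * t)).
  by rewrite mulnAC leq_mul2r (leq_trans (leq_mul le' (leqnn _)) le) orbT.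
by rewrite -mulnA ltn_pmul2l ?expn_gt0.
Qed.

Lemma foldl_add_leaf F rho sigma x (s : seq state) :
  let v := \sum_(st <- s) heavy_leaf F sigma (3 * budget sigma) st.2
             * 2 ^ room false n st.2 in
  foldl (add_leaf F rho sigma) x s = (x.1 + v, x.2 + v * rho.2).
Proof.
elim: s x => [|st s IH] x /=; first by rewrite big_nil mul0n !addn0; case: x.
by rewrite IH big_cons /add_leaf; case: heavy_leaf; rewrite /= ?mul1n ?mul0n ?mulnDl ?addnA.
Qed.

Lemma foldl_add_leaves F rho sigma x (s : seq state) :
  let v := \sum_(st <- s) \sum_(st' <- mstage F [:: (budget sigma, st.2)])
    heavy_leaf F sigma (3 * budget sigma) st'.2 * 2 ^ room false n st'.2 in
  foldl (add_leaves F rho sigma) x s = (x.1 + v, x.2 + v * rho.2).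
Proof.
elim: s x => [|st s IH] x /=; first by rewrite big_nil mul0n !addn0; case: x.
by rewrite IH big_cons /add_leaves foldl_add_leaf /= mulnDl !addnA.
Qed.

(** Double counting again, now of the pairs of a leaf and an assignment a in its cube; h depends on
    the leaf alone. *)
Lemma sum_mstage F (h : pred state) st0 : independent st0.2 ->
  \sum_(st <- mstage F [:: st0]) h st * 2 ^ room false n st.2 =
  \sum_a force_sum F (fun st => cons_x a st.2 && h st) st0.
Proof.
move=> ind; have E a : force_sum F (fun st => cons_x a st.2 && h st) st0 =
    \sum_(st <- mstage F [:: st0]) (cons_x a st.2 && h st).
  by rewrite sum_stage big_seq1.
rewrite (eq_bigr _ (fun a _ => E a)) exchange_big /=; apply: eq_big_seq => st st_in.
rewrite -card_cons_x ?(mstage_independent ind st_in) // card_pred_sum big_distrr /=.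
by apply: eq_bigr => a _; rewrite mulnC mulnb.
Qed.

Notation split_sum F := (branch_sum (same false) (@split_step n n') F).

(** The budgets for sigma thus cause no error at all; only the coverage of a by the leaves over x
    can fall short. *)
Lemma leaf_sums1 F rho sigma : is_2cnf F -> 0 < sigma.1 < sigma.2 ->
  (leaf_sums F rho sigma).1 =
  \sum_a heavy_by F sigma a *
    split_sum F (fun st => consistent a [ffun=> false] st.2) (3 * budget rho, [::]).
Proof.
move=> two s01; rewrite /leaf_sums foldl_add_leaves /= add0n.
have E a : split_sum F (fun st => consistent a [ffun=> false] st.2) (3 * budget rho, [::]) =
    \sum_(st <- xstage F [:: (3 * budget rho, [::])]) consistent a [ffun=> false] st.2.
  by rewrite sum_stage big_seq1.
under [RHS]eq_bigr => a _ do rewrite E big_distrr /=.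
rewrite exchange_big /=; apply: eq_big_seq => st st_in.
have cube := xstage_cube st_in; have /andP[ind px] := cube.
rewrite (sum_mstage F (fun st => heavy_leaf F sigma (3 * budget sigma) st.2)) //.
apply: eq_bigr => a _; rewrite consistent_x //.
case: (boolP (cons_x a st.2)) => ca; last by rewrite muln0 force_sum0.
rewrite muln1 force_sum_heavy //.
(* The leaf [st] contains a, so the sum over all leaves is positive and the bound forces a to
   satisfy the clauses over x. *)
have := split_total_le false F (3 * budget rho, [::]) a [ffun=> false].
rewrite E (big_rem _ st_in) /= consistent_x // ca add1n.
by case: (sat_stage _ _ _ _).
Qed.

Lemma heavy_by_sat F q a : is_2cnf F -> 0 < q.1 -> heavy_by F q a ->
  sat_stage (same false) F a [ffun=> false].
Proof.
move=> two q0; rewrite /heavy_by.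
case: (pickP [pred b | sat F a b]) => [b /= | none]; last first.
  by rewrite (eq_card0 none) mul0n leqn0 muln_eq0 expn_eq0 /= eqn0Ngt q0.
rewrite sat_stages // => /andP[satx _] _.
apply: sub_all (satx) => -[|l C] //; case E: same => [[z w]|] //.
have [sz sw] := same_side E; move: sz sw; rewrite /sat_literal /side.
by case: (z.1) => // i _; case: (w.1).
Qed.

(** When the branching over x is exact, so is the count, because heavy assignments satisfy the
    clauses over x. Otherwise the heavy assignments lie among the few solutions of many disjoint
    clauses, and both the true count and the computed one miss the threshold. *)
Theorem answerE F rho sigma : is_2cnf F ->
  0 < rho.1 < rho.2 -> 0 < sigma.1 < sigma.2 ->
  answer F rho sigma =
    if 2 ^ n * rho.1 <= #|[pred a | heavy_by F sigma a]| * rho.2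
    then Some #|[pred a | heavy_by F sigma a]| else None.
Proof.
move=> two r01 s01; set c := #|_|.
have E2 : (leaf_sums F rho sigma).2 = (leaf_sums F rho sigma).1 * rho.2.
  by rewrite /leaf_sums foldl_add_leaves /= !add0n.
have [sig0 _] := andP s01.
have hs a : heavy_by F sigma a = heavy_by F sigma a && sat_stage (same false) F a [ffun=> false].
  by case: (boolP (heavy_by _ _ _)) => // /(heavy_by_sat two sig0)->.
have [|eq|[M [szM uM subM]]] :=
  @split_total n n' false F F (3 * budget rho, [::]) [::] (fun _ => id).
- by split.
- have E1 : (leaf_sums F rho sigma).1 = c.
    rewrite leaf_sums1 // /c card_pred_sum; apply: eq_bigr => a _.
    by rewrite (eq a [ffun=> false]) /= mulnb -hs.
  by rewrite /answer E2 E1.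
have lt : c * rho.2 < 2 ^ n * rho.1.
  apply: few_solutions r01 _; rewrite /= addn0 in szM; rewrite -szM.
  by apply: (card_sat_x_le (b := [ffun=> false]) subM uM) => a; apply: heavy_by_sat.
have le : (leaf_sums F rho sigma).1 <= c.
  rewrite leaf_sums1 // /c card_pred_sum; apply: leq_sum => a _.
  rewrite /= -[leqRHS]muln1 leq_mul2l; apply/orP; right.
  by apply: leq_trans (split_total_le _ _ _ _ _) _; case: (_ && _).
have /negbTE nc : ~~ (2 ^ n * rho.1 <= c * rho.2) by rewrite -ltnNge.
rewrite /answer E2 nc ifF //; apply/negbTE; rewrite -ltnNge.
by apply: leq_ltn_trans lt; rewrite leq_mul2r le orbT.
Qed.

End Answer.

(** * Number of branches *)

Lemma leq_exp2rW i j e : i <= j -> i ^ e <= j ^ e.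
Proof. by case: e => // e; rewrite leq_exp2r. Qed.

Section Bounds.

Variables n n' : nat.
Notation lit := (literal n n').
Notation state := (state n n').
Implicit Types (z w l : lit) (p : seq lit) (st : state) (F : cnf n n').
Implicit Types (a : assignment n) (b : assignment n').

Notation force_sum F := (branch_sum (@mixed n n') (@force_step n n') F).

#[local] Arguments mixed {n n'} C : simpl never.

Lemma size_stage_sum o (step : lit -> lit -> state -> seq state) F st :
  size (stage o step F [:: st]) = branch_sum o step F (fun=> 1) st.
Proof. by rewrite -sum1_size sum_stage big_seq1. Qed.

(** A step has at most three successors, and more than one only if it uses a unit of budget. *)
Lemma size_split_stage s F st :
  size (stage (same s) (@split_step n n') F [:: st]) <= 3 ^ st.1.
Proof.
rewrite size_stage_sum; elim: F st => [|C F IH] st /=; first by rewrite expn_gt0.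
case: C => // l C; case: same => [[z w]|] //.
apply: leq_trans (_ : \sum_(st' <- split_step z w st) 3 ^ st'.1 <= _).
  by apply: leq_sum => st' _; apply: IH.
case: st => t p /=; case: ifP => _; first by rewrite big_seq1.
case: ifP => _; first by case: ifP => _; rewrite ?big_nil ?big_seq1.
case: ifP => _; first by rewrite big_seq1.
case: ifP => _; first by rewrite big_seq1.
case: t => [|t]; first by rewrite big_nil.
by rewrite !big_cons big_nil /= expnS; lia.
Qed.

(** The leaves are disjoint cubes over x, each with at least one assignment. *)
Lemma size_xstage_le F d : size (xstage F [:: (d, [::])]) <= 2 ^ n.
Proof.
pose b0 : assignment n' := [ffun=> false].
rewrite -(card_assignment n) -!sum1_card -sum1_size.
apply: leq_trans (_ : \sum_(st <- xstage F [:: (d, [::])]) 2 ^ room false n st.2 <= _).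
  by apply: leq_sum => st _; rewrite expn_gt0.
have E : \sum_(st <- xstage F [:: (d, [::])]) 2 ^ room false n st.2 =
    \sum_(st <- xstage F [:: (d, [::])]) \sum_a consistent a b0 st.2.
  apply: eq_big_seq => st /xstage_cube/andP[ind px].
  rewrite -card_cons_x // card_pred_sum; apply: eq_bigr => a _.
  by rewrite consistent_x.
rewrite E exchange_big /=; apply: leq_sum => a _.
rewrite sum_stage big_seq1; apply: leq_trans (split_total_le _ _ _ _ _) _.
by case: (_ && _).
Qed.

Lemma ex_cons_x p : independent p -> exists a, cons_x a p.
Proof.
move=> ind; have := card_cons_x ind.
case: (pickP [pred a | cons_x a p]) => [a ap|none] ; first by exists a.
by rewrite (eq_card0 none) => /eqP; rewrite eq_sym expn_eq0.
Qed.

Lemma extensions_le F a p : extensions F a p <= 2 ^ n'.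
Proof. by rewrite -(card_assignment n') max_card. Qed.

Lemma size_ystage_le F d p : independent p -> size (ystage F [:: (d, p)]) <= 2 ^ n'.
Proof.
move=> ind; have [a ca] := ex_cons_x ind; apply: leq_trans (extensions_le F a p).
apply: leq_trans (sum_ystage_le F d ind ca); rewrite -sum1_size.
by apply: leq_sum => st _; rewrite expn_gt0.
Qed.

Lemma volume_le_pow F q d p : independent p -> volume F q d p <= 2 ^ n' * q.
Proof.
move=> ind; have [a ca] := ex_cons_x ind; apply: leq_trans (volume_le _ _ _ ind ca) _.
by rewrite leq_mul2r extensions_le orbT.
Qed.

Lemma leaf_sums_le F rho sigma : is_2cnf F -> 0 < sigma.1 < sigma.2 ->
  (leaf_sums F rho sigma).1 <= 2 ^ n /\ (leaf_sums F rho sigma).2 <= 2 ^ n * rho.2.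
Proof.
move=> two s01; have le : (leaf_sums F rho sigma).1 <= 2 ^ n.
  rewrite leaf_sums1 // -(card_assignment n) -sum1_card; apply: leq_sum => a _.
  apply: leq_trans (leq_mul (leq_b1 _) (split_total_le _ _ _ _ _)) _.
  by case: (_ && _).
split=> //; have -> : (leaf_sums F rho sigma).2 = (leaf_sums F rho sigma).1 * rho.2.
  by rewrite /leaf_sums foldl_add_leaves /= !add0n.
by rewrite leq_mul2r le orbT.
Qed.

Lemma force_sum_le F a st :
  force_sum F (fun st => cons_x a st.2 && true) st <= cons_x a st.2.
Proof.
elim: F st => [|C F IH] st /=; first by rewrite andbT.
case: C => // l C; case E: (mixed (l :: C)) => [[z w]|] //.
have [sz sw] := mixed_side E.
have zN : sat_x a (neg z) = ~~ sat_x a z.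
  by move: sz; rewrite /side /sat_x /=; case: (z.1) => // i _; case: (a i); case: (z.2).
apply: leq_trans (_ : \sum_(st' <- force_step z w st) cons_x a st'.2 <= _).
  by apply: leq_sum => st' _; apply: IH.
case: st => t p /=; case: ifP => _; first by rewrite big_seq1.
case: ifP => _.
  by case: ifP => _; rewrite ?big_nil ?big_seq1 //= /cons_x /=; case: (sat_x a z).
case: t => [|t]; case: ifP => _; rewrite ?big_cons ?big_nil //= ?addn0 /cons_x /=.
- by case: (sat_x a z).
- by case: (sat_x a w).
- by rewrite zN; case: (sat_x a z); case: (sat_x a w) => /=; lia.
Qed.

(** The x-parts of the leaves are nonempty and disjoint, because the two options of a step disagree
    on z. *)
Lemma size_mstage_le F st : independent st.2 -> size (mstage F [:: st]) <= 2 ^ n.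
Proof.
move=> ind; rewrite -(card_assignment n) -sum1_card -sum1_size.
apply: leq_trans (_ : \sum_(st' <- mstage F [:: st]) true * 2 ^ room false n st'.2 <= _).
  by apply: leq_sum => st' _; rewrite mul1n expn_gt0.
rewrite (sum_mstage F (fun=> true) ind); apply: leq_sum => a _.
exact: leq_trans (force_sum_le F a st) (leq_b1 _).
Qed.

(** Distinct pairs of literals are counted instead of clauses, so that the bound depends on the
    number of variables and not on the length of F. *)
Definition pending F p : seq (lit * lit) :=
  undup [seq c <- pmap (@mixed n n') F | (c.1 \notin p) && (c.2 \notin p)].

Lemma size_pending F p : size (pending F p) <= (2 * (n + n')) ^ 2.
Proof.
rewrite -(card_uniqP (undup_uniq _)); apply: leq_trans (max_card _) _.
by rewrite !card_prod card_sum !card_ord card_bool; lia.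
Qed.

Lemma pending_sub C F p q : {subset p <= q} ->
  size (pending F q) <= size (pending (C :: F) p).
Proof.
move=> sub; apply: uniq_leq_size (undup_uniq _) _ => c.
rewrite !mem_undup !mem_filter => /andP[/andP[c1 c2] cF].
rewrite (contra (@sub _) c1) (contra (@sub _) c2) /=.
by case: (mixed C) => [e|] //; rewrite inE cF orbT.
Qed.

Lemma pending_lt C F p q z l : mixed C = Some (z, l) -> z \notin p -> l \notin p ->
  {subset p <= q} -> (z \in q) || (l \in q) ->
  (size (pending F q)).+1 <= size (pending (C :: F) p).
Proof.
move=> E zp lp sub zlq; rewrite -[_.+1]/(size ((z, l) :: pending F q)).
apply: uniq_leq_size => [|c].
  rewrite /= undup_uniq andbT mem_undup mem_filter /=.
  by case/orP: zlq => ->; rewrite ?andbF.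
rewrite inE !mem_undup !mem_filter /= E => /orP[/eqP->|/andP[/andP[c1 c2] cF]].
  by rewrite /= zp lp mem_head.
by rewrite (contra (@sub _) c1) (contra (@sub _) c2) /= inE cF orbT.
Qed.

(** With k pairs pending and budget t, either option settles a pair and the second also costs
    budget, giving at most k ^ t + k ^ (t - 1) = (k + 1) k ^ (t - 1) <= (k + 1) ^ t leaves. *)
Lemma size_mstage_pending F st :
  force_sum F (fun=> 1) st <= (size (pending F st.2)).+1 ^ st.1.
Proof.
elim: F st => [|C F IH] st; first by rewrite /= expn_gt0.
have sub (q p : seq lit) : {subset p <= q ++ p} by move=> l lp; rewrite mem_cat lp orbT.
have mono := pending_sub C F (sub [::] st.2).
case: C mono => [|l0 C] mono //; rewrite [branch_sum _ _ _ _ _]/=.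
case E: (mixed (l0 :: C)) => [[z l]|]; last first.
  by apply: leq_trans (IH st) _; apply: leq_exp2rW; rewrite ltnS.
have one st' q t : st'.2 = q ++ st.2 -> z \notin st.2 -> l \notin st.2 ->
    (z \in q) || (l \in q) -> st'.1 <= t ->
    force_sum F (fun=> 1) st' <= (size (pending ((l0 :: C) :: F) st.2)) ^ t.
  move=> Eq zp lp zlq let_; apply: leq_trans (IH st') _.
  have lt := @pending_lt (l0 :: C) F st.2 st'.2 z l E zp lp.
  rewrite Eq in lt *; have {}lt := lt (sub q _); rewrite !mem_cat in lt.
  have {}lt : (size (pending F (q ++ st.2))).+1 <= size (pending ((l0 :: C) :: F) st.2).
    by apply: lt; case/orP: zlq => ->; rewrite ?orbT.
  apply: leq_trans (leq_exp2rW _ lt) _; rewrite leq_pexp2l //.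
  exact: leq_ltn_trans lt.
move: one IH mono; case: st => t p /= one IH mono; case: ifP => [_|/negbT].
  rewrite big_seq1; apply: leq_trans (IH (t, p)) _; exact: leq_exp2rW.
rewrite negb_or => /andP[zp lp]; set k := size _ in one mono *.
have z1 : force_sum F (fun=> 1) (t, z :: p) <= k ^ t.
  by apply: (one _ [:: z] t) => //; rewrite inE eqxx.
have ks : k ^ t <= k.+1 ^ t by apply: leq_exp2rW.
case: ifP => _.
  by case: ifP => _; rewrite ?big_nil ?big_seq1 // (leq_trans z1).
case: t z1 ks one => [|t] z1 ks one; case: ifP => _; rewrite ?big_nil ?big_seq1 //.
- have := one (t, l :: p) [:: l] t.+1 erefl zp lp; rewrite !inE eqxx orbT /=.
  by move=> /(_ isT (leqnSn _)) le; apply: leq_trans ks.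
- rewrite !big_cons big_nil addn0.
  have := one (t, [:: neg z, l & p]) [:: neg z; l] t erefl zp lp.
  rewrite !inE eqxx !orbT => /(_ isT (leqnn _)) le.
  apply: leq_trans (leq_add z1 le) _; rewrite expnS -[X in _ + X]mul1n -mulnDl addn1 expnS.
  by rewrite leq_mul2l leq_exp2rW ?orbT.
Qed.

Lemma size_mstage_le_pow F st :
  size (mstage F [:: st]) <= ((2 * (n + n')) ^ 2).+1 ^ st.1.
Proof.
rewrite size_stage_sum; apply: leq_trans (size_mstage_pending _ _) _.
by apply: leq_exp2rW; rewrite ltnS size_pending.
Qed.

End Bounds.

(** * Polynomial bounds and the running time of the whole program *)

Definition polynomial_bound (f : nat -> nat) : Prop :=
  exists c, forall m, f m <= c * m.+1 ^ c.

Lemma polynomial_bound_const k : polynomial_bound (fun=> k).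
Proof. by exists k => m; rewrite leq_pmulr // expn_gt0. Qed.

Lemma polynomial_bound_id : polynomial_bound id.
Proof. by exists 1 => m; rewrite mul1n expn1. Qed.

Lemma polynomial_bound_add f g : polynomial_bound f -> polynomial_bound g ->
  polynomial_bound (fun m => f m + g m).
Proof.
move=> [c cP] [d dP]; exists (c + d) => m; rewrite mulnDl.
by apply: leq_add; [apply: leq_trans (cP m) _ | apply: leq_trans (dP m) _];
  rewrite leq_mul // leq_pexp2l // ?leq_addr ?leq_addl.
Qed.

Lemma polynomial_bound_mul f g : polynomial_bound f -> polynomial_bound g ->
  polynomial_bound (fun m => f m * g m).
Proof.
move=> [c cP] [d dP]; exists (c * d + c + d) => m.
apply: leq_trans (leq_mul (cP m) (dP m)) _; rewrite mulnACA -expnD.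
by rewrite leq_mul ?leq_pexp2l // -?addnA ?leq_addr ?leq_addl.
Qed.

Lemma polynomial_bound_comp f g : polynomial_bound f -> polynomial_bound g ->
  polynomial_bound (fun m => f (g m)).
Proof.
move=> [c cP] [d dP]; exists (c * d.+1 ^ c + d * c) => m.
apply: leq_trans (cP _) _; apply: (@leq_trans (c * (d.+1 * m.+1 ^ d) ^ c)).
  rewrite leq_mul2l; apply/orP; right; apply: leq_exp2rW.
  by rewrite mulSn -add1n leq_add // expn_gt0.
by rewrite expnMn -expnM mulnA leq_mul ?leq_addr // leq_pexp2l // leq_addl.
Qed.

Lemma stage_bd_affine m L : stage_bd m L <= L.+1 * stage_bd m 1.
Proof.
rewrite /stage_bd; move: (step_bd m) => S; nia.
Qed.

Lemma heavy_bd_affine m L : heavy_bd m L <= L.+1 * heavy_bd m 1.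
Proof.
rewrite /heavy_bd; have := stage_bd_affine m L.
by move: (stage_bd m L) (stage_bd m 1) (addmul_bd m) => A B C; nia.
Qed.

(** The bound is affine in each list length, so the branch counts can be factored out and a
    polynomial in the input size remains. *)
Lemma main_bd_affine m Lx Lm Ly :
  main_bd m Lx Lm Ly <= Lx.+1 * Lm.+1 * Ly.+1 * main_bd m 1 1 1.
Proof.
rewrite /main_bd; have hx := stage_bd_affine m Lx; have hm := stage_bd_affine m Lm.
have hy := heavy_bd_affine m Ly.
move: (stage_bd m Lx) (stage_bd m Lm) (stage_bd m 1) (heavy_bd m Ly) (heavy_bd m 1)
  (addmul_bd m) (leaf_bd m) hx hm hy => A B C D E G H hx hm hy.
apply: (@leq_trans (Lx.+1 * C + Lx * (Lm.+1 * C + Lm * (Ly.+1 * E + H + 100) + 200)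
  + G + 500 * m.+1)).
  rewrite !leq_add2r leq_add // leq_mul2l; apply/orP; right.
  by rewrite leq_add2r leq_add // leq_mul2l !leq_add2r hy orbT.
nia.
Qed.

Lemma polynomial_bound_main : polynomial_bound (fun m => main_bd m 1 1 1).
Proof.
rewrite /main_bd /heavy_bd /leaf_bd /stage_bd /step_bd /mem_bd /addmul_bd.
by repeat first [ apply: polynomial_bound_add | apply: polynomial_bound_mul
  | apply: polynomial_bound_const | apply: polynomial_bound_id
  | apply: (@polynomial_bound_add (fun=> 1) _)].
Qed.

Lemma tree_size_enc_list (T : Type) (f : T -> tree) s : size s < tree_size (enc_list f s).
Proof. by elim: s => //= x s IH; lia. Qed.

Section MainCost.

Variables n n' : nat.

Definition instance (F : cnf n n') (rho sigma : nat * nat) : tree :=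
  Cons (enc_cnf F) (Cons (enc_frac rho) (enc_frac sigma)).

Lemma cost_main_le (F : cnf n n') rho sigma : is_2cnf F ->
  0 < rho.1 < rho.2 -> 0 < sigma.1 < sigma.2 ->
  cost main_prog [:: instance F rho sigma] <=
  main_bd (6 * tree_size (instance F rho sigma))
    (minn (2 ^ n) (3 ^ (3 * budget rho)))
    (minn (2 ^ n) (((2 * (n + n')) ^ 2).+1 ^ budget sigma))
    (minn (2 ^ n') (3 ^ (3 * budget sigma))).
Proof.
move=> two r01 s01.
have [h1 h2 h3] : [/\ n < tree_size (enc_unary n), n' < tree_size (enc_unary n')
  & size F < tree_size (enc_list (enc_list (@enc_literal n n')) F)].
  by have := (tree_size_enc_list enc_bool (nseq n false),
    tree_size_enc_list enc_bool (nseq n' false),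
    tree_size_enc_list (enc_list (@enc_literal n n')) F); rewrite !size_nseq => -[[]].
have hb v := tree_size_enc_list enc_bool (bits v).
have := (hb rho.1, hb rho.2, hb sigma.1, hb sigma.2) => -[[[h4 h5] h6] h7].
set m := 6 * tree_size (instance F rho sigma).
have hm : 6 * (n + n' + size F + size (bits rho.1) + size (bits rho.2) +
    size (bits sigma.1) + size (bits sigma.2)) + 12 <= m.
  rewrite /m /instance /enc_cnf /enc_frac /= -!/(enc_binary _).
  move: h1 h2 h3 h4 h5 h6 h7; rewrite /enc_binary.
  move: (tree_size _) (tree_size _) (tree_size _) (tree_size _) (tree_size _) (tree_size _)
    (tree_size _) => *; lia.
have sb k v : k + size (bits v) <= m -> forall w, w <= 2 ^ k * v -> size (bits w) <= m.
  by move=> le w /size_bits_mono; move/leq_trans; apply; apply: size_bits_mul.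
have le1 : 6 * size F <= m by lia.
have le2 : n + n' + 2 <= m by lia.
have le3 : n + n' + size (bits rho.1) <= m by lia.
have le4 : n + n' + size (bits rho.2) <= m by lia.
have le5 : n + n' + size (bits sigma.1) <= m by lia.
have le6 : n + n' + size (bits sigma.2) <= m by lia.
have {h1 h2 h3 h4 h5 h6 h7 hb hm} [leT1 leT2] := leaf_sums_le rho two s01.
apply: cost_main => //.
- move=> j; rewrite leq_min size_xstage_le; exact: size_split_stage.
- move=> st /xstage_cube/andP[ind _] j; rewrite leq_min size_mstage_le //.
  exact: size_mstage_le_pow.
- move=> st st' /xstage_cube/andP[ind _] st'_in j.
  have ind' := @mstage_independent _ _ F (budget sigma, st.2) st' ind st'_in.
  by rewrite leq_min size_ystage_le //; exact: size_split_stage.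
- move=> st st' /xstage_cube/andP[ind _] st'_in.
  have ind' := @mstage_independent _ _ F (budget sigma, st.2) st' ind st'_in.
  apply: (sb n' sigma.2); last exact: volume_le_pow.
  by apply: leq_trans le6; rewrite leq_add2r leq_addl.
- apply: leq_trans (_ : n.+1 <= _); last by lia.
  by apply: size_bits_le; apply: leq_ltn_trans leT1 _; rewrite ltn_exp2l.
- apply: (sb n rho.2) leT2.
  by apply: leq_trans le4; rewrite leq_add2r leq_addr.
Qed.

Lemma main_runs (F : cnf n n') rho sigma :
  runs (program main_prog) (instance F rho sigma)
    (enc_option enc_binary (answer F rho sigma))
    (cost main_prog [:: instance F rho sigma] + 2).
Proof. by rewrite -den_main; apply: program_runs. Qed.

End MainCost.

(** * Rational thresholds and real-valued time bounds *)

Local Open Scope ring_scope.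

Definition nat_frac (q : rat) : nat * nat := (`|numq q|%N, `|denq q|%N).

Lemma frac_bounds (q : rat) : 0 < q < 1 -> (0 < (nat_frac q).1 < (nat_frac q).2)%N.
Proof.
move=> /andP[q0 q1]; rewrite /nat_frac /=; apply/andP; split.
  by rewrite absz_gt0 numq_eq0 gt_eqF.
rewrite -ltz_nat !gez0_abs ?numq_ge0 ?ltW ?denq_gt0 //.
by move: q1; rewrite -{1}(divq_num_den q) ltr_pdivrMr ?ltr0z ?denq_gt0 // mul1r ltr_int.
Qed.

Lemma frac_le (q : rat) (c N : nat) : 0 < q -> (0 < N)%N ->
  (q <= c%:R / N%:R) = (N * (nat_frac q).1 <= c * (nat_frac q).2)%N.
Proof.
move=> q0 N0; rewrite ler_pdivlMr ?ltr0n // -{1}(divq_num_den q).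
have d0 : 0 < (denq q)%:~R :> rat by rewrite ltr0z denq_gt0.
rewrite mulrAC ler_pdivrMr // -(gez0_abs (ltW (denq_gt0 q))).
have n0 : 0 <= numq q by rewrite numq_ge0 ltW.
by rewrite -(gez0_abs n0) -!pmulrn -!natrM ler_nat mulnC.
Qed.

Lemma heavy_frac n n' (F : cnf n n') (sigma : rat) a : 0 < sigma ->
  heavy F sigma a = heavy_by F (nat_frac sigma) a.
Proof.
move=> s0; rewrite /heavy /Pr (card_assignment n') frac_le ?expn_gt0 //.
Qed.

Lemma threshold_countE n n' (F : cnf n n') (rho sigma : rat) :
  is_2cnf F -> 0 < rho < 1 -> 0 < sigma < 1 ->
  threshold_count F rho sigma = answer F (nat_frac rho) (nat_frac sigma).
Proof.
move=> two r01 s01; rewrite answerE ?frac_bounds //.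
have E : #|heavy F sigma| = #|[pred a | heavy_by F (nat_frac sigma) a]|.
  by apply: eq_card => a; rewrite !inE /= -heavy_frac //; case/andP: s01.
rewrite /threshold_count /threshold_yes /Pr (card_assignment n) E.
by rewrite frac_le ?expn_gt0 //; case/andP: r01.
Qed.

Lemma enc_instanceE n n' (F : cnf n n') (rho sigma : rat) :
  enc_instance F rho sigma = instance F (nat_frac rho) (nat_frac sigma).
Proof. by []. Qed.

Section RealBounds.

Variable R : realType.

(** The inequality ln (1 + x) <= x at x = -1/2. *)
Lemma ln2_ge : 1 / 2 <= ln 2 :> R.
Proof.
have := @le_ln1Dx R (- (1 / 2)).
rewrite (_ : 1 + - (1 / 2) = 2^-1 :> R); last by field.
rewrite lnV ?posrE // => /(_ _); lra.
Qed.

Lemma budget_ratr (q : rat) : 0 < q < 1 ->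
  2 ^+ budget (nat_frac q) <= 4 * (ratr q)^-1 :> R.
Proof.
move=> q01; have /andP[q0 _] := q01.
have le := budget_le (frac_bounds q01).
have n0 : (0 < (nat_frac q).1)%N by case/andP: (frac_bounds q01).
have E : (ratr q)^-1 = (nat_frac q).2%:R / (nat_frac q).1%:R :> R.
  rewrite /ratr invf_div /nat_frac /= !pmulrn !gez0_abs ?numq_ge0 ?(ltW q0) //.
rewrite E mulrA ler_pdivlMr ?ltr0n // mulrC.
by move: le; rewrite -(@ler_nat R) !natrM natrX.
Qed.


(* Since [2 ^ k <= 4 / q], the exponent [k] is at most [2 + 2 ln (1 / q)].     *)
Lemma expr_budget_le (q : rat) (N : nat) : 0 < q < 1 -> (0 < N)%N ->
  N%:R ^+ budget (nat_frac q) <= N%:R ^+ 2 * (N%:R `^ (2 * ln (ratr q)^-1)) :> R.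
Proof.
move=> q01 N0; set k := budget _; set L := ln _.
have /andP[q0 q1] := q01.
have u0 : 0 < (ratr q)^-1 :> R by rewrite invr_gt0 ltr0q.
have L0 : 0 <= L by rewrite ln_ge0 // invf_ge1 ?ltr0q // -(rmorph1 (@ratr R)) ler_rat ltW.
have kL : k%:R <= 2 + 2 * L :> R.
  have := budget_ratr q01; rewrite -/k => le.
  have : ln (2 ^+ k : R) <= ln (4 * (ratr q)^-1).
    by rewrite ler_ln ?posrE ?exprn_gt0 // mulr_gt0.
  rewrite lnXn // lnM ?posrE // -/L (_ : 4 = 2 ^+ 2 :> R) ?lnXn //; last by ring.
  have := ln2_ge; set l2 := ln (2 : R); rewrite -!(mulr_natl l2) => h2 h.
  have [k2|k2] := leP k%:R (2 : R); first by lra.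
  have h3 : 0 <= (k%:R - 2) * (l2 - 1 / 2).
    by apply: mulr_ge0; lra.
  by move: h h3; move: (k%:R : R) => x; lra.
have N1 : 1 <= N%:R :> R by rewrite ler1n.
rewrite -!powR_mulrn ?ler0n // -powRD; last by rewrite pnatr_eq0 -lt0n N0 implybT.
by apply: ler_powR.
Qed.

End RealBounds.

Local Open Scope nat_scope.

(** Passes to the shape of bound in the theorem; allowing every larger d leaves room to meet other
    demands with the same constant. *)
Lemma polynomial_bound_size f : polynomial_bound f ->
  exists c, forall d S, c <= d -> 0 < S -> f S <= d * S ^ d.
Proof.
case=> c cP; exists (c * 2 ^ c + c) => d S le S0; apply: leq_trans (cP S) _.
apply: (@leq_trans (c * (2 * S) ^ c)).
  by rewrite leq_mul2l leq_exp2rW ?orbT //; lia.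
rewrite expnMn mulnA leq_mul ?leq_pexp2l //.
  by apply: leq_trans le; apply: leq_addr.
by apply: leq_trans le; apply: leq_addl.
Qed.

Lemma polynomial_bound_exp f k : polynomial_bound f -> polynomial_bound (fun m => f m ^ k).
Proof.
move=> pf; elim: k => [|k IH]; first exact: polynomial_bound_const.
have [c cP] := polynomial_bound_mul pf IH.
by exists c => m; rewrite expnS.
Qed.

Definition branches (n n' K k : nat) : nat :=
  (minn (2 ^ n) (3 ^ (3 * K))).+1 *
  (minn (2 ^ n) (((2 * (n + n')) ^ 2).+1 ^ k)).+1 *
  (minn (2 ^ n') (3 ^ (3 * k))).+1.

(** For at most one variable powers of n + n' bound nothing, and the trivial counts 2 ^ n and 2 ^ n'
    take over. *)
Lemma branches_small n n' K k : n + n' <= 1 -> branches n n' K k <= 27.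
Proof.
move=> le; have h2 m M : m <= 1 -> (minn (2 ^ m) M).+1 <= 3.
  by case: m => [|[|m]] // _; rewrite ltnS geq_min.
by rewrite -[27]/(3 * 3 * 3) !leq_mul // h2 //; lia.
Qed.

(** For N >= 2 one has 27 <= 2 ^ 5 <= N ^ 5 and (2 N) ^ 2 + 1 <= 8 N ^ 2 <= N ^ 5. *)
Lemma branches_large n n' K k : 1 < n + n' ->
  branches n n' K k <= 8 * (2 ^ K) ^ 5 * ((n + n') ^ k) ^ 10.
Proof.
move=> lt; set N := n + n'.
have pow b x y : b ^ 5 = y -> 0 < y -> x <= y -> forall e, x ^ e + 1 <= 2 * (b ^ e) ^ 5.
  move=> Eb y0 le e; rewrite -expnM (mulnC e) expnM Eb mul2n -addnn leq_add ?leq_exp2rW //.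
  by rewrite expn_gt0 y0.
have h1 : (minn (2 ^ n) (3 ^ (3 * K))).+1 <= 2 * (2 ^ K) ^ 5.
  apply: leq_trans (_ : 27 ^ K + 1 <= _); last exact: (@pow 2 27 32).
  by rewrite addn1 ltnS expnM geq_min leqnn orbT.
have N5 : 8 * N ^ 2 <= N ^ 5.
  by rewrite (expnD N 3 2) leq_mul2r -[8]/(2 ^ 3) leq_exp2rW ?orbT.
have N0 : 0 < N ^ 5 by rewrite expn_gt0 ltnW.
have h2 : (minn (2 ^ n) (((2 * N) ^ 2).+1 ^ k)).+1 <= 2 * (N ^ k) ^ 5.
  apply: leq_trans (_ : ((2 * N) ^ 2).+1 ^ k + 1 <= _); last first.
    apply: (@pow N _ (N ^ 5)) => //; apply: leq_trans N5; rewrite expnMn.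
    have : 0 < N ^ 2 by rewrite expn_gt0 ltnW.
    by move: (N ^ 2) => M; lia.
  by rewrite addn1 ltnS geq_min leqnn orbT.
have h3 : (minn (2 ^ n') (3 ^ (3 * k))).+1 <= 2 * (N ^ k) ^ 5.
  apply: leq_trans (_ : 27 ^ k + 1 <= _); last first.
    apply: (@pow N _ (N ^ 5)) => //; apply: (@leq_trans (2 ^ 5)) => //.
    exact: leq_exp2rW.
  by rewrite addn1 ltnS expnM geq_min leqnn orbT.
apply: leq_trans (leq_mul (leq_mul h1 h2) h3) _; rewrite (expnD _ 5 5).
by move: (_ ^ 5) ((N ^ k) ^ 5) => A B; rewrite eq_leq //; ring.
Qed.

Lemma cost_main_branches n n' (F : cnf n n') rho sigma : is_2cnf F ->
  0 < rho.1 < rho.2 -> 0 < sigma.1 < sigma.2 ->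
  cost main_prog [:: instance F rho sigma] <=
    branches n n' (budget rho) (budget sigma) *
    main_bd (6 * tree_size (instance F rho sigma)) 1 1 1.
Proof.
move=> two r01 s01; apply: leq_trans (cost_main_le two r01 s01) _.
exact: main_bd_affine.
Qed.

Lemma tree_size_gt0 t : 0 < tree_size t.
Proof. by case: t. Qed.

Lemma instance_vars n n' (F : cnf n n') rho sigma :
  n + n' <= tree_size (instance F rho sigma).
Proof.
have := (tree_size_enc_list enc_bool (nseq n false),
    tree_size_enc_list enc_bool (nseq n' false)); rewrite !size_nseq => -[].
rewrite /instance /enc_cnf /= -!/(enc_unary _).
by move: (tree_size _) (tree_size _) => *; lia.
Qed.

Local Open Scope ring_scope.

(** The cost is at most x B, with x polynomial in the input size and B a power of 1 / rho times a
    power of n ^ ln (1 / sigma). As x B <= x ^ 2 + B ^ 2, the product becomes the required sum. *)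
Lemma main_time (R : realType) : exists c : nat,
  forall (n n' : nat) (F : cnf n n') (rho sigma : rat),
    is_2cnf F -> 0 < rho < 1 -> 0 < sigma < 1 ->
    (cost main_prog [:: enc_instance F rho sigma] + 2)%:R <=
    (c * tree_size (enc_instance F rho sigma) ^ c)%:R
      + threshold_time R c (n + n') rho sigma.
Proof.
(* The constant comes from 8 (4 / rho) ^ 5; it is kept behind an equation so that the numeral is not
   unfolded. *)
have [D DE] : exists D, D = (8 * 4 ^ 5)%N by eexists.
pose A (S : nat) := (D * S ^ 20 * main_bd (6 * S) 1 1 1 + 2)%N.
have pA : polynomial_bound (fun S => (27 * main_bd (6 * S) 1 1 1 + 2 + A S ^ 2)%N).
  have pm := polynomial_bound_comp polynomial_bound_main
    (polynomial_bound_mul (polynomial_bound_const 6) polynomial_bound_id).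
  have p2 := polynomial_bound_const 2.
  have pS := polynomial_bound_exp 20 polynomial_bound_id.
  have pB := polynomial_bound_add
    (polynomial_bound_mul (polynomial_bound_mul (polynomial_bound_const D) pS) pm) p2.
  exact: polynomial_bound_add (polynomial_bound_add
    (polynomial_bound_mul (polynomial_bound_const 27) pm) p2) (polynomial_bound_exp 2 pB).
have [c0 c0P] := polynomial_bound_size pA.
(* The exponents in B ^ 2 are 10 and 40, so 40 suffices on top of c0. *)
pose c := (c0 + 40)%N; exists c => n n' F rho sigma two r01 s01.
have S0 := tree_size_gt0 (enc_instance F rho sigma).
have := c0P c _ (leq_addr 40 c0) S0.
have := cost_main_branches two (frac_bounds r01) (frac_bounds s01).
rewrite -enc_instanceE; have := instance_vars F (nat_frac rho) (nat_frac sigma).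
rewrite -enc_instanceE; move: (tree_size _) S0 => S S0 leN leC leA.
have u1 (q : rat) : 0 < q < 1 -> 1 <= (ratr q)^-1 :> R.
  move=> /andP[q0 q1]; rewrite invf_ge1 ?ltr0q // -(rmorph1 (@ratr R)).
  by rewrite ler_rat ltW.
have r1 := u1 _ r01; have L0 : 0 <= ln (ratr sigma)^-1 :> R by rewrite ln_ge0 ?u1.
have tt0 : 0 <= threshold_time R c (n + n') rho sigma.
  by rewrite /threshold_time !mulr_ge0 ?exprn_ge0 ?powR_ge0 // (le_trans ler01).
have [N1|N1] := leqP (n + n') 1.
  apply: ler_wpDr => //; rewrite ler_nat; apply: leq_trans leA.
  have := leq_mul (branches_small (budget (nat_frac rho)) (budget (nat_frac sigma)) N1)
    (leqnn (main_bd (6 * S) 1 1 1)).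
  by move: leC; lia.
have N0 : (0 < n + n')%N by apply: ltnW.
set N := (n + n')%N in N1 N0 leN tt0 *.
pose r : R := (ratr rho)^-1; pose W : R := N%:R `^ ln (ratr sigma)^-1.
have W1 : 1 <= W.
  by rewrite /W -[leLHS](powRr0 (N%:R : R)) ler_powR // ler1n.
pose B : R := r ^+ 5 * W ^+ 20.
have B1 : 1 <= B by rewrite mulr_ege1 // exprn_ege1.
have c40 : (40 <= c)%N by apply: leq_addl.
have leB : B ^+ 2 <= threshold_time R c N rho sigma.
  rewrite /B /threshold_time exprMn -!exprM -/r.
  have c1 : 1 <= c%:R :> R by rewrite ler1n /c addn_gt0 orbT.
  have -> : N%:R `^ (c%:R * ln (ratr sigma)^-1) = W ^+ c.
    by rewrite mulrC powRrM powR_mulrn ?powR_ge0.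
  have W0 : 0 <= W by rewrite powR_ge0.
  have r0 : 0 <= r by apply: le_trans r1.
  apply: ler_pM; rewrite ?exprn_ge0 //; last by apply: ler_weXn2l => //; apply: leq_trans c40.
  rewrite -[leLHS]mul1r; apply: ler_pM; rewrite ?exprn_ge0 //.
  by apply: ler_weXn2l => //; apply: leq_trans c40.
have leT : (cost main_prog [:: enc_instance F rho sigma] + 2)%:R <= (A S)%:R * B.
  have h1 := leq_trans leC (leq_mul
    (branches_large (budget (nat_frac rho)) (budget (nat_frac sigma)) N1) (leqnn _)).
  move: h1 {leC leA pA c0P}; rewrite /A -/N.
  move: (main_bd _ _ _ _) (cost main_prog _) => Q C leC.
  have hK : ((2 ^ budget (nat_frac rho)) ^ 5)%:R <= (4 * r) ^+ 5 :> R.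
    by rewrite !natrX lerXn2r ?nnegrE ?exprn_ge0 ?budget_ratr // mulr_ge0 // (le_trans ler01).
  (* The factor N ^ 20 coming from the additive constant in the budget is absorbed by the input
     size. *)
  have hk : ((N ^ budget (nat_frac sigma)) ^ 10)%:R <= S%:R ^+ 20 * W ^+ 20 :> R.
    have := expr_budget_le R s01 N0.
    rewrite [2 * _]mulrC powRrM -/W -[W `^ 2]/(W `^ (2%:R)) powR_mulrn ?powR_ge0 // => le.
    rewrite !natrX; apply: le_trans (_ : (N%:R ^+ 2 * W ^+ 2) ^+ 10 <= _).
      by rewrite lerXn2r ?nnegrE ?mulr_ge0 ?exprn_ge0 ?(le_trans ler01 W1).
    rewrite exprMn -!exprM ler_wpM2r ?exprn_ge0 ?(le_trans ler01 W1) //.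
    by rewrite lerXn2r ?nnegrE ?ler0n // ler_nat.
  have le1 : (C + 2)%:R <= 8 * ((2 ^ budget (nat_frac rho)) ^ 5)%:R
      * ((N ^ budget (nat_frac sigma)) ^ 10)%:R * Q%:R + 2 :> R.
    by rewrite -!natrM -natrD ler_nat leq_add2r.
  apply: le_trans le1 _.
  apply: le_trans (_ : 8 * (4 * r) ^+ 5 * (S%:R ^+ 20 * W ^+ 20) * Q%:R + 2 <= _).
    rewrite lerD2r ler_wpM2r ?ler0n //; apply: ler_pM; rewrite ?mulr_ge0 ?ler0n //.
    by rewrite ler_wpM2l ?ler0n.
  have DR : D%:R = 8 * 4 ^+ 5 :> R by rewrite DE natrM natrX.
  rewrite natrD natrM [(D * _)%:R]natrM natrX DR [leRHS]mulrDl.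
  apply: lerD; last by rewrite ler_peMr ?ler0n.
  by rewrite /B exprMn le_eqVlt; apply/orP; left; apply/eqP; ring.
apply: le_trans leT _; apply: le_trans (_ : (A S)%:R ^+ 2 + B ^+ 2 <= _).
  by move: (A S)%:R => x; nra.
apply: lerD => //; rewrite -natrX ler_nat; apply: leq_trans leA; exact: leq_addl.
Qed.

Local Open Scope nat_scope.

(** * Recognition of encoded formulas *)

Fixpoint spine (t : tree) : seq tree := if t is Cons x r then x :: spine r else [::].

Definition is_nil (t : tree) : bool := if t is Nil then true else false.

Definition is_bool (t : tree) : bool :=
  match t with Nil | Cons Nil Nil => true | _ => false end.

Definition is_unary (t : tree) : bool := all is_nil (spine t).

Definition lit_ok (nn l : tree) : bool :=
  if l is Cons b (Cons s u) then
    [&& is_bool b, is_bool s, is_unary u & len u < len (if s is Nil then hd nn else tl nn)]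
  else false.

Definition clause_ok (nn C : tree) : bool := (len C <= 2) && all (lit_ok nn) (spine C).

Definition cnf_ok (x : tree) : bool :=
  if x is Cons n (Cons n' F) then
    [&& is_unary n, is_unary n' & all (clause_ok (Cons n n')) (spine F)]
  else false.

Lemma spine_enc_list (T : Type) (f : T -> tree) s : spine (enc_list f s) = map f s.
Proof. by elim: s => //= x s ->. Qed.

Lemma is_boolP t : reflect (exists b, t = enc_bool b) (is_bool t).
Proof.
case: t => [|[|x y] [|z w]]; apply: (iffP idP) => //; try by case=> [[]].
  by exists false.
by exists true.
Qed.

Lemma is_unaryE t : is_unary t -> t = enc_unary (len t).
Proof. by elim: t => // -[|y z] _ r IH //= /IH->; rewrite len_enc_unary. Qed.

Lemma is_unary_enc k : is_unary (enc_unary k).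
Proof. by elim: k. Qed.

Lemma enc_list_exists (T : Type) (f : T -> tree) (P : pred tree) t :
  (forall x, P x -> exists y, x = f y) -> all P (spine t) ->
  exists s, t = enc_list f s.
Proof.
move=> PE; elim: t => [|x _ r IH] /=; first by exists [::].
move=> /andP[/PE[y ->] /IH[s ->]]; by exists (y :: s).
Qed.

Lemma lit_okP n n' l :
  lit_ok (Cons (enc_unary n) (enc_unary n')) l <-> exists x : literal n n', l = enc_literal x.
Proof.
split; last first.
  case=> -[[i|j] b] -> /=; rewrite is_unary_enc !len_enc_unary ltn_ord;
    by case: b.
case: l => [|b [|s u]] //= /and4P[/is_boolP[c ->] /is_boolP[[] ->] /is_unaryE-> /=];
  rewrite !len_enc_unary => lt.
  by exists (inr (Ordinal lt), c).
by exists (inl (Ordinal lt), c).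
Qed.

Lemma cnf_okP x :
  cnf_ok x <-> exists n n' (F : cnf n n'), x = enc_cnf F /\ is_2cnf F.
Proof.
split; last first.
  move=> [n [n' [F [-> two]]]]; rewrite /= !is_unary_enc /=.
  rewrite spine_enc_list all_map; apply: sub_all two => C /= leC.
  rewrite /clause_ok len_enc_list leC spine_enc_list all_map /=.
  by apply/allP => l _; apply: (proj2 (@lit_okP n n' _)); exists l.
case: x => [|u [|u' G]] //= /and3P[/is_unaryE-> /is_unaryE->].
move: (len u) (len u') => n n' {u u'} ok; exists n, n'.
have [|F EG] := @enc_list_exists _ (enc_list (@enc_literal n n')) _ _ _ ok.
  by move=> C /andP[_]; apply: enc_list_exists => l /lit_okP.
exists F; rewrite EG; split=> //; move: ok.
rewrite EG spine_enc_list all_map; apply: sub_all => C /andP[].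
by rewrite len_enc_list.
Qed.

Definition all_prog (q : prog) : prog :=
  fun2 (fun c l => fold l ETrue (fun acc x =>
    ite acc (call q [:: c; x]) (ret ENil))).

Lemma den_all q (P : tree -> tree -> bool) c l :
  (forall x, den q [:: c; x] = enc_bool (P c x)) ->
  den (all_prog q) [:: c; l] = enc_bool (all (P c) (spine l)).
Proof.
move=> qE; rewrite /= /evl /=.
have E b : iter_tree (fun r acc => match acc with Nil => Nil | Cons _ _ => den q [:: c; hd r] end)
    l (enc_bool b) = enc_bool (b && all (P c) (spine l)).
  elim: l b => [|x _ r IH] [] //=; rewrite ?andbT // ?qE ?IH //.
  exact: (IH false).
exact: (E true).
Qed.

(** The body need only be cheap on remaining lists of size at most S, which covers all tails of
    [l]. *)
Lemma iter_cost_size S B g c l acc :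
  (forall r a, tree_size r <= S -> c r a <= B) -> tree_size l <= S ->
  iter_cost g c l acc <= S * (B + 10).
Proof.
move=> cB leS; have lenS t : len t <= tree_size t by elim: t => //= *; lia.
apply: leq_trans (_ : len l * (B + 10) <= _); last first.
  by rewrite leq_mul2r (leq_trans (lenS l) leS) orbT.
elim: l acc leS => //= x _ r IH acc leS.
rewrite mulSn leq_add ?leq_add2r ?cB // IH //.
by move: leS => /=; lia.
Qed.

Lemma cost_all q c l S B :
  (forall x, tree_size x <= S -> cost q [:: c; x] <= B) -> tree_size l <= S ->
  cost (all_prog q) [:: c; l] <= S * (B + 30) + 20.
Proof.
move=> qB leS; rewrite /= /evl /=.
set g := fun r acc => _; set k := fun _ _ : tree => _.
have := @iter_cost_size S (B + 20) g k l (Cons Nil Nil) _ leS.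
move=> /(_ _); suff H : forall r a, tree_size r <= S -> k r a <= B + 20.
  by move=> /(_ H); lia.
move=> r a ler; rewrite /k; case: a => [|? ?]; first by lia.
have hdr : tree_size (hd r) <= S by apply: leq_trans ler; case: (r) => //= *; lia.
by have := qB _ hdr; rewrite /= /evl /=; lia.
Qed.

Definition nil_prog : prog := fun2 (fun _ x => ite x (ret ENil) (ret ETrue)).

Definition bool_prog : prog :=
  fun1 (fun t => ite t (ite (EHd t) (ret ENil) (ite (ETl t) (ret ENil) (ret ETrue)))
                       (ret ETrue)).

Definition lt_prog : prog :=
  fun2 (fun u n => LET r := fold u n (fun acc _ => ret (ETl acc)) IN
    ite r (ret ETrue) (ret ENil)).

Definition lit_ok_prog : prog :=
  fun2 (fun nn l =>
    ite (ETl l)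
      (LET b := call bool_prog [:: EHd l] IN
       LET s := call bool_prog [:: EHd (ETl l)] IN
       LET u := call (all_prog nil_prog) [:: ENil; ETl (ETl l)] IN
       ite b (ite s (ite u
         (ite (EHd (ETl l)) (call lt_prog [:: ETl (ETl l); ETl nn])
                            (call lt_prog [:: ETl (ETl l); EHd nn]))
         (ret ENil)) (ret ENil)) (ret ENil))
      (ret ENil)).

Definition clause_ok_prog : prog :=
  fun2 (fun nn C => ite (ETl (ETl C)) (ret ENil) (call (all_prog lit_ok_prog) [:: nn; C])).

Definition cnf_ok_prog : prog :=
  fun1 (fun x => ite (ETl x)
    (LET u := call (all_prog nil_prog) [:: ENil; EHd x] IN
     LET v := call (all_prog nil_prog) [:: ENil; EHd (ETl x)] IN
     LET w := call (all_prog clause_ok_prog)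
       [:: ECons (EHd x) (EHd (ETl x)); ETl (ETl x)] IN
     ite u (ite v (ret w) (ret ENil)) (ret ENil))
    (ret ENil)).

Lemma den_unary_ok c t : den (all_prog nil_prog) [:: c; t] = enc_bool (is_unary t).
Proof. by rewrite (@den_all _ (fun=> is_nil)) // => -[]. Qed.

Lemma den_bool t : den bool_prog [:: t] = enc_bool (is_bool t).
Proof. by case: t => [|[|? ?] [|? ?]]. Qed.

Lemma den_lt u n : den lt_prog [:: u; n] = enc_bool (len u < len n).
Proof.
rewrite /= /evl /=.
have -> : (len u < len n) = non_nil (iter_tree
    (fun _ acc => match acc with Nil => Nil | Cons _ t => t end) u n).
  elim: u n => [|x _ u IH] [|y n] //=; rewrite -?IH //.
by case: (iter_tree _ _ _).
Qed.

Lemma len_le_size t : len t <= tree_size t.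
Proof. by elim: t => //= *; lia. Qed.

Lemma cost_unary_ok c t S : tree_size t <= S ->
  cost (all_prog nil_prog) [:: c; t] <= S * 60 + 20.
Proof.
move=> le; apply: leq_trans (@cost_all nil_prog c t S 30 _ le) _ => //.
by move=> x _; case: x.
Qed.

Lemma cost_bool t : cost bool_prog [:: t] <= 30.
Proof. by case: t => [|[|? ?] [|? ?]]. Qed.

Lemma cost_lt u n S : tree_size u <= S -> cost lt_prog [:: u; n] <= 20 * S + 40.
Proof.
move=> leS; rewrite /= /evl /=.
set g := fun r acc => _; set k := fun _ _ : tree => _.
have := @iter_cost_le 10 g k u n (fun _ _ => isT); have := len_le_size u.
by move: (iter_cost _ _ _ _) => C; split_tests; lia.
Qed.

#[local] Opaque nil_prog bool_prog lt_prog all_prog.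

Lemma den_lit_ok nn l : den lit_ok_prog [:: nn; l] = enc_bool (lit_ok nn l).
Proof.
case: l => [|b [|s u]] //; rewrite /= /evl /= !den_bool den_unary_ok.
case: (is_bool b) => //=; case: (is_bool s) => //=; case: (is_unary u) => //=.
by case: s => [|? ?] /=; rewrite /evl /= den_lt.
Qed.

#[local] Opaque lit_ok_prog.

Lemma den_clause_ok nn C : den clause_ok_prog [:: nn; C] = enc_bool (clause_ok nn C).
Proof.
rewrite /clause_ok; case: C => [|x [|y [|z C]]] //=; rewrite /evl /=;
  by rewrite (den_all _ (den_lit_ok nn)).
Qed.

#[local] Opaque clause_ok_prog.

Lemma den_cnf_ok x : den cnf_ok_prog [:: x] = enc_bool (cnf_ok x).
Proof.
case: x => [|u [|v G]] //; rewrite /= /evl /= !den_unary_ok.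
by rewrite (den_all _ (den_clause_ok _)); case: (is_unary u); case: (is_unary v).
Qed.

Definition lit_ok_bd (S : nat) : nat := 200 * S + 300.
Definition clause_ok_bd (S : nat) : nat := S * (lit_ok_bd S + 30) + 100.
Definition cnf_ok_bd (S : nat) : nat :=
  S * (clause_ok_bd S + 30) + 2 * (S * 60 + 20) + 200.

#[local] Transparent lit_ok_prog.

Lemma cost_lit_ok nn l S : tree_size l <= S ->
  cost lit_ok_prog [:: nn; l] <= lit_ok_bd S.
Proof.
rewrite /lit_ok_bd => leS; case: l leS => [|b [|s u]] leS; rewrite /= /evl /=; try by lia.
rewrite !den_bool den_unary_ok.
have leu : tree_size u <= S by apply: leq_trans leS; rewrite /=; lia.
have := (cost_bool b, cost_bool s, cost_unary_ok Nil leu) => -[[]].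
have h v := @cost_lt u v S leu.
case: (is_bool b); case: (is_bool s); case: (is_unary u); try by rewrite /=; lia.
by case: s {leS} => [|? ?]; rewrite /= /evl /=;
  [have := h (hd nn) | have := h (tl nn)]; rewrite /hd /tl; lia.
Qed.

#[local] Opaque lit_ok_prog.
#[local] Transparent clause_ok_prog.

Lemma cost_clause_ok nn C S : tree_size C <= S ->
  cost clause_ok_prog [:: nn; C] <= clause_ok_bd S.
Proof.
move=> leS; have := @cost_all lit_ok_prog nn C S (lit_ok_bd S) (fun x => @cost_lit_ok nn x S) leS.
rewrite /clause_ok_bd; case: C leS => [|x [|y [|z C]]] leS; rewrite /= /evl /=;
  move: (lit_ok_bd S) (cost (all_prog _) _) => *; lia.
Qed.

#[local] Opaque clause_ok_prog.

Lemma cost_cnf_ok x : cost cnf_ok_prog [:: x] <= cnf_ok_bd (tree_size x).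
Proof.
have := leqnn (tree_size x); move: {2 3}(tree_size x) => S leS.
case: x leS => [|u [|v G]] leS; rewrite /cnf_ok_bd /= /evl /=; try by lia.
have leu : tree_size u <= S by apply: leq_trans leS; rewrite /=; lia.
have lev : tree_size v <= S by apply: leq_trans leS; rewrite /=; lia.
have leG : tree_size G <= S by apply: leq_trans leS; rewrite /=; lia.
have := (cost_unary_ok Nil leu, cost_unary_ok Nil lev,
  @cost_all clause_ok_prog (Cons u v) G S (clause_ok_bd S) (fun x => @cost_clause_ok (Cons u v) x S) leG).
case=> [[]]; rewrite !den_unary_ok; move: (clause_ok_bd S) => B.
move: (cost _ [:: Nil; u]) (cost _ [:: Nil; v]) (cost _ [:: _; G]) => C1 C2 C3 *.
by case: (is_unary u); case: (is_unary v); rewrite /=; lia.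
Qed.

(* The decision procedure for MAJ-MAJ-2SAT *)
#[local] Opaque cnf_ok_prog main_prog.

(** Numerator 1 and denominator 2 in binary, least significant bit first. *)
Definition half : expr :=
  ECons (ECons ETrue ENil) (ECons ENil (ECons ETrue ENil)).

Definition decide_prog : prog :=
  fun1 (fun x => LET ok := call cnf_ok_prog [:: x] IN
    ite ok (LET r := call main_prog [:: ECons x (ECons half half)] IN
            ite r (ret ETrue) (ret ENil)) (ret ENil)).

Lemma enc_halfE : enc_frac (1, 2) =
  Cons (Cons (Cons Nil Nil) Nil) (Cons Nil (Cons (Cons Nil Nil) Nil)).
Proof. by rewrite /enc_frac /enc_binary -[1]/(num [:: true]) -[2]/(num [:: false; true]) !bits_num. Qed.

Lemma nat_frac_half : nat_frac (1 / 2)%R = (1, 2).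
Proof. by []. Qed.

Lemma decide_correct x : exists b,
  den decide_prog [:: x] = enc_bool b /\ (b <-> MAJ_MAJ_2SAT x).
Proof.
have half01 : (0 < (1 / 2 : rat) < 1)%R by [].
have main n n' (F : cnf n n') : is_2cnf F ->
    den decide_prog [:: enc_cnf F] = enc_bool (threshold_yes F (1 / 2) (1 / 2)).
  move=> two; rewrite /= /evl /= den_cnf_ok -enc_halfE.
  have -> : cnf_ok (enc_cnf F) by apply: (proj2 (cnf_okP _)); exists n, n', F.
  rewrite /= /evl /= -[Cons (enc_cnf F) _]/(instance F (1, 2) (1, 2)) den_main.
  rewrite -nat_frac_half -threshold_countE // /threshold_count.
  by case: threshold_yes.
case: (boolP (cnf_ok x)) => ok.
  have /cnf_okP[n [n' [F [-> two]]]] := ok.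
  exists (threshold_yes F (1 / 2) (1 / 2)); split; first exact: main.
  split=> [yes|]; first by exists n, n', F.
  move=> [k [k' [F' [E two' yes']]]].
  (* Two formulas with the same encoding get the same output from the program, so the answers agree
     without injectivity of the encoding. *)
  have := main _ _ F two; rewrite E main // yes'.
  by case: threshold_yes.
exists false; split; first by rewrite /= /evl /= den_cnf_ok (negbTE ok).
split=> // -[n [n' [F [E two _]]]]; case/negP: ok; apply/cnf_okP.
by exists n, n', F.
Qed.

Lemma decide_time : exists c, forall x,
  cost decide_prog [:: x] + 2 <= c * tree_size x ^ c.
Proof.
(* The budget for 1/2 is 2, so three-way branching has at most 3 ^ (3 * 2) leaves. *)
have [E EE] : exists E, E = (3 ^ 6).+1 by eexists.
pose A S := E * (((2 * S) ^ 2).+1 ^ 2).+1 * E.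
(* Appending the two encoded halves adds 28 to the size of the input. *)
pose T S := cnf_ok_bd S + A S * main_bd (6 * (S + 28)) 1 1 1 + 100.
have [c cP] : exists c, forall d S, c <= d -> 0 < S -> T S <= d * S ^ d.
  apply: polynomial_bound_size.
  have pc := polynomial_bound_const; have pid := polynomial_bound_id.
  have pS f : polynomial_bound f -> polynomial_bound (fun m => (f m).+1).
    by move=> pf; apply: (polynomial_bound_add (pc 1) pf).
  have pA : polynomial_bound A.
    apply: polynomial_bound_mul (pc E); apply: polynomial_bound_mul (pc E) _.
    apply/pS/polynomial_bound_exp/pS/polynomial_bound_exp.
    exact: polynomial_bound_mul (pc 2) pid.
  have pM := polynomial_bound_comp polynomial_bound_main
    (polynomial_bound_mul (pc 6) (polynomial_bound_add pid (pc 28))).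
  apply: polynomial_bound_add (pc 100).
  apply: polynomial_bound_add (polynomial_bound_mul pA pM).
  rewrite /cnf_ok_bd /clause_ok_bd /lit_ok_bd.
  by repeat first [ apply: polynomial_bound_add | apply: polynomial_bound_mul
    | apply: polynomial_bound_const | apply: polynomial_bound_id ].
exists c => x; apply: leq_trans (cP c _ (leqnn _) (tree_size_gt0 x)).
rewrite /= /evl /= den_cnf_ok -enc_halfE; have := cost_cnf_ok x.
case: (boolP (cnf_ok x)) => [/cnf_okP[n [n' [F [Ex two]]]]|_]; last first.
  by rewrite /= /T; move: (cost _ _) (main_bd _ _ _ _) (A _) => *; lia.
have r01 : 0 < (1, 2).1 < (1, 2).2 by [].
have := cost_main_branches two r01 r01.
have -> : budget (1, 2) = 2 by rewrite /budget -[2]/(num [:: false; true]) -[1]/(num [:: true]) !bits_num.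
have -> : tree_size (instance F (1, 2) (1, 2)) = tree_size x + 28.
  by rewrite /instance -Ex enc_halfE /=; lia.
have leA : branches n n' 2 2 <= A (tree_size x).
  have leN : n + n' <= tree_size x.
    rewrite Ex /= -!/(enc_unary _).
    have := (len_le_size (enc_unary n), len_le_size (enc_unary n')).
    by rewrite !len_enc_unary => -[]; move: (tree_size _) (tree_size _) => *; lia.
  rewrite /branches /A EE; apply: leq_mul; last by rewrite ltnS geq_min leqnn orbT.
  apply: leq_mul; first by rewrite ltnS geq_min leqnn orbT.
  rewrite ltnS geq_min; apply/orP; right; apply: leq_exp2rW; rewrite ltnS.
  by apply: leq_exp2rW; rewrite leq_mul2l leN orbT.
move=> leC; have {leC} := leq_trans leC (leq_mul leA (leqnn _)).
rewrite -[Cons (enc_frac (1, 2)) _]/(Cons (enc_frac (1, 2)) (enc_frac (1, 2))) /T.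
have -> : Cons x (Cons (enc_frac (1, 2)) (enc_frac (1, 2))) = instance F (1, 2) (1, 2).
  by rewrite Ex.
rewrite /= /evl /=; move: (cost main_prog _) (den main_prog _) (A _ * _) (cost cnf_ok_prog _).
by move=> C1 r B C2; split_tests; rewrite /=; lia.
Qed.

Theorem MAJ_MAJ_2SAT_in_P : in_P MAJ_MAJ_2SAT.
Proof.
have [c cP] := decide_time; exists (program decide_prog), c => x.
have [b [E L]] := decide_correct x; exists b, (cost decide_prog [:: x] + 2).
by split=> //; rewrite -E; apply: program_runs.
Qed.

Local Open Scope ring_scope.

Theorem theorem6p3 (R : realType) :
  in_P MAJ_MAJ_2SAT /\
  exists (p : cmd) (c : nat),
    forall (n n' : nat) (F : cnf n n') (rho sigma : rat),
      is_2cnf F -> 0 < rho < 1 -> 0 < sigma < 1 ->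
      exists2 t : nat,
        runs p (enc_instance F rho sigma)
          (enc_option enc_binary (threshold_count F rho sigma)) t &
        t%:R <= (c * tree_size (enc_instance F rho sigma) ^ c)%:R
                + threshold_time R c (n + n') rho sigma.
Proof.
split; first exact: MAJ_MAJ_2SAT_in_P.
have [c cP] := main_time R; exists (program main_prog), c.
move=> n n' F rho sigma two r01 s01.
exists (cost main_prog [:: enc_instance F rho sigma] + 2)%N; last exact: cP.
rewrite threshold_countE // enc_instanceE; exact: main_runs.
Qed.
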